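(* Let $\boldsymbol\gamma$ be product weights, let $\boldsymbol a=(a,a,\dots)$ with $a\in D$ and $\sum_{u\in\mathcal U}\gamma_uk(a,a)^{|u|}<\infty$, and let $v_k=[L_k]$, $k\in\mathbb N$, where $L_1<L_2<\cdots$ are natural numbers with $L_k=\Theta(b^k)$ for some $b\in(1,\infty)$. Let $\$(\nu)=O(\nu^s)$ for some $s>0$. Let $\alpha\ge1$, $\delta>0$, $\tau:=\min\{\alpha,\mathrm{decay}_{\boldsymbol\gamma}\}-\delta$ and $p:=\mathrm{decay}_{\boldsymbol\gamma}-\delta s$ (with $\mathrm{decay}_{\boldsymbol\gamma}<\infty$). Assume that for every $k\in\mathbb N$ (and every number $n_k$ of points) there exist randomized linear algorithms $$Q_{v_k,\boldsymbol a}(f)=\sum_{j=1}^{n_k}w_{j,k}f(\boldsymbol t^{(j,k)}_{v_k};\boldsymbol a),\quad w_{j,k}\in\mathbb R,\ \boldsymbol t^{(j,k)}_{v_k}\in D^{v_k},$$ with $\sum_{j=1}^{n_k}w_{j,k}=1$ that satisfy condition ( * ) for the set of all subsets of $v_k$. Assume further that for all $u\subseteq v_k$ there are constants $C_{u,k,\tau}$ (independent of $n_k$) with $$\mathrm{Var}(Q_{v_k,\boldsymbol a}(f_u))\le C_{u,k,\tau}(n_k-1)^{-\tau}\|f_u\|_{k_u}^2\quad\text{for all }f_u\in H_u,$$ that for all $k\ge2$ and all $j\in V_k$ $$C_{u_j,k,\tau}\,\gamma_{u_j}=O(L_{k-1}^{1-p}),$$ and that for all $k$ and all $\emptyset\neq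 u\subseteq v_{k-1}$ $$C_{u,k,\tau}\,\gamma_u=O(1),$$ with implied constants independent of $j,u,k$. Then there are a constant $C$ and an $N_0$ such that for every $N\ge N_0$ one can choose $m$ and $n_1\ge\cdots\ge n_m$ such that the resulting multilevel algorithm $Q$ has cost at most $N$ in the variable subspace sampling model and satisfies the following. If $s\ge\frac{\alpha-1}{\alpha}$: $$e(Q,B(K))^2\le C N^{-\alpha+\delta}\ \text{ if }\mathrm{decay}_{\boldsymbol\gamma}\ge1+\alpha s,\qquad e(Q,B(K))^2\le CN^{-\frac{\mathrm{decay}_{\boldsymbol\gamma}-1}{s}+\delta}\ \text{ if }1+\alpha s>\mathrm{decay}_{\boldsymbol\gamma}>1.$$ If $\frac{\alpha-1}{\alpha}>s>0$: $$e(Q,B(K))^2\le CN^{-\alpha+\delta}\ \text{ if }\mathrm{decay}_{\boldsymbol\gamma}\ge\alpha,$$ $$e(Q,B(K))^2\le CN^{-\mathrm{decay}_{\boldsymbol\gamma}+\delta}\ \text{ if }\alpha>\mathrm{decay}_{\boldsymbol\gamma}>\tfrac1{1-s},$$ $$e(Q,B(K))^2\le CN^{-\frac{\mathrm{decay}_{\boldsymbol\gamma}-1}{s}+\delta}\ \text{ if }\tfrac1{1-s}\ge\mathrm{decay}_{\boldsymbol\gamma}>1.$$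
   Context: **Function spaces.** $[n]=\{1,\dots,n\}$; $\mathcal U$ is the set of all finite subsets of $\mathbb N$. $D\subseteq\mathbb R$, $\rho$ is a probability measure on $D$, $\mu=\bigotimes_{n\in\mathbb N}\rho$ on $D^{\mathbb N}$. For a reproducing kernel $L$, $H(L)$ is its reproducing kernel Hilbert space, $\|\cdot\|_L$ its norm, $B(L)$ its closed unit ball. $k\neq0$ is a measurable reproducing kernel on $D\times D$ with $H(k)\cap H(1)=\{0\}$ ($H(1)$: constant functions), $M:=\int_D k(x,x)\,\rho(dx)<\infty$, $\int_D k(x,y)\,\rho(dx)=0$ for all $y\in D$, and $k(a,a)>0$ for all $a\in D$. The weights $\boldsymbol\gamma=(\gamma_u)_{u\in\mathcal U}$ are non-negative with $\gamma_\emptyset=1$ and $\sum_{u\in\mathcal U}\gamma_uM^{|u|}<\infty$; they are product weights if $\gamma_u=\prod_{j\in u}\gamma_j$ for a sequence $\gamma_1\ge\gamma_2\ge\cdots\ge0$. Put $k_u(\boldsymbol x,\boldsymbol y)=\prod_{j\in u}k(x_j,y_j)$ ($k_\emptyset=1$), $H_u=H(k_u)$ (functions in $H_u$ depend only on the coordinates in $u$), $\mathfrak X=\{\boldsymbol x\in D^{\mathbb N}:\sum_{u\in\mathcal U}\gamma_uk_u(\boldsymbol x,\boldsymbol x)<\infty\}$ (one has $\mu(\mathfrak X)=1$), and $K=\sum_{u\in\mathcal U}\gamma_uk_u$ on $\mathfrak X\times\mathfrak X$. $I(f)=\int_{\mathfrak X}f\,d\mu$ for $f\in H(K)$. **Decay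 and index sets.** $\widehat\gamma_u=\gamma_uk(a,a)^{|u|}$; $u_1,u_2,\dots$ is an ordering of the (infinitely many) non-empty $u\in\mathcal U$ with $\gamma_u>0$ such that $\widehat\gamma_{u_1}\ge\widehat\gamma_{u_2}\ge\cdots$; $\mathrm{decay}_{\boldsymbol\gamma}=\sup\{q\in\mathbb R:\lim_{j\to\infty}\widehat\gamma_{u_j}j^q=0\}$. $v_0=\emptyset$; $V_1=\{j\in\mathbb N:u_j\subseteq v_1\}$ and $V_k=\{j\in\mathbb N:u_j\subseteq v_k,\ u_j\not\subseteq v_{k-1}\}$ for $k\ge2$. **Condition ( * ).** $(\Omega,\Sigma,\mathbb P)$ denotes a probability space. For a finite index set $w$, random points $\boldsymbol t^{(i)}:\Omega^w\to D^w$ (with product measure $\mathbb P^w$ on $\Omega^w$) satisfy condition ( * ) for a collection $\mathcal V$ of subsets of $w$ if for all $u\in\mathcal V$, $j\in u$ and all $i$ the $j$th coordinate $t^{(i)}_j(\omega')$ depends only on $\omega'_j$ and is distributed according to $\rho$. **Multilevel algorithm.** $(\boldsymbol x_v;\boldsymbol a)$ is the point with coordinates $x_j$ for $j\in v$ and $a_j$ for $j\notin v$; $(\Psi_kf)(\boldsymbol x)=f(\boldsymbol x_{v_k};\boldsymbol a)$ for $k\ge1$, $\Psi_0=0$. The multilevel algorithm is $Q(f)=\sum_{k=1}^mQ_{v_k,\boldsymbol a}(f-\Psi_{k-1}f)$, the $m$ summands being independent. **Cost and error.** $\$:\mathbb N\cup\{0\}\to[0,\infty)$ is monotone increasing. For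 strictly increasing sequences $\mathbf v=(v_i')_{i\in\mathbb N}$ of non-empty sets in $\mathcal U$ and an anchor $\boldsymbol a\in\mathfrak X$, let $c_{\mathbf v,\boldsymbol a}(\boldsymbol x)=\inf\{\$(|v_i'|): x_j=a_j\ \forall j\notin v_i'\}$ ($\inf\emptyset=\infty$). The cost of $Q$ in the variable subspace sampling model is $\inf_{\mathbf v,\boldsymbol a}\sup_{f\in B(K)}\mathbb E(\text{sum of }c_{\mathbf v,\boldsymbol a}(\boldsymbol x)\text{ over all evaluation points }\boldsymbol x\text{ used by }Q\text{ on }f)$. The error is $e(Q,B(K))=\big(\sup_{f\in B(K)}\mathbb E((I(f)-Q(f))^2)\big)^{1/2}$.
   Formalization: At the two critical values (decay = 1+αs with s ≥ (α−1)/α, and decay = 1/(1−s) with s < (α−1)/α) the assumed variance bounds and O-conditions are also required for some smaller δ' in (0,δ); for a single fixed δ the claim fails there by a power of log N. *)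

(* Defs.v *)
From HB Require Import structures.
From mathcomp Require Import all_boot all_order all_algebra finmap.
From mathcomp Require Import all_classical all_reals all_analysis.

Set Implicit Arguments.
Unset Strict Implicit.
Unset Printing Implicit Defensive.

Import Order.TTheory GRing.Theory Num.Theory.
Import numFieldNormedType.Exports.

Local Open Scope fset_scope.
Local Open Scope classical_set_scope.
Local Open Scope ring_scope.

(* The subset D of the reals as a measurable space, with the trace of the
   Borel sigma-algebra.  The point a only serves to make the type pointed, as
   every measurableType is. *)
Definition pointed_subset (R : realType) (D : set R) (a : D) : Type := D.
HB.instance Definition _ (R : realType) (D : set R) (a : D) :=
  Choice.on (pointed_subset a).
HB.instance Definition _ (R : realType) (D : set R) (a : D) :=
  isPointed.Build (pointed_subset a) a.

Definition trace_space (R : realType) (D : set R) (a : D) : Type :=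
  g_sigma_algebra_preimageType (fun x : pointed_subset a => val x : R).
HB.instance Definition _ (R : realType) (D : set R) (a : D) :=
  Measurable.on (trace_space a).

Definition base (R : realType) (D : set R) (a : D) : trace_space a := a.

(* T^I with the product sigma-algebra, for an arbitrary index type I. *)
Definition coord_cylinders (I : Type) d (T : measurableType d) :
    set (set (I -> T)) :=
  [set C | exists i (B : set T), measurable B /\ C = [set x | B (x i)]].

Definition prodspace (I : Type) d (T : measurableType d) : Type :=
  g_sigma_algebraType (@coord_cylinders I d T).
HB.instance Definition _ (I : Type) d (T : measurableType d) :=
  Measurable.on (prodspace I T).

(* This determines mu, as the sets on the left form a pi-system that generates
   the product sigma-algebra. *)
Definition is_product_measure (R : realType) (I : choiceType) d
    (T : measurableType d) (rho : probability T R)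
    (mu : probability (prodspace I T) R) : Prop :=
  forall (J : {fset I}) (B : I -> set T),
    (forall i, measurable (B i)) ->
    mu [set x | forall i, i \in J -> B i (x i)]
    = (\prod_(i <- J) rho (B i))%E.

Definition independent_elements (R : realType) d (T : measurableType d)
    (P : probability T R) (d' : nat -> measure_display)
    (S : forall k, measurableType (d' k)) (xi : forall k, T -> S k) : Prop :=
  forall (J : {fset nat}) (B : forall k, set (S k)),
    (forall k, measurable (B k)) ->
    P [set t | forall k, k \in J -> B k (xi k t)]
    = (\prod_(k <- J) P (xi k @^-1` B k))%E.

Definition reproducing_kernel (R : realType) (E : Type) (L : E -> E -> R) : Prop :=
  (forall x y, L x y = L y x) /\
  (forall n (x : 'I_n -> E) (c : 'I_n -> R),
     0 <= \sum_(i < n) \sum_(j < n) c i * c j * L (x i) (x j)).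

(* The reproducing kernel Hilbert space of the kernel L on A x A.  A function
   on A is represented by its extension by 0 to E.  By the Moore-Aronszajn
   theorem the carrier and the inner product on it are determined by A and L. *)
Record rkhs (R : realType) (E : Type) (A : set E) (L : E -> E -> R) := RKHS {
  rkhs_carrier : set (E -> R) ;
  rkhs_inner : (E -> R) -> (E -> R) -> R ;
  rkhs_supp : forall f x, rkhs_carrier f -> ~ A x -> f x = 0 ;
  rkhs_zero : rkhs_carrier (fun=> 0) ;
  rkhs_lin : forall c f g, rkhs_carrier f -> rkhs_carrier g ->
    rkhs_carrier (fun x => c * f x + g x) ;
  rkhs_innerC : forall f g, rkhs_carrier f -> rkhs_carrier g ->
    rkhs_inner f g = rkhs_inner g f ;
  rkhs_inner_lin : forall c f g h,
    rkhs_carrier f -> rkhs_carrier g -> rkhs_carrier h ->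
    rkhs_inner (fun x => c * f x + g x) h = c * rkhs_inner f h + rkhs_inner g h ;
  rkhs_inner_ge0 : forall f, rkhs_carrier f -> 0 <= rkhs_inner f f ;
  rkhs_inner_eq0 : forall f, rkhs_carrier f -> rkhs_inner f f = 0 ->
    f = (fun=> 0) ;
  rkhs_complete : forall F : nat -> E -> R, (forall n, rkhs_carrier (F n)) ->
    (forall e, 0 < e -> exists N, forall m n, (N <= m)%N -> (N <= n)%N ->
       Num.sqrt (rkhs_inner (F m \- F n) (F m \- F n)) < e) ->
    exists2 f, rkhs_carrier f &
      (fun n => Num.sqrt (rkhs_inner (F n \- f) (F n \- f))) @ \oo --> (0 : R) ;
  rkhs_section : forall x, A x -> rkhs_carrier (patch (fun=> 0) A (L^~ x)) ;
  rkhs_reproducing : forall f x, rkhs_carrier f -> A x ->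
    rkhs_inner f (patch (fun=> 0) A (L^~ x)) = f x }.

Definition rkhs_norm (R : realType) (E : Type) (A : set E) (L : E -> E -> R)
    (H : rkhs A L) (f : E -> R) : R := Num.sqrt (rkhs_inner H f f).

Definition rkhs_ball (R : realType) (E : Type) (A : set E) (L : E -> E -> R)
    (H : rkhs A L) : set (E -> R) :=
  [set f | rkhs_carrier H f /\ rkhs_norm H f <= 1].

(* The sum of an absolutely summable family of reals. *)
Definition abs_sum (R : realType) (I : choiceType) (f : I -> R) : R :=
  fine (\esum_(i in [set: I]) (Num.max (f i) 0)%:E)
  - fine (\esum_(i in [set: I]) (Num.max (- f i) 0)%:E).

(* Coordinates and weights are indexed from 0: the coordinate n of the
   mathematical text is n.-1 here, and {1, ..., L} becomes {0, ..., L - 1}. *)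

Definition prod_weight (R : realType) (g : nat -> R) (u : {fset nat}) : R :=
  \prod_(j <- u) g j.

Definition ker_u (R : realType) d (D : measurableType d) (k : D -> D -> R)
    (u : {fset nat}) (x y : prodspace nat D) : R :=
  \prod_(j <- u) k (x j) (y j).

Definition frakX (R : realType) d (D : measurableType d) (k : D -> D -> R)
    (gamma : {fset nat} -> R) : set (prodspace nat D) :=
  [set x | (\esum_(u in [set: {fset nat}]) (gamma u * ker_u k u x x)%:E < +oo)%E].

Definition ker_K (R : realType) d (D : measurableType d) (k : D -> D -> R)
    (gamma : {fset nat} -> R) (x y : prodspace nat D) : R :=
  abs_sum (fun u => gamma u * ker_u k u x y).

Definition gamma_hat (R : realType) d (D : measurableType d) (k : D -> D -> R)
    (a : D) (gamma : {fset nat} -> R) (u : {fset nat}) : R :=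
  gamma u * k a a ^+ #|` u|.

(* us enumerates, from 0, the non-empty u with gamma u > 0, in the order of
   non-increasing gh u. *)
Definition decreasing_enum (R : realType) (gamma gh : {fset nat} -> R)
    (us : nat -> {fset nat}) : Prop :=
  [/\ injective us,
      forall u, (exists j, us j = u) <-> (u != fset0 /\ 0 < gamma u) &
      forall i j, (i <= j)%N -> gh (us j) <= gh (us i)].

Definition decay (R : realType) (gh : {fset nat} -> R)
    (us : nat -> {fset nat}) : \bar R :=
  ereal_sup [set q%:E | q in
    [set q : R | (fun j => gh (us j) * j.+1%:R `^ q) @ \oo --> (0 : R)]].

(* v_0 is empty and v_k = [L_k]; L 0 is not used. *)
Definition level_set (L : nat -> nat) (k : nat) : {fset nat} :=
  if k is 0%N then fset0 else [fset i | i in iota 0 (L k)].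

(* For k = 1 the second condition is u_j <> set0, which holds for the u_j of an
   enumeration as above. *)
Definition V_set (us : nat -> {fset nat}) (v : nat -> {fset nat}) (k : nat) :
    set nat :=
  [set j | (us j `<=` v k)%fset /\ ~ (us j `<=` v k.-1)%fset].

(* The points (x_v; a), for x in D^v and for x in D^nat. *)
Definition splice_fin d (D : measurableType d) (v : {fset nat})
    (x : prodspace v D) (a : prodspace nat D) : prodspace nat D :=
  fun j => if insub j is Some i then x i else a j.

Definition splice d (D : measurableType d) (v : {fset nat})
    (x a : prodspace nat D) : prodspace nat D :=
  fun j => if j \in v then x j else a j.

Definition Psi (R : realType) d (D : measurableType d) (v : nat -> {fset nat})
    (a : prodspace nat D) (k : nat) (f : prodspace nat D -> R) :
    prodspace nat D -> R :=
  fun x => if k is 0%N then 0 else f (splice (v k) x a).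

(* A randomized linear algorithm with n random points in D^v, defined on
   Omega^v. *)
Record rule (R : realType) dO (Omega : measurableType dO)
    d (D : measurableType d) (v : {fset nat}) (n : nat) := Rule {
  weight : 'I_n -> R ;
  node : 'I_n -> prodspace v Omega -> prodspace v D ;
  node_measurable : forall i, measurable_fun setT (node i) }.

Definition rule_eval (R : realType) dO (Omega : measurableType dO)
    d (D : measurableType d) (v : {fset nat}) (n : nat)
    (q : rule R Omega D v n) (a : prodspace nat D)
    (f : prodspace nat D -> R) (omega : prodspace v Omega) : R :=
  \sum_(i < n) weight q i * f (splice_fin (node q i omega) a).

Definition condition_star (R : realType) dO (Omega : measurableType dO)
    d (D : measurableType d) (rho : probability D R) (w : {fset nat})
    (Pw : probability (prodspace w Omega) R) (n : nat)
    (V : set {fset nat}) (t : 'I_n -> prodspace w Omega -> prodspace w D) : Prop :=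
  forall u, V u -> forall j : w, val j \in u -> forall i : 'I_n,
    (forall om om' : prodspace w Omega, om j = om' j -> t i om j = t i om' j) /\
    (forall B : set D, measurable B -> Pw [set om | B (t i om j)] = rho B).

(* The bounds assumed for the building blocks, for given exponents tau and p.
   The variance bound is void for n = 1 when tau > 0, whence n >= 2. *)
Definition level_bounds (R : realType) dO (Omega : measurableType dO)
    d (D : measurableType d) (k : D -> D -> R)
    (Pw : forall w : {fset nat}, probability (prodspace w Omega) R)
    (Hu : forall u : {fset nat}, rkhs setT (ker_u k u))
    (gamma : {fset nat} -> R) (us : nat -> {fset nat})
    (L : nat -> nat) (a : prodspace nat D)
    (Q : forall l n, rule R Omega D (level_set L l) n)
    (C : {fset nat} -> nat -> R) (tau p : R) : Prop :=
  [/\ forall l n u f, (1 <= l)%N -> (2 <= n)%N ->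
        (u `<=` level_set L l)%fset ->
        rkhs_carrier (Hu u) f ->
        ('V_(Pw (level_set L l))[rule_eval (Q l n) a f]
         <= (C u l * n.-1%:R `^ (- tau) * rkhs_norm (Hu u) f ^+ 2)%:E)%E,
      exists c : R, forall l j, (2 <= l)%N -> V_set us (level_set L) l j ->
        C (us j) l * gamma (us j) <= c * (L l.-1)%:R `^ (1 - p) &
      exists c : R, forall l u, (1 <= l)%N -> u != fset0 ->
        (u `<=` level_set L l.-1)%fset -> C u l * gamma u <= c].

(* The multilevel algorithm with m levels and n l points on level l; xi l is
   the random element of Omega^(v l) used on level l. *)
Definition ml_eval (R : realType) dO (Omega : measurableType dO)
    d (D : measurableType d) (v : nat -> {fset nat}) (a : prodspace nat D)
    (Q : forall l n, rule R Omega D (v l) n) (T : Type)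
    (xi : forall l, T -> prodspace (v l) Omega) (m : nat) (n : nat -> nat)
    (f : prodspace nat D -> R) (t : T) : R :=
  \sum_(1 <= l < m.+1)
    rule_eval (Q l (n l)) a (f \- Psi v a l.-1 f) (xi l t).

(* On level l >= 2, one value of f - Psi_(l-1) f takes two values of f. *)
Definition ml_points (R : realType) dO (Omega : measurableType dO)
    d (D : measurableType d) (v : nat -> {fset nat}) (a : prodspace nat D)
    (Q : forall l n, rule R Omega D (v l) n) (T : Type)
    (xi : forall l, T -> prodspace (v l) Omega) (m : nat) (n : nat -> nat)
    (f : prodspace nat D -> R) (t : T) : seq (prodspace nat D) :=
  flatten [seq
    let pts := [seq splice_fin (node (Q l (n l)) i (xi l t)) a | i <- enum 'I_(n l)] in
    pts ++ (if l == 1%N then [::] else [seq splice (v l.-1) x a | x <- pts])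
  | l <- iota 1 m].

Definition point_cost (R : realType) d (D : measurableType d)
    (dollar : nat -> R) (v : nat -> {fset nat}) (a x : prodspace nat D) : \bar R :=
  ereal_inf [set (dollar #|` v i|)%:E |
    i in [set i | forall j, j \notin v i -> x j = a j]].

(* pts f t is the list of the evaluation points used on f. *)
Definition vss_cost (R : realType) d (D : measurableType d)
    (dollar : nat -> R) (X : set (prodspace nat D))
    (BK : set (prodspace nat D -> R)) dT (T : measurableType dT)
    (P : probability T R)
    (pts : (prodspace nat D -> R) -> T -> seq (prodspace nat D)) : \bar R :=
  ereal_inf [set c | exists (v : nat -> {fset nat}) (a : prodspace nat D),
    [/\ forall i, v i != fset0, forall i, (v i `<` v i.+1)%fset, X a &
        c = ereal_sup [set (\int[P]_t \sum_(x <- pts f t) point_cost dollar v a x)%E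
                      | f in BK]]].

Definition rand_error (R : realType) d (D : measurableType d)
    (mu : probability (prodspace nat D) R) (X : set (prodspace nat D))
    (BK : set (prodspace nat D -> R)) dT (T : measurableType dT)
    (P : probability T R) (Q : (prodspace nat D -> R) -> T -> R) : \bar R :=
  (ereal_sup [set \int[P]_t (((\int[mu]_(x in X) f x)%R - Q f t) ^+ 2)%:E
             | f in BK] `^ 2^-1)%E.

(* Main.v *)
(* Write A_l = prod_(j >= l) (1 + gamma_j k(a,a)).  Anchoring the coordinates
   j >= l at a turns f in the unit ball of H(K) into a finite sum of components
   f_u in H_u, u a subset of {0, ..., l - 1}, with
   sum_u |f_u|^2 / gamma_u <= A_l; for the difference with the function anchored
   at a lower level, the components of the old u satisfy the same bound with
   A_low - A_high in place of A_l.  As the coordinates of a node are independent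
   and k has mean zero, the images of distinct f_u under the rule are orthogonal,
   so their variances add up; the squared bias after m levels is at most
   A_(L_m) - 1.
   All these bounds come from one fact: for a positive semidefinite N, the
   rank-one kernel N(z,x) N(z,y) is dominated by N(z,z) N(x,y).
   Monotone weights give gamma_j k(a,a) <= gamma_hat_(u_j), because among the
   first j + 1 singletons one sits at position at least j; hence
   A_l - 1 = O(l^(1 - p)) for 1 < p < decay.  With L_l of order b^l the squared
   error is thus O(b^(m(1-p)) + sum_l n_l^(-tau) b^(l(1-p))) at cost
   O(sum_l n_l b^(l s)), and n_l of order x b^(-eta l) with eta strictly between
   s and (p - 1) / tau balances the two sums without logarithms.  At the two
   critical values of the decay this interval degenerates, and a smaller delta'
   restores it. *)

From HB Require Import structures.
Require Import Defs.
From mathcomp Require Import all_boot all_order all_algebra finmap.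
From mathcomp Require Import all_classical all_reals all_analysis.
From mathcomp Require Import measurable_realfun.
From mathcomp Require Import ring lra.

Set Implicit Arguments.
Unset Strict Implicit.
Unset Printing Implicit Defensive.

Import Order.TTheory GRing.Theory Num.Theory.
Import numFieldNormedType.Exports.

Local Open Scope fset_scope.
Local Open Scope classical_set_scope.
Local Open Scope ring_scope.

(** The spaces enter only through the record [rkhs]: no splitting of H(K) into the H_u is at hand,
    and nothing says that elements of H(K) are measurable. So everything is done first on finite
    combinations of kernel sections. Their squared norms are quadratic forms, and each norm
    inequality becomes the semidefiniteness of some kernel. As [K] is a limit of finite products,
    that is checked on the finite products, where the remainder is visibly built from semidefinite
    factors, and then passed to the limit. For given [f] one approximating sequence [s] of
    combinations is fixed, and the components, the level means and the integral are all limits along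
    it. This makes the bias computable: if [x] is anchored from [l] on, K(x, y) is a finite product
    times a factor A_l(y), which is [tail_sec]; the section at [y] has integral 1, while its level
    means telescope to A_(L_m)(y). The bias is thus the limit of the sums of c_i (A_(L_m)(y_i) - 1),
    again a quantity controlled by a semidefinite kernel. *)

Lemma count_lt (T : Type) (P P' : pred T) s : subpred P' P ->
  has (fun x => P x && ~~ P' x) s -> (count P' s < count P s)%N.
Proof.
move=> sub; elim: s => //= x s IH.
case Px: (P x); case P'x: (P' x) => //=; rewrite ?add0n ?ltn_add2l//.
  by rewrite add1n ltnS => _; exact: sub_count.
by rewrite sub in Px.
Qed.

(** * Positive semidefinite kernels *)

Section positive_definite.
Variables (R : realType) (E : Type).
Implicit Types (A B L N : E -> E -> R) (s : seq (R * E)).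

(** A combination is a list of coefficient-point pairs, repetitions allowed: adding combinations is
    concatenation, and no points need to be merged. *)
Definition qform L s := \sum_(p <- s) \sum_(q <- s) p.1 * q.1 * L p.2 q.2.

Definition psd L := (forall x y, L x y = L y x) /\ forall s, 0 <= qform L s.

Lemma kernel_psd L : reproducing_kernel L -> psd L.
Proof.
move=> [sL pL]; split=> // s; rewrite /qform big_tnth.
under eq_bigr do rewrite big_tnth.
exact: (pL _ (fun i => (tnth (in_tuple s) i).2) (fun i => (tnth (in_tuple s) i).1)).
Qed.

Lemma qform_cons L t z s : (forall x y, L x y = L y x) ->
  qform L ((t, z) :: s) =
  qform L s + 2 * t * (\sum_(p <- s) p.1 * L z p.2) + t ^+ 2 * L z z.
Proof.
move=> sL; rewrite /qform big_cons /= big_cons /=.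
under [X in _ + X = _]eq_bigr do rewrite big_cons /=.
rewrite big_split /=.
have -> : \sum_(j <- s) t * j.1 * L z j.2 = t * \sum_(p <- s) p.1 * L z p.2.
  by rewrite mulr_sumr; apply: eq_bigr => p _; rewrite mulrA.
have -> : \sum_(i <- s) i.1 * t * L i.2 z = t * \sum_(p <- s) p.1 * L z p.2.
  by rewrite mulr_sumr; apply: eq_bigr => p _; rewrite sL mulrAC mulrC.
ring.
Qed.

Lemma eq_qform L L' s : (forall x y, L x y = L' x y) -> qform L s = qform L' s.
Proof. by move=> e; apply: eq_bigr => p _; apply: eq_bigr => q _; rewrite e. Qed.

Lemma qformD L L' s :
  qform (fun x y => L x y + L' x y) s = qform L s + qform L' s.
Proof.
rewrite /qform -big_split; apply: eq_bigr => p _ /=.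
by rewrite -big_split; apply: eq_bigr => q _ /=; rewrite mulrDr.
Qed.

Lemma qformZ c L s : qform (fun x y => c * L x y) s = c * qform L s.
Proof.
rewrite /qform mulr_sumr; apply: eq_bigr => p _ /=.
by rewrite mulr_sumr; apply: eq_bigr => q _ /=; rewrite mulrCA.
Qed.

Lemma qform_sum (I : Type) (r : seq I) (F : I -> E -> E -> R) s :
  qform (fun x y => \sum_(i <- r) F i x y) s = \sum_(i <- r) qform (F i) s.
Proof.
elim: r => [|i r IH].
  rewrite big_nil; apply: big1 => p _; apply: big1 => q _.
  by rewrite big_nil mulr0.
rewrite big_cons -IH -qformD; apply: eq_qform => x y; exact: big_cons.
Qed.

Lemma qform_weight (phi : E -> R) L s :
  qform (fun x y => phi x * phi y * L x y) s
  = qform L [seq (p.1 * phi p.2, p.2) | p <- s].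
Proof.
rewrite /qform big_map; apply: eq_bigr => p _; rewrite big_map.
by apply: eq_bigr => q _ /=; ring.
Qed.

Lemma qform_rank1 (phi : E -> R) s :
  qform (fun x y => phi x * phi y) s = (\sum_(p <- s) p.1 * phi p.2) ^+ 2.
Proof.
rewrite /qform expr2 mulr_suml; apply: eq_bigr => p _.
by rewrite mulr_sumr; apply: eq_bigr => q _; ring.
Qed.

Lemma eq_psd L L' : (forall x y, L x y = L' x y) -> psd L -> psd L'.
Proof.
move=> e [sL pL]; split=> [x y|s]; first by rewrite -!e.
by rewrite -(eq_qform _ e).
Qed.

Lemma psdD L L' : psd L -> psd L' -> psd (fun x y => L x y + L' x y).
Proof.
move=> [sL pL] [sL' pL']; split=> [x y|s]; first by rewrite sL sL'.
by rewrite qformD addr_ge0.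
Qed.

Lemma psdZ c L : 0 <= c -> psd L -> psd (fun x y => c * L x y).
Proof.
move=> c0 [sL pL]; split=> [x y|s]; first by rewrite sL.
by rewrite qformZ mulr_ge0.
Qed.

Lemma psd_rank1 (phi : E -> R) : psd (fun x y => phi x * phi y).
Proof. by split=> [x y|s]; rewrite 1?mulrC // qform_rank1 sqr_ge0. Qed.

Lemma psd1 : psd (fun _ _ => 1).
Proof. by apply: eq_psd (psd_rank1 (fun=> 1)) => x y; rewrite mulr1. Qed.

Lemma psd_diag L x : psd L -> 0 <= L x x.
Proof.
by move=> [_ /(_ [:: (1, x)])]; rewrite /qform !big_seq1 !mul1r.
Qed.

Lemma discr_le0 (q l n : R) : 0 <= n ->
  (forall t, 0 <= q + 2 * t * l + t ^+ 2 * n) -> l ^+ 2 <= n * q.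
Proof.
rewrite le_eqVlt => /predU1P[<- h|n0 h].
  rewrite mul0r; have [->|l0] := eqVneq l 0; first by rewrite expr0n.
  (* For [n = 0] the polynomial is affine in [t], and this [t] would give it the value -1. *)
  have := h (- (q + 1) / (2 * l)).
  have -> : q + 2 * (- (q + 1) / (2 * l)) * l + (- (q + 1) / (2 * l)) ^+ 2 * 0 = -1.
    by field.
  by rewrite ler0N1.
have := h (- l / n).
have -> : q + 2 * (- l / n) * l + (- l / n) ^+ 2 * n = q - l ^+ 2 / n.
  by field; rewrite gt_eqF.
by rewrite subr_ge0 ler_pdivrMr// mulrC.
Qed.

(** Discriminant of the form on [(t, z) :: s], a nonnegative quadratic polynomial in [t]. *)
Lemma psd_CS L z s : psd L ->
  (\sum_(p <- s) p.1 * L z p.2) ^+ 2 <= L z z * qform L s.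
Proof.
move=> pL; apply: discr_le0; first exact: psd_diag.
by move=> t; rewrite -qform_cons; [exact: pL.2|exact: pL.1].
Qed.

Lemma psd_CS2 L x y : psd L -> L x y ^+ 2 <= L x x * L y y.
Proof.
move=> pL; have := psd_CS x [:: (1, y)] pL.
by rewrite /qform !big_seq1 !mul1r.
Qed.

(** The Schur complement of the point [z], scaled by [L z z] so that it makes sense when [L z z]
    vanishes; its semidefiniteness is a restatement of [psd_CS]. *)
Lemma psd_schur_compl L z : psd L ->
  psd (fun x y => L z z * L x y - L z x * L z y).
Proof.
move=> pL; split=> [x y|s]; first by rewrite [L x y]pL.1 [X in _ - X]mulrC.
rewrite (_ : qform _ s = qform (fun x y => L z z * L x y + -1 * (L z x * L z y)) s).
  by rewrite qformD !qformZ qform_rank1 mulN1r subr_ge0 psd_CS.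
by apply: eq_qform => x y; rewrite mulN1r.
Qed.

(* Schur's product theorem: each step splits off a rank one kernel from A and
   annihilates one more diagonal entry. *)
Lemma schur_qform A B s : psd A -> psd B ->
  0 <= qform (fun x y => A x y * B x y) s.
Proof.
have [n] := ubnP (count (fun p => A p.2 p.2 != 0) s).
elim: n A => // n IH A; rewrite ltnS => hn pA pB.
have [/(has_tnthP (t := in_tuple s))[i /= Az]|] :=
    boolP (has (fun p => A p.2 p.2 != 0) s); last first.
  rewrite -all_predC => /(all_tnthP (t := in_tuple s)) A0.
  rewrite /qform big_tnth big1// => i _; rewrite big_tnth big1// => j _.
  have := psd_CS2 (tnth (in_tuple s) i).2 (tnth (in_tuple s) j).2 pA.
  have /= := A0 i; rewrite negbK => /eqP ->; rewrite mul0r => Aij.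
  have /eqP -> : A (tnth (in_tuple s) i).2 (tnth (in_tuple s) j).2 == 0.
    by rewrite -sqrf_eq0 eq_le Aij sqr_ge0.
  by rewrite mul0r mulr0.
set z := (tnth (in_tuple s) i).2 in Az.
have Az0 : 0 < A z z by rewrite lt_def Az psd_diag.
pose A' x y := (A z z)^-1 * (A z z * A x y - A z x * A z y).
have pA' : psd A'.
  by apply: psdZ; [rewrite invr_ge0 ltW|exact: psd_schur_compl].
have -> : qform (fun x y => A x y * B x y) s =
    qform (fun x y => A' x y * B x y) s
    + (A z z)^-1 * qform (fun x y => A z x * A z y * B x y) s.
  rewrite -qformZ -qformD; apply: eq_qform => x y.
  by rewrite /A'; field.
rewrite addr_ge0//; last first.
  by apply: mulr_ge0; [rewrite invr_ge0 ltW|rewrite (qform_weight (A z)) pB.2].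
apply: IH => //; apply: leq_trans hn; apply: count_lt => [p|].
  apply: contraNN => /eqP Ap0.
  have := psd_CS2 z p.2 pA; rewrite Ap0 mulr0 => Azp.
  have {}Azp : A z p.2 = 0 by apply/eqP; rewrite -sqrf_eq0 eq_le Azp sqr_ge0.
  by rewrite /A' Azp Ap0 !mulr0 subrr mulr0.
apply/(has_tnthP (t := in_tuple s)); exists i; rewrite /= -/z Az negbK /A' -expr2.
by rewrite subrr mulr0 eqxx.
Qed.

Lemma psdM A B : psd A -> psd B -> psd (fun x y => A x y * B x y).
Proof.
move=> pA pB; split=> [x y|s]; first by rewrite pA.1 pB.1.
exact: schur_qform.
Qed.

Lemma psd_prod (I : Type) (r : seq I) (F : I -> E -> E -> R) :
  (forall i, psd (F i)) -> psd (fun x y => \prod_(i <- r) F i x y).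
Proof.
move=> pF; elim: r => [|i r IH].
  by apply: eq_psd psd1 => x y; rewrite big_nil.
by apply: eq_psd (psdM (pF i) IH) => x y; rewrite big_cons.
Qed.

Lemma psd_prod1D (I : Type) (r : seq I) (F : I -> E -> E -> R) :
  (forall i, psd (F i)) -> psd (fun x y => \prod_(i <- r) (1 + F i x y)).
Proof. by move=> pF; apply: psd_prod => i; apply: psdD => //; exact: psd1. Qed.

(** Induction on the list: [(1 + F) P - 1 = (P - 1) + F P] is a sum of semidefinite kernels. *)
Lemma psd_prod1D_sub1 (I : Type) (r : seq I) (F : I -> E -> E -> R) :
  (forall i, psd (F i)) -> psd (fun x y => \prod_(i <- r) (1 + F i x y) - 1).
Proof.
move=> pF; elim: r => [|i r IH].
  apply: eq_psd (psdZ (lexx 0) psd1) => x y.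
  by rewrite big_nil subrr mul0r.
have h := psdD IH (psdM (pF i) (psd_prod1D r pF)).
by apply: eq_psd h => x y; rewrite big_cons; ring.
Qed.

(* The sections of N at z have squared norm N z z, so N z x N z y is dominated
   by N z z N x y; multiplying by P preserves this. *)
Lemma qform_section_le P N K z s : psd P -> psd N ->
  psd (fun x y => K x y - P x y * N x y) ->
  qform (fun x y => N z x * N z y * P x y) s <= N z z * qform K s.
Proof.
move=> pP pN pK; apply: (@le_trans _ _ (N z z * qform (fun x y => P x y * N x y) s)).
  rewrite -qformZ -subr_ge0 -mulN1r -qformZ -qformD.
  have := (psdM pP (psd_schur_compl z pN)).2 s.
  by congr (_ <= _); apply: eq_qform => x y; ring.
apply: ler_wpM2l; first exact: psd_diag.
rewrite -subr_ge0 -mulN1r -qformZ -qformD.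
by have := pK.2 s; congr (_ <= _); apply: eq_qform => x y; ring.
Qed.

End positive_definite.

Lemma cvg0_sqr_le (R : realType) (u v : nat -> R) (c : R) :
  (forall n, u n ^+ 2 <= c * v n) -> v @ \oo --> (0 : R) -> u @ \oo --> (0 : R).
Proof.
move=> uv v0; apply/norm_cvg0P.
have cv0 : (fun n => Num.sqrt (c * v n)) @ \oo --> (0 : R).
  rewrite -[X in _ --> X]sqrtr0 -[X in Num.sqrt X](mulr0 c).
  apply: (@continuous_cvg _ _ _ _ _ _ (@Num.sqrt R)); first exact: sqrt_continuous.
  exact: cvgMr.
apply: (squeeze_cvgr _ (cvg_cst 0) cv0); near=> n.
by rewrite /= normr_ge0 -sqrtr_sqr ler_wsqrtr.
Unshelve. all: by end_near. Qed.

Lemma cvg0_sqrt (R : realType) (v : nat -> R) : (forall n, 0 <= v n) ->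
  (fun n => Num.sqrt (v n)) @ \oo --> (0 : R) -> v @ \oo --> (0 : R).
Proof.
move=> v0 h; have -> : v = (fun n => Num.sqrt (v n) * Num.sqrt (v n)).
  by apply/funext => n; rewrite -expr2 sqr_sqrtr.
by rewrite -[X in _ --> X](mulr0 (0 : R)); exact: cvgM.
Qed.

Lemma cvg_bigsum (R : realType) (I : Type) (r : seq I) (u : I -> nat -> R)
    (l : I -> R) : (forall i, u i @ \oo --> l i) ->
  (fun n => \sum_(i <- r) u i n) @ \oo --> \sum_(i <- r) l i.
Proof.
move=> ul; elim: r => [|i r IH].
  by under eq_fun do rewrite big_nil; rewrite big_nil; exact: cvg_cst.
by under eq_fun do rewrite big_cons; rewrite big_cons; exact: cvgD.
Qed.

Lemma sumr_negl (R : pzRingType) (I : Type) (r : seq (R * I)) (F : I -> R) :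
  \sum_(p <- [seq (- q.1, q.2) | q <- r]) p.1 * F p.2 = - \sum_(p <- r) p.1 * F p.2.
Proof. by rewrite big_map -sumrN; apply: eq_bigr => p _; rewrite mulNr. Qed.

(** * Reproducing kernel Hilbert spaces *)

Section rkhs_theory.
Variables (R : realType) (E : Type) (A : set E) (L : E -> E -> R) (H : rkhs A L).
Implicit Types (f g h : E -> R) (s : seq (R * A)).
Local Notation C := (rkhs_carrier H).
Local Notation ip := (rkhs_inner H).

Definition sqn f := ip f f.

Definition ksec (x : E) : E -> R := patch (fun=> 0) A (L^~ x).

Definition comb s : E -> R := fun x => \sum_(p <- s) p.1 * ksec (val p.2) x.

Definition rker (x y : A) : R := L (val x) (val y).

Lemma setvalP (x : A) : A (val x).
Proof. exact: set_mem (valP x). Qed.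

Lemma ksecE x y : A y -> ksec x y = L y x.
Proof. by move=> Ay; rewrite /ksec patchE mem_set. Qed.

Lemma ksecC x : A x -> C (ksec x).
Proof. exact: rkhs_section. Qed.

Lemma carrierD f g : C f -> C g -> C (f \+ g).
Proof.
move=> Cf Cg; have := rkhs_lin 1 Cf Cg; congr (C _).
by apply/funext => x; rewrite mul1r.
Qed.

Lemma carrierZD c f g : C f -> C g -> C (f \+ (fun x => c * g x)).
Proof.
move=> Cf Cg; have := rkhs_lin c Cg Cf; congr (C _).
by apply/funext => x; rewrite /= addrC.
Qed.

Lemma carrierB f g : C f -> C g -> C (f \- g).
Proof.
move=> Cf Cg; have := carrierZD (-1) Cf Cg; congr (C _).
by apply/funext => x; rewrite /= mulN1r.
Qed.

Lemma carrierZ c f : C f -> C (fun x => c * f x).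
Proof.
move=> Cf; have := carrierZD c (rkhs_zero H) Cf; congr (C _).
by apply/funext => x; rewrite /= add0r.
Qed.

Lemma sqn_ge0 f : C f -> 0 <= sqn f.
Proof. exact: rkhs_inner_ge0. Qed.

Lemma ipZDl c f g h : C f -> C g -> C h ->
  ip (f \+ (fun x => c * g x)) h = ip f h + c * ip g h.
Proof.
move=> Cf Cg Ch; rewrite addrC -rkhs_inner_lin//; congr (ip _ _).
by apply/funext => x; rewrite /= addrC.
Qed.

Lemma ipZDr c f g h : C f -> C g -> C h ->
  ip h (f \+ (fun x => c * g x)) = ip h f + c * ip h g.
Proof.
move=> Cf Cg Ch; rewrite rkhs_innerC// ?ipZDl//; last exact: carrierZD.
by rewrite [ip f h]rkhs_innerC// [ip g h]rkhs_innerC.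
Qed.

Lemma ip0l h : C h -> ip (fun=> 0) h = 0.
Proof.
move=> Ch; have := ipZDl (-1) Ch Ch Ch; rewrite mulN1r subrr => e; rewrite -[RHS]e.
by congr (ip _ _); apply/funext => x /=; ring.
Qed.

Lemma sqnZD c f g : C f -> C g ->
  sqn (f \+ (fun x => c * g x)) = sqn f + 2 * c * ip f g + c ^+ 2 * sqn g.
Proof.
move=> Cf Cg; rewrite /sqn ipZDl// ?ipZDr//; last exact: carrierZD.
by rewrite [ip g f]rkhs_innerC//; ring.
Qed.

Lemma sqnB f g : C f -> C g -> sqn (f \- g) = sqn f - 2 * ip f g + sqn g.
Proof.
move=> Cf Cg; have := sqnZD (-1) Cf Cg.
rewrite mulrN1 sqrrN expr1n mul1r mulNr => <-.
by congr sqn; apply/funext => x; rewrite /= mulN1r.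
Qed.

Lemma sqnBC f g : C f -> C g -> sqn (f \- g) = sqn (g \- f).
Proof. by move=> Cf Cg; rewrite !sqnB// [ip g f]rkhs_innerC//; ring. Qed.

Lemma ip_CS f g : C f -> C g -> ip f g ^+ 2 <= sqn g * sqn f.
Proof.
move=> Cf Cg; apply: discr_le0 => [|t]; first exact: sqn_ge0.
by rewrite -sqnZD//; apply/sqn_ge0/carrierZD.
Qed.

Lemma ip_ksec f x : C f -> A x -> ip f (ksec x) = f x.
Proof. by move=> Cf Ax; rewrite rkhs_reproducing. Qed.

Lemma sqn_ksec x : A x -> sqn (ksec x) = L x x.
Proof. by move=> Ax; rewrite /sqn ip_ksec ?ksecE//; exact: ksecC. Qed.

Lemma sqr_eval_le f x : C f -> A x -> f x ^+ 2 <= L x x * sqn f.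
Proof.
by move=> Cf Ax; rewrite -sqn_ksec// -(ip_ksec Cf Ax); apply/ip_CS/ksecC.
Qed.

Lemma comb_nil : comb [::] = fun=> 0.
Proof. by apply/funext => x; rewrite /comb big_nil. Qed.

Lemma comb_cons p s : comb (p :: s) = comb s \+ (fun x => p.1 * ksec (val p.2) x).
Proof. by apply/funext => x; rewrite /comb big_cons addrC. Qed.

Lemma combC s : C (comb s).
Proof.
elim: s => [|p s IH]; first by rewrite comb_nil; exact: rkhs_zero.
by rewrite comb_cons; apply: carrierZD => //; exact/ksecC/setvalP.
Qed.

Lemma comb_subE s s' :
  comb s \- comb s' = comb (s ++ [seq (- q.1, q.2) | q <- s']).
Proof.
apply/funext => x; rewrite /comb big_cat /=; congr (_ + _).
by rewrite (sumr_negl _ (fun y => ksec (val y) x)).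
Qed.

Lemma ip_comb s f : C f -> ip (comb s) f = \sum_(p <- s) p.1 * f (val p.2).
Proof.
move=> Cf; elim: s => [|p s IH]; first by rewrite comb_nil ip0l// big_nil.
rewrite comb_cons big_cons ipZDl//; [|exact: combC|exact/ksecC/setvalP].
rewrite IH addrC rkhs_innerC//; last exact/ksecC/setvalP.
by rewrite ip_ksec//; exact: setvalP.
Qed.

Lemma sqn_comb s : sqn (comb s) = qform rker s.
Proof.
rewrite /sqn ip_comb; last exact: combC.
apply: eq_bigr => p _; rewrite /comb mulr_sumr; apply: eq_bigr => q _.
by rewrite ksecE ?mulrA//; exact: setvalP.
Qed.

Lemma rker_psd : psd rker.
Proof.
split=> [x y|s]; last by rewrite -sqn_comb; exact/sqn_ge0/combC.
rewrite /rker -!ksecE; [|exact: setvalP..].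
rewrite -!ip_ksec; [|exact/ksecC/setvalP|exact: setvalP|exact/ksecC/setvalP|exact: setvalP].
by rewrite rkhs_innerC//; exact/ksecC/setvalP.
Qed.

Lemma rkhs_cauchy_cvg (F : nat -> E -> R) : (forall n, C (F n)) ->
  (forall e, 0 < e -> exists N, forall m n, (N <= m)%N -> (N <= n)%N ->
     sqn (F m \- F n) < e) ->
  exists2 f, C f & (fun n => sqn (F n \- f)) @ \oo --> (0 : R).
Proof.
move=> CF cF; have [|f Cf Ff] := rkhs_complete CF.
  move=> e e0; have [|N hN] := cF (e ^+ 2); first exact: exprn_gt0.
  exists N => m n Nm Nn; rewrite -[ltRHS]gtr0_norm// -sqrtr_sqr ltr_sqrt ?exprn_gt0//.
  exact: hN.
exists f => //; apply: cvg0_sqrt Ff => n.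
exact/sqn_ge0/carrierB.
Qed.

Section norm_limit.
Variables (F : nat -> E -> R) (f : E -> R).
Hypotheses (CF : forall n, C (F n)) (Cf : C f).
Hypothesis Ff : (fun n => sqn (F n \- f)) @ \oo --> (0 : R).

Lemma cvg_ip h : C h -> (fun n => ip h (F n)) @ \oo --> ip h f.
Proof.
move=> Ch; have Cd n : C (F n \- f) by exact: carrierB.
have h0 : (fun n => ip h (F n \- f)) @ \oo --> (0 : R).
  apply: (@cvg0_sqr_le _ _ _ (sqn h) _ Ff) => n.
  by rewrite mulrC; exact: ip_CS.
have -> : (fun n => ip h (F n)) = (fun n => ip h f + ip h (F n \- f)).
  apply/funext => n; have := ipZDr 1 Cf (Cd n) Ch; rewrite mul1r => <-.
  by congr (ip _ _); apply/funext => x /=; ring.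
by rewrite -[X in _ --> X]addr0; apply: cvgD => //; exact: cvg_cst.
Qed.

Lemma cvg_eval x : (fun n => F n x) @ \oo --> f x.
Proof.
have [Ax|nAx] := pselect (A x); last first.
  under eq_fun do rewrite (rkhs_supp (CF _) nAx).
  by rewrite (rkhs_supp Cf nAx); exact: cvg_cst.
have Cx := ksecC Ax.
rewrite -(ip_ksec Cf Ax) rkhs_innerC//.
have -> : (fun n => F n x) = (fun n => ip (ksec x) (F n)).
  by apply/funext => n; rewrite rkhs_innerC// ip_ksec.
exact: cvg_ip.
Qed.

Lemma cvg_sqn : (fun n => sqn (F n)) @ \oo --> sqn f.
Proof.
have -> : (fun n => sqn (F n)) =
    (fun n => sqn (F n \- f) + 2 * ip f (F n) - sqn f).
  by apply/funext => n; rewrite sqnB// [ip f _]rkhs_innerC//; ring.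
rewrite [X in _ --> X](_ : _ = 0 + 2 * ip f f - sqn f); last by rewrite /sqn; ring.
apply: cvgB; last exact: cvg_cst.
by apply: cvgD => //; apply: cvgMr; exact: cvg_ip.
Qed.

End norm_limit.

(** The reproducing property says that a function orthogonal to all sections vanishes, so density is
    obtained from a nearest point: a minimizing sequence of combinations has a limit [h], and since
    no multiple of a section can bring [f \- h] closer to zero, [f \- h] is orthogonal to every
    section. *)
Lemma comb_dense f : C f ->
  exists s : nat -> seq (R * A), (fun n => sqn (comb (s n) \- f)) @ \oo --> (0 : R).
Proof.
move=> Cf; pose S := [set sqn (f \- comb s) | s in [set: seq (R * A)]].
have CB s : C (f \- comb s) by apply: carrierB => //; exact: combC.
have S0 : S !=set0 by exists (sqn (f \- comb [::])), [::].
have Slb : has_lbound S by exists 0 => _ [s _ <-]; exact: sqn_ge0.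
have hinf : has_inf S by [].
have near_inf n : exists s, sqn (f \- comb s) < inf S + n.+1%:R^-1.
  have [|_ [s _ <-] hs] := @inf_adherent _ S n.+1%:R^-1 _ hinf.
    by rewrite invr_gt0 ltr0n.
  by exists s.
have [s hs] := choice near_inf.
have ge_inf r : inf S <= sqn (f \- comb r) by apply: ge_inf => //; exists r.
have half s1 s2 : exists r, f \- comb r =
    (fun x => 2^-1 * ((f \- comb s1) \+ (f \- comb s2)) x).
  exists [seq (2^-1 * p.1, p.2) | p <- s1 ++ s2]; apply/funext => x.
  rewrite /comb /= big_map.
  under eq_bigr do rewrite -mulrA.
  by rewrite -mulr_sumr big_cat /=; field.
(* the parallelogram identity makes a minimizing sequence Cauchy *)
have par m n : sqn (comb (s m) \- comb (s n)) <= 2 * (m.+1%:R^-1 + n.+1%:R^-1).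
  set u := f \- comb (s m); set v := f \- comb (s n).
  have -> : sqn (comb (s m) \- comb (s n)) = sqn (v \- u).
    by congr sqn; apply/funext => x; rewrite /u /v /=; ring.
  have [r hr] := half (s m) (s n).
  have := ge_inf r; rewrite hr -/u -/v.
  rewrite (_ : (fun x => _) = (fun=> 0) \+ (fun x => 2^-1 * (u \+ v) x)); last first.
    by apply/funext => x /=; rewrite add0r.
  rewrite sqnZD; [|exact: rkhs_zero|by apply: carrierD; exact: CB].
  rewrite {1}/sqn !ip0l; [|by apply: carrierD; exact: CB|exact: rkhs_zero].
  rewrite (_ : u \+ v = u \+ (fun x => 1 * v x)); last first.
    by apply/funext => x /=; rewrite mul1r.
  rewrite sqnZD; [|exact: CB..].
  rewrite sqnB; [|exact: CB..].
  rewrite (rkhs_innerC (CB (s n)) (CB (s m))) -/u -/v.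
  have := hs m; have := hs n; rewrite -/u -/v.
  move: (sqn v) (sqn u) (ip u v) m.+1%:R^-1 n.+1%:R^-1 => V U I x y.
  rewrite (_ : 2^-1 ^+ 2 = 4^-1 :> R); last by field.
  by lra.
have [|h Ch hcvg] := @rkhs_cauchy_cvg (fun n => comb (s n)) (fun n => combC (s n)).
  move=> e e0; have e8 : 0 < e / 8 by rewrite divr_gt0.
  have [N _ hN] := near_infty_natSinv_lt (PosNum e8).
  exists N => m n Nm Nn; apply: le_lt_trans (par m n) _.
  have h1 : m.+1%:R^-1 < e / 8 := hN m Nm.
  have h2 : n.+1%:R^-1 < e / 8 := hN n Nn.
  move: (m.+1%:R^-1) (n.+1%:R^-1) h1 h2 => x y h1 h2.
  by lra.
have fh x : A x -> f x = h x.
  move=> Ax; have Cx := ksecC Ax; have Cfh : C (f \- h) by exact: carrierB.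
  have fcvg : (fun n => sqn ((f \- comb (s n)) \- (f \- h))) @ \oo --> (0 : R).
    apply: cvg_trans hcvg; apply: near_eq_cvg; near=> n.
    rewrite sqnBC; [|exact: combC|exact: Ch].
    by congr sqn; apply/funext => y /=; ring.
  have infE : sqn (f \- h) <= inf S.
    have lim0 : (fun n => inf S + n.+1%:R^-1) @ \oo --> inf S + (0 : R).
      by apply: cvgD; [exact: cvg_cst|exact: cvg_harmonic].
    have lim1 := cvg_sqn (fun n => CB (s n)) Cfh fcvg.
    rewrite -[leRHS]addr0 -(cvg_lim _ lim0)// -(cvg_lim _ lim1)//.
    apply: ler_lim; [by apply/cvg_ex; eexists; exact: lim1| |].
      by apply/cvg_ex; eexists; exact: lim0.
    by near=> n; exact/ltW/hs.
  have min t : inf S <= sqn ((f \- h) \+ (fun y => t * ksec x y)).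
    pose u n := (f \- comb (s n)) \+ (fun y => t * ksec x y).
    have Cu n : C (u n) by apply: carrierZD => //; exact: CB.
    have Cl : C ((f \- h) \+ (fun y => t * ksec x y)) by exact: carrierZD.
    have ucvg : (fun n => sqn (u n \- ((f \- h) \+ (fun y => t * ksec x y)))) @ \oo --> (0 : R).
      apply: cvg_trans fcvg; apply: near_eq_cvg; near=> n.
      by congr sqn; apply/funext => y; rewrite /u /=; ring.
    have lim1 := cvg_sqn Cu Cl ucvg.
    rewrite -(cvg_lim _ lim1)//; apply: limr_ge.
      by apply/cvg_ex; eexists; exact: lim1.
    near=> n; have -> : u n = f \- comb ((- t, Sub x (mem_set Ax)) :: s n).
      by rewrite comb_cons; apply/funext => y; rewrite /u /=; ring.
    exact: ge_inf.
  (* The increment of the squared norm along [t * ksec x] is a nonnegative quadratic in [t] without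
     constant term, so its linear coefficient is zero. *)
  have : (ip (f \- h) (ksec x)) ^+ 2 <= sqn (ksec x) * 0.
    apply: discr_le0; first exact: sqn_ge0.
    move=> t; have := min t; rewrite sqnZD//.
    by move: infE (min 0); rewrite sqnZD// => ? ?; lra.
  rewrite mulr0 => ip0; have {ip0} : ip (f \- h) (ksec x) == 0.
    by rewrite -sqrf_eq0 eq_le ip0 sqr_ge0.
  by rewrite ip_ksec//= subr_eq0 => /eqP.
exists s; suff -> : f = h by [].
apply/funext => x; have [/fh//|nAx] := pselect (A x).
by rewrite (rkhs_supp Cf nAx) (rkhs_supp Ch nAx).
Unshelve. all: by end_near. Qed.

End rkhs_theory.

(* Continuous linear extension, from the combinations of sections to their
   limits. *)
Lemma comb_extend (R : realType) (E E' : Type) (A : set E) (A' : set E')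
    (L : E -> E -> R) (L' : E' -> E' -> R) (H : rkhs A L) (H' : rkhs A' L')
    (tau : A -> E' -> R) (c : R) (s : nat -> seq (R * A)) f :
  (forall y, rkhs_carrier H' (tau y)) ->
  (forall r, sqn H' (fun x => \sum_(p <- r) p.1 * tau p.2 x) <= c * qform (rker L) r) ->
  rkhs_carrier H f ->
  (fun n => sqn H (comb L (s n) \- f)) @ \oo --> (0 : R) ->
  exists2 h, rkhs_carrier H' h &
    (fun n => sqn H' ((fun x => \sum_(p <- s n) p.1 * tau p.2 x) \- h)) @ \oo --> (0 : R).
Proof.
move=> Ct bT Cf sf; pose T r x := \sum_(p <- r) p.1 * tau p.2 x.
have CT r : rkhs_carrier H' (T r).
  elim: r => [|p r IH].
    by rewrite (_ : T _ = fun=> 0); [exact: rkhs_zero|apply/funext => x; exact: big_nil].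
  rewrite (_ : T _ = T r \+ (fun x => p.1 * tau p.2 x)); first exact: carrierZD.
  by apply/funext => x; rewrite /T big_cons addrC.
apply: (@rkhs_cauchy_cvg _ _ _ _ _ (fun n => T (s n))) => // e e0.
pose c' := `|c| + 1; have c'0 : 0 < c' by rewrite ltr_wpDl.
have e4 : 0 < e / (4 * c') by rewrite divr_gt0// mulr_gt0.
move/cvgrPdist_lt : sf => /(_ _ e4)[N _ hN].
exists N => m n Nm Nn.
have -> : T (s m) \- T (s n) = T (s m ++ [seq (- q.1, q.2) | q <- s n]).
  apply/funext => x; rewrite /T big_cat /=; congr (_ + _).
  by rewrite (sumr_negl _ (fun y => tau y x)).
apply: le_lt_trans (bT _) _; rewrite -(sqn_comb H) -comb_subE.
set q := sqn H _; have Cs r := combC H r.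
have q0 : 0 <= q by apply/sqn_ge0/carrierB.
have : q <= 2 * sqn H (comb L (s m) \- f) + 2 * sqn H (comb L (s n) \- f).
  set u := comb L (s m) \- f; set v := comb L (s n) \- f.
  have [Cu Cv] : rkhs_carrier H u /\ rkhs_carrier H v.
    by split; apply: carrierB.
  rewrite /q (_ : _ \- _ = u \- v); last by apply/funext => x; rewrite /u /v /=; ring.
  rewrite sqnB//; have : 0 <= sqn H (u \+ (fun x => 1 * v x)).
    exact/sqn_ge0/carrierZD.
  by rewrite sqnZD//; lra.
have := hN m Nm; have := hN n Nn; rewrite /= !sub0r !normrN.
rewrite !ger0_norm; [|by apply/sqn_ge0/carrierB..].
rewrite !ltr_pdivlMr ?mulr_gt0//.
set a := sqn H _; set b := sqn H _ => ha hb hq.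
have := ler_wpM2l (ltW c'0) hq; have : c * q <= c' * q.
  by rewrite ler_wpM2r// (le_trans (ler_norm c))// /c' lerDl.
by lra.
Qed.

(** * Finite sets of coordinates, and sums and products over them *)

Fixpoint subsets (n : nat) : seq {fset nat} :=
  if n is n'.+1 then subsets n' ++ [seq (n' |` u)%fset | u <- subsets n']
  else [:: fset0].

Lemma mem_subsetsP n (u : {fset nat}) :
  reflect (forall j, j \in u -> (j < n)%N) (u \in subsets n).
Proof.
apply: (iffP idP).
  elim: n u => [|n IH] u /=; first by rewrite inE => /eqP -> j; rewrite inE.
  rewrite mem_cat => /orP[/IH h j /h jn|/mapP[v /IH h -> j]].
    by rewrite ltnS ltnW.
  by rewrite !inE => /predU1P[->//|/h jn]; rewrite ltnS ltnW.
elim: n u => [|n IH] u h /=.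
  rewrite inE; apply/eqP/fsetP => j; rewrite inE.
  by apply/negbTE/negP => /h.
rewrite mem_cat; have [nu|nu] := boolP (n \in u); last first.
  rewrite IH// => j ju; have := h j ju; rewrite ltnS leq_eqVlt => /predU1P[jn|//].
  by rewrite -jn ju in nu.
apply/orP; right; apply/mapP; exists (u `\ n)%fset; last by rewrite fsetD1K.
apply: IH => j; rewrite !inE => /andP[jn /h].
by rewrite ltnS leq_eqVlt (negbTE jn).
Qed.

Lemma subsets_notin n u : u \in subsets n -> n \notin u.
Proof. by move/mem_subsetsP => h; apply/negP => /h; rewrite ltnn. Qed.

Lemma subsets_uniq n : uniq (subsets n).
Proof.
elim: n => //= n IH; rewrite cat_uniq IH /= map_inj_in_uniq ?IH ?andbT.
  apply/hasPn => _ /mapP[v vn ->]; apply/negP => /subsets_notin.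
  by rewrite !inE eqxx.
move=> u v /subsets_notin nu /subsets_notin nv e.
by rewrite -(fsetU1K nu) -(fsetU1K nv) e.
Qed.

Lemma subsets_subset m n : (m <= n)%N -> {subset subsets m <= subsets n}.
Proof.
move=> mn u /mem_subsetsP h; apply/mem_subsetsP => j /h jm.
exact: leq_trans mn.
Qed.

Lemma fset0_subsets n : fset0 \in subsets n.
Proof. by apply/mem_subsetsP => j; rewrite inE. Qed.

Lemma prod1D_subsets (R : comPzRingType) (t : nat -> R) n :
  \prod_(0 <= j < n) (1 + t j) = \sum_(u <- subsets n) \prod_(j <- u) t j.
Proof.
elim: n => [|n IH] /=; first by rewrite big_nil big_seq1 big_seq_fset0.
rewrite big_nat_recr//= IH big_cat big_map /= mulrDr mulr1; congr (_ + _).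
rewrite mulr_suml big_seq [RHS]big_seq; apply: eq_bigr => u /subsets_notin nu.
by rewrite big_fsetU1// mulrC.
Qed.

Lemma finite_subsets (r : seq {fset nat}) : exists n, {subset r <= subsets n}.
Proof.
elim: r => [|u r [n IH]]; first by exists 0%N.
exists (maxn n (\max_(j <- u) j).+1) => v; rewrite inE => /predU1P[->|/IH].
  apply/mem_subsetsP => j ju; rewrite leq_max ltnS; apply/orP; right.
  exact: leq_bigmax_seq.
by apply: subsets_subset; exact: leq_maxl.
Qed.

Section subsets_sum.
Variables (R : realType).
Implicit Types (f : {fset nat} -> R).

Lemma subset_sum_le f (r1 r2 : seq {fset nat}) : (forall u, 0 <= f u) ->
  uniq r1 -> {subset r1 <= r2} -> \sum_(u <- r1) f u <= \sum_(u <- r2) f u.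
Proof.
move=> f0; elim: r1 r2 => [|u r1 IH] r2 /=.
  by move=> _ _; rewrite big_nil; apply: sumr_ge0.
move=> /andP[ur1 ur] sub; have ur2 : u \in r2 by apply: sub; rewrite inE eqxx.
rewrite big_cons (perm_big _ (perm_to_rem ur2)) big_cons lerD2l.
apply: IH => // v vr1; have : v \in r2 by apply: sub; rewrite inE vr1 orbT.
rewrite (perm_mem (perm_to_rem ur2)) inE => /predU1P[vu|//].
by rewrite -vu vr1 in ur1.
Qed.

Lemma subsets_sum_le_esum f n : (forall u, 0 <= f u) ->
  ((\sum_(u <- subsets n) f u)%:E <= \esum_(u in [set: {fset nat}]) (f u)%:E)%E.
Proof.
move=> f0; apply: esum_ge; exists [set` subsets n].
  by split=> //; exact: finite_seq.
by rewrite -fsbig_seq ?subsets_uniq// sumEFin.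
Qed.

Lemma esum_le_subsets f c : (forall u, 0 <= f u) ->
  (forall n, \sum_(u <- subsets n) f u <= c) ->
  (\esum_(u in [set: {fset nat}]) (f u)%:E <= c%:E)%E.
Proof.
move=> f0 h; apply: ge_ereal_sup => _ [X [finX _] <-].
rewrite fsbig_finite// sumEFin lee_fin.
have [n hn] := finite_subsets (fset_set X).
by apply: le_trans (h n); apply: subset_sum_le => //; exact: fset_uniq.
Qed.

Lemma cvg_subsets_sum_ge0 f : (forall u, 0 <= f u) ->
  (\esum_(u in [set: {fset nat}]) (f u)%:E < +oo)%E ->
  (fun n => \sum_(u <- subsets n) f u) @ \oo -->
  fine (\esum_(u in [set: {fset nat}]) (f u)%:E).
Proof.
move=> f0 foo; set s := \esum_(u in _) _.
have sfin : s = (fine s)%:E.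
  by rewrite fineK// ge0_fin_numE// esum_ge0// => u _; rewrite lee_fin.
pose S n := \sum_(u <- subsets n) f u.
have Sle n : S n <= fine s by rewrite -lee_fin -sfin; exact: subsets_sum_le_esum.
have Smon : nondecreasing_seq S.
  move=> m n mn; apply: subset_sum_le => //; first exact: subsets_uniq.
  exact: subsets_subset.
have Scvg : cvgn S.
  apply: nondecreasing_is_cvgn => //; exists (fine s) => _ [n _ <-].
  exact: Sle.
suff <- : limn S = fine s by [].
apply/eqP; rewrite eq_le limr_le//=; last by apply: nearW => n; exact: Sle.
rewrite -lee_fin -sfin; apply: esum_le_subsets => // n.
exact: nondecreasing_cvgn_le.
Qed.

Lemma esum_fin_le f f' : (forall u, 0 <= f u <= f' u) ->
  (\esum_(u in [set: {fset nat}]) (f' u)%:E < +oo)%E ->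
  (\esum_(u in [set: {fset nat}]) (f u)%:E < +oo)%E.
Proof.
move=> h; apply: le_lt_trans; apply: le_esum => u _.
by rewrite lee_fin; case/andP: (h u).
Qed.

(** [abs_sum] is an unordered sum; exhausting the finite sets by [subsets n] makes it a sequential
    limit, separately for the positive and the negative parts. *)
Lemma cvg_subsets_sum f :
  (\esum_(u in [set: {fset nat}]) (`|f u|)%:E < +oo)%E ->
  (fun n => \sum_(u <- subsets n) f u) @ \oo --> abs_sum f.
Proof.
move=> foo.
have -> : (fun n => \sum_(u <- subsets n) f u) =
  (fun n => (\sum_(u <- subsets n) Num.max (f u) 0) -
            (\sum_(u <- subsets n) Num.max (- f u) 0)).
  apply/funext => n; rewrite -sumrB; apply: eq_bigr => u _.
  by rewrite /Num.max; case: ifP; case: ifP; lra.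
rewrite /abs_sum; apply: cvgB; apply: cvg_subsets_sum_ge0.
- by move=> u; rewrite le_max lexx orbT.
- apply: esum_fin_le foo => u; rewrite le_max lexx orbT /= ge_max normr_ge0.
  by rewrite ler_norm.
- by move=> u; rewrite le_max lexx orbT.
- apply: esum_fin_le foo => u; rewrite le_max lexx orbT /= ge_max normr_ge0.
  by rewrite -normrN ler_norm.
Qed.

(** Expresses membership in [frakX] by bounded finite products, a form in which finitely many
    coordinates can be changed freely. *)
Lemma esum_fin_prodP (t : nat -> R) : (forall j, 0 <= t j) ->
  ((\esum_(u in [set: {fset nat}]) (\prod_(j <- u) t j)%:E < +oo)%E <->
   exists c, forall n, \prod_(0 <= j < n) (1 + t j) <= c).
Proof.
move=> t0; have p0 (u : {fset nat}) : 0 <= \prod_(j <- u) t j by exact: prodr_ge0.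
split=> [foo|[c hc]].
  exists (fine (\esum_(u in [set: {fset nat}]) (\prod_(j <- u) t j)%:E)) => n.
  rewrite prod1D_subsets -lee_fin fineK; first exact: subsets_sum_le_esum.
  by rewrite ge0_fin_numE// esum_ge0// => u _; rewrite lee_fin.
apply: (@le_lt_trans _ _ c%:E); last exact: ltry.
by apply: esum_le_subsets => // n; rewrite -prod1D_subsets.
Qed.

(** The infinite product of the [1 + t j] over [j >= l]: setting the first [l] factors to 1 turns it
    into an [abs_sum] over finite sets, to which [cvg_subsets_sum] applies. *)
Definition tail_prod (t : nat -> R) l :=
  abs_sum (fun u : {fset nat} => \prod_(j <- u) (if (j < l)%N then 0 else t j)).

Lemma cvg_tail_prod (t : nat -> R) l :
  (\esum_(u in [set: {fset nat}]) (`|\prod_(j <- u) t j|)%:E < +oo)%E ->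
  (fun n => \prod_(l <= j < n) (1 + t j)) @ \oo --> tail_prod t l.
Proof.
move=> foo; set t' := fun j => if (j < l)%N then 0 else t j.
have {}foo : (\esum_(u in [set: {fset nat}]) (`|\prod_(j <- u) t' j|)%:E < +oo)%E.
  apply: esum_fin_le foo => u; rewrite normr_ge0 /= !normr_prod.
  apply: ler_prod => j _; rewrite normr_ge0 /= /t'.
  by case: ifP; rewrite ?normr0.
have h := cvg_subsets_sum foo; refine (cvg_trans _ h).
apply: near_eq_cvg; near=> n.
rewrite -prod1D_subsets (@big_cat_nat _ _ _ l)//=; last by near: n; exact: nbhs_infty_ge.
rewrite [X in X * _]big_nat_cond big1 ?mul1r => [|j]; last first.
  by rewrite andbT /t' => /= ->; rewrite addr0.
rewrite big_nat_cond [RHS]big_nat_cond; apply: eq_bigr => j.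
by rewrite andbT => /andP[lj _]; rewrite /t' ltnNge lj.
Unshelve. all: by end_near. Qed.

End subsets_sum.

Lemma abs_le_mean (R : realFieldType) (x y z : R) : 0 <= x -> 0 <= y ->
  z ^+ 2 <= x * y -> `|z| <= (x + y) / 2.
Proof.
move=> x0 y0 h; rewrite -(@ler_pXn2r _ 2)// ?nnegrE ?divr_ge0 ?addr_ge0//.
rewrite real_normK ?num_real// (le_trans h)// -subr_ge0.
by rewrite (_ : _ - _ = ((x - y) / 2) ^+ 2) ?sqr_ge0//; field.
Qed.

Lemma psd_comp (R : realType) (E E' : Type) (phi : E' -> E) (L : E -> E -> R) :
  psd L -> psd (fun x y => L (phi x) (phi y)).
Proof.
move=> [sL pL]; split=> [x y|s]; first exact: sL.
have := pL [seq (p.1, phi p.2) | p <- s]; rewrite /qform big_map.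
by under eq_bigr do rewrite big_map.
Qed.

Lemma cvg_qform (R : realType) (E : Type) (Ln : nat -> E -> E -> R) L s :
  (forall x y, Ln ^~ x ^~ y @ \oo --> L x y) ->
  (fun n => qform (Ln n) s) @ \oo --> qform L s.
Proof.
move=> h; apply: cvg_bigsum => p; apply: cvg_bigsum => q.
exact: cvgMr.
Qed.

Lemma qform_ge0 (R : realType) (E : Type) (L : E -> E -> R) s : psd L -> 0 <= qform L s.
Proof. by move=> pL; exact: pL.2. Qed.

(** * Anchored product kernels *)

Section product_kernel.
Variables (R : realType) (d : measure_display) (D : measurableType d).
Variables (k : D -> D -> R) (g : nat -> R) (a : D).
Hypothesis k_psd : psd k.
Hypothesis g_gt0 : forall j, 0 < g j.

Local Notation E := (prodspace nat D).
Local Notation FX := (frakX k (prod_weight g)).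
Local Notation K := (ker_K k (prod_weight g)).

Definition anchor : E := fun=> a.
Definition factor (j : nat) (x y : E) : R := g j * k (x j) (y j).
Definition restrict (l : nat) (x : E) : E := fun j => if (j < l)%N then x j else a.
(** The factor of K(x, y) that remains from the coordinates [j >= l] when [x] is anchored there. Its
    value at the anchor is the number A_l. *)
Definition tail_sec (l : nat) (y : E) : R := tail_prod (fun j => factor j anchor y) l.

Hypothesis X_anchor : FX anchor.

Lemma prod_weight_gt0 u : 0 < prod_weight g u.
Proof. exact: prodr_gt0. Qed.

Lemma prod_weight_ge0 u : 0 <= prod_weight g u.
Proof. exact/ltW/prod_weight_gt0. Qed.

Lemma prod_weight0 : prod_weight g fset0 = 1.
Proof. exact: big_seq_fset0. Qed.

Lemma ker_u0 x y : ker_u k fset0 x y = 1.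
Proof. exact: big_seq_fset0. Qed.

Lemma factorE u x y :
  prod_weight g u * ker_u k u x y = \prod_(j <- u) factor j x y.
Proof. by rewrite -big_split. Qed.

Lemma factor_psd j : psd (factor j).
Proof. by apply: psdZ (psd_comp (fun x : E => x j) k_psd); exact: ltW. Qed.

Lemma ker_u_psd u : psd (ker_u k u).
Proof.
apply: (psd_prod _ (F := fun j (x y : E) => k (x j) (y j))) => j.
exact: (psd_comp (fun x : E => x j) k_psd).
Qed.

Lemma factor_diag_ge0 j x : 0 <= factor j x x.
Proof. exact: psd_diag (factor_psd j). Qed.

Lemma eq_ker_u u x x' y : (forall j, j \in u -> x j = x' j) ->
  ker_u k u x y = ker_u k u x' y.
Proof.
by move=> e; rewrite /ker_u big_seq [RHS]big_seq; apply: eq_bigr => j /e ->.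
Qed.

Lemma frakXE x : FX x <->
  (\esum_(u in [set: {fset nat}]) (\prod_(j <- u) factor j x x)%:E < +oo)%E.
Proof.
by rewrite /frakX /=; under eq_esum do rewrite factorE.
Qed.

Lemma frakX_bounded x :
  FX x <-> exists c, forall n, \prod_(0 <= j < n) (1 + factor j x x) <= c.
Proof.
by rewrite frakXE; apply: esum_fin_prodP => j; exact: factor_diag_ge0.
Qed.

(** All factors on the diagonal are at least 1, so the altered ones multiply the bound by the fixed
    finite product [q x' 0 l]. *)
Lemma frakX_perturb l x x' : (forall j, (l <= j)%N -> x' j = x j) -> FX x -> FX x'.
Proof.
move=> xx' /frakX_bounded[c hc]; apply/frakX_bounded.
pose q (y : E) m n := \prod_(m <= j < n) (1 + factor j y y).
have q1 y m n : 1 <= q y m n.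
  apply: (big_ind (fun z : R => 1 <= z)) => //; first exact: mulr_ege1.
    by move=> j _; rewrite lerDl factor_diag_ge0.
have q_cat y m n p : (m <= n <= p)%N -> q y m p = q y m n * q y n p.
  by move=> /andP[mn np]; rewrite /q (@big_cat_nat _ _ _ n).
exists (q x' 0%N l * c) => n; have q0 y m p : 0 <= q y m p by exact: le_trans (q1 _ _ _).
apply: (@le_trans _ _ (q x' 0%N (maxn l n))).
  by rewrite (q_cat x' 0%N n (maxn l n)) ?leq_maxr// ler_peMr ?q0 ?q1.
rewrite (q_cat x' 0%N l (maxn l n)) ?leq_maxl// ler_wpM2l ?q0//.
have -> : q x' l (maxn l n) = q x l (maxn l n).
  rewrite /q big_nat_cond [RHS]big_nat_cond; apply: eq_bigr => j.
  by rewrite andbT => /andP[lj _]; rewrite /factor xx'.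
apply: le_trans (hc (maxn l n)); rewrite -/(q x 0%N _).
by rewrite (q_cat x 0%N l (maxn l n)) ?leq_maxl// ler_peMl ?q0 ?q1.
Qed.

(** Cauchy-Schwarz for each product kernel bounds an off-diagonal term by the mean of the two
    diagonal terms. *)
Lemma summable_factor x y : FX x -> FX y ->
  (\esum_(u in [set: {fset nat}]) (`|\prod_(j <- u) factor j x y|)%:E < +oo)%E.
Proof.
move=> /frakXE Xx /frakXE Xy; pose P u x y : R := \prod_(j <- u) factor j x y.
have P0 (u : {fset nat}) z : 0 <= P u z z.
  by apply: prodr_ge0 => j _; exact: factor_diag_ge0.
apply: (@esum_fin_le _ _ (fun u => P u x x + P u y y)) => [u|].
  rewrite normr_ge0 /=; apply: (@le_trans _ _ ((P u x x + P u y y) / 2)).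
    apply: abs_le_mean => //; apply: psd_CS2.
    by apply: psd_prod => j; exact: factor_psd.
  by rewrite ler_pdivrMr// ler_peMr ?addr_ge0// ler1n.
under eq_esum do rewrite EFinD.
by rewrite esumD//; [exact: lte_add_pinfty|move=> u _; rewrite lee_fin; exact: P0..].
Qed.

Lemma cvg_factor_tail l y : FX y ->
  (fun n => \prod_(l <= j < n) (1 + factor j anchor y)) @ \oo --> tail_sec l y.
Proof. by move=> Xy; apply: cvg_tail_prod; exact: summable_factor. Qed.

Lemma cvg_factor_K x y : FX x -> FX y ->
  (fun n => \prod_(0 <= j < n) (1 + factor j x y)) @ \oo --> K x y.
Proof.
move=> Xx Xy; under eq_fun do rewrite prod1D_subsets.
have -> : K x y = abs_sum (fun u : {fset nat} => \prod_(j <- u) factor j x y).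
  by congr abs_sum; apply/funext => u; rewrite factorE.
exact/cvg_subsets_sum/summable_factor.
Qed.

(** The source of the components: on points anchored from [l] on, a section of [K] is a finite
    combination of sections of the [ker_u], and the whole tail is a scalar depending on [y]. *)
Lemma K_restricted l x y : (forall j, (l <= j)%N -> x j = a) -> FX y ->
  K x y = \sum_(u <- subsets l) prod_weight g u * ker_u k u x y * tail_sec l y.
Proof.
move=> xa Xy; have Xx : FX x by apply: (@frakX_perturb l anchor) => // j /xa ->.
rewrite -mulr_suml; under eq_bigr do rewrite factorE.
rewrite -prod1D_subsets; set c := (X in _ = X * _).
apply: (cvg_unique _ (cvg_factor_K Xx Xy)); first exact: Rhausdorff.
have h : (fun n => c * \prod_(l <= j < n) (1 + factor j anchor y)) @ \oo -->
    c * tail_sec l y by apply: cvgMr; exact: cvg_factor_tail.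
apply: (cvg_trans _ h); apply: near_eq_cvg; near=> n.
rewrite /= (@big_cat_nat _ _ _ l 0)//=; last by near: n; exact: nbhs_infty_ge.
congr (_ * _); rewrite big_nat_cond [RHS]big_nat_cond; apply: eq_bigr => j.
by rewrite andbT => /andP[lj _]; rewrite /factor xa.
Unshelve. all: by end_near. Qed.

Lemma ker_u_restrict l u x y : u \in subsets l ->
  ker_u k u (restrict l x) y = ker_u k u x y.
Proof.
move=> /mem_subsetsP ul; apply: eq_ker_u => j /ul jl.
by rewrite /restrict jl.
Qed.

Section quadratic_bounds.
Implicit Type s : seq (R * FX).

Local Notation zX := (Sub anchor (mem_set X_anchor) : FX).
Local Notation fX := (fun j (x y : FX) => factor j (val x) (val y)).

Let fX_psd j : psd (fX j).
Proof. exact: (psd_comp (fun x : FX => val x) (factor_psd j)). Qed.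

Let cvg_KX (x y : FX) :
  (fun n => \prod_(0 <= j < n) (1 + fX j x y)) @ \oo --> rker K x y.
Proof. by apply: cvg_factor_K; exact: setvalP. Qed.

(** [qform_section_le] in the limit of infinitely many coordinates. [N n] is the part of the kernel
    whose section at the anchor converges to the scalar factor [B], and [P] is the part that
    survives in the components. *)
Lemma qform_section_lim (P : FX -> FX -> R) (N : nat -> FX -> FX -> R) (B : FX -> R) (c : R) s :
  psd P -> (forall n, psd (N n)) ->
  (\forall n \near \oo,
     psd (fun x y => \prod_(0 <= j < n) (1 + fX j x y) - P x y * N n x y)) ->
  (forall y, (fun n => N n zX y) @ \oo --> B y) ->
  (fun n => N n zX zX) @ \oo --> c ->
  qform (fun x y => B x * B y * P x y) s <= c * qform (rker K) s.
Proof.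
move=> pP pN pK NB Nc.
have lhs : (fun n => qform (fun x y => N n zX x * N n zX y * P x y) s) @ \oo -->
    qform (fun x y => B x * B y * P x y) s.
  apply: (cvg_qform (Ln := fun n x y => N n zX x * N n zX y * P x y)) => x y.
  by apply: cvgMl; exact: cvgM.
have rhs : (fun n => N n zX zX * qform (fun x y => \prod_(0 <= j < n) (1 + fX j x y)) s)
    @ \oo --> c * qform (rker K) s.
  apply: cvgM => //.
  by apply: (cvg_qform (Ln := fun n x y => \prod_(0 <= j < n) (1 + fX j x y))) => x y.
rewrite -(cvg_lim _ lhs)// -(cvg_lim _ rhs)//; apply: ler_lim.
- by apply/cvg_ex; eexists; exact: lhs.
- by apply/cvg_ex; eexists; exact: rhs.
near=> n; apply: qform_section_le => //.
by near: n.
Unshelve. all: by end_near. Qed.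

Let sum_qform_ker_u l (B : FX -> R) s :
  \sum_(u <- subsets l) prod_weight g u *
    qform (fun x y => B x * B y * ker_u k u (val x) (val y)) s =
  qform (fun x y => B x * B y * \prod_(0 <= j < l) (1 + fX j x y)) s.
Proof.
under eq_bigr do rewrite -qformZ.
rewrite -qform_sum; apply: eq_qform => x y.
rewrite prod1D_subsets mulr_sumr; apply: eq_bigr => u _.
by rewrite -factorE; ring.
Qed.

Let cat_fX l n (x y : FX) : (l <= n)%N ->
  \prod_(0 <= j < n) (1 + fX j x y) =
  \prod_(0 <= j < l) (1 + fX j x y) * \prod_(l <= j < n) (1 + fX j x y).
Proof. by move=> ln; rewrite (@big_cat_nat _ _ _ l). Qed.

(** [P] is the product of the factors below [l] and [N] that of the others; together they are the
    whole kernel, so the domination is an equality. *)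
Lemma qform_high l s :
  \sum_(u <- subsets l) prod_weight g u * qform (fun x y : FX =>
    tail_sec l (val x) * tail_sec l (val y) * ker_u k u (val x) (val y)) s
  <= tail_sec l anchor * qform (rker K) s.
Proof.
rewrite (sum_qform_ker_u l (fun x : FX => tail_sec l (val x))).
apply: (qform_section_lim (N := fun n x y => \prod_(l <= j < n) (1 + fX j x y))).
- exact: psd_prod1D.
- by move=> n; exact: psd_prod1D.
- near=> n; apply: eq_psd (psdZ (lexx 0) (psd1 R FX)) => x y.
  by rewrite mul0r (@cat_fX l) ?subrr//; near: n; exact: nbhs_infty_ge.
- by move=> y; apply: cvg_factor_tail; exact: setvalP.
- exact: cvg_factor_tail.
Unshelve. all: by end_near. Qed.

(** The difference of the two tails is itself the section of a semidefinite kernel, namely [N], the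
    middle product minus 1 times the tail from [l'] on. What [P * N] leaves of the kernel is the
    product over the coordinates outside [[l, l')]. *)
Lemma qform_low l l' s : (l <= l')%N ->
  \sum_(u <- subsets l) prod_weight g u * qform (fun x y : FX =>
    (tail_sec l (val x) - tail_sec l' (val x)) *
    (tail_sec l (val y) - tail_sec l' (val y)) * ker_u k u (val x) (val y)) s
  <= (tail_sec l anchor - tail_sec l' anchor) * qform (rker K) s.
Proof.
move=> ll'; rewrite (sum_qform_ker_u l (fun x : FX => tail_sec l (val x) - tail_sec l' (val x))).
pose N n x y := (\prod_(l <= j < l') (1 + fX j x y) - 1) * \prod_(l' <= j < n) (1 + fX j x y).
have NE n (x y : FX) : (l' <= n)%N -> N n x y =
    \prod_(l <= j < n) (1 + fX j x y) - \prod_(l' <= j < n) (1 + fX j x y).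
  by move=> l'n; rewrite /N (@big_cat_nat _ _ _ l' l n)//=; ring.
have NB (y : E) : FX y -> (fun n => \prod_(l <= j < n) (1 + factor j anchor y) -
    \prod_(l' <= j < n) (1 + factor j anchor y)) @ \oo --> tail_sec l y - tail_sec l' y.
  by move=> Xy; apply: cvgB; exact: cvg_factor_tail.
have NB' (y : FX) : (fun n => N n zX y) @ \oo --> tail_sec l (val y) - tail_sec l' (val y).
  apply: cvg_trans (NB _ (setvalP y)); apply: near_eq_cvg; near=> n.
  by rewrite NE//; near: n; exact: nbhs_infty_ge.
apply: (qform_section_lim (N := N)) => //.
- exact: psd_prod1D.
- by move=> n; apply: psdM; [exact: psd_prod1D_sub1|exact: psd_prod1D].
- near=> n; have l'n : (l' <= n)%N by near: n; exact: nbhs_infty_ge.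
  apply: (eq_psd (L := fun x y => \prod_(0 <= j < l) (1 + fX j x y) *
      \prod_(l' <= j < n) (1 + fX j x y))) => [x y|].
    rewrite (@cat_fX l n) ?(leq_trans ll')//.
    by have := NE n x y l'n; rewrite /N => ->; ring.
  by apply: psdM; exact: psd_prod1D.
Unshelve. all: by end_near. Qed.

(** Here [P = 1] and [N = T - 1] with [T] the tail product from [l] on; with [F] the product of the
    factors below [l], the remainder is [F T - (T - 1) = (F - 1) T + 1]. *)
Lemma qform_bias l s :
  (\sum_(p <- s) p.1 * (tail_sec l (val p.2) - 1)) ^+ 2
  <= (tail_sec l anchor - 1) * qform (rker K) s.
Proof.
rewrite -(qform_rank1 (fun y : FX => tail_sec l (val y) - 1)).
rewrite (_ : qform _ s = qform (fun x y : FX =>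
  (tail_sec l (val x) - 1) * (tail_sec l (val y) - 1) * 1) s); last first.
  by apply: eq_qform => x y; rewrite mulr1.
apply: (qform_section_lim (N := fun n x y => \prod_(l <= j < n) (1 + fX j x y) - 1)).
- exact: psd1.
- by move=> n; exact: psd_prod1D_sub1.
- near=> n; apply: (eq_psd (L := fun x y => (\prod_(0 <= j < l) (1 + fX j x y) - 1) *
      \prod_(l <= j < n) (1 + fX j x y) + 1)) => [x y|].
    by rewrite (@cat_fX l n); [ring|near: n; exact: nbhs_infty_ge].
  apply: psdD; last exact: psd1.
  by apply: psdM; [exact: psd_prod1D_sub1|exact: psd_prod1D].
- by move=> y; apply: cvgB; [apply: cvg_factor_tail; exact: setvalP|exact: cvg_cst].
- by apply: cvgB; [exact: cvg_factor_tail|exact: cvg_cst].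
Unshelve. all: by end_near. Qed.

End quadratic_bounds.
End product_kernel.

(** * Components of anchored functions *)

Section decomposition.
Variables (R : realType) (d : measure_display) (D : measurableType d).
Variables (k : D -> D -> R) (g : nat -> R) (a : D).
Hypothesis k_psd : psd k.
Hypothesis g_gt0 : forall j, 0 < g j.

Local Notation E := (prodspace nat D).
Local Notation FX := (frakX k (prod_weight g)).
Local Notation K := (ker_K k (prod_weight g)).
Local Notation A l y := (tail_sec k g a l y).

Hypothesis X_anchor : FX (anchor a).
Variable Hu : forall u : {fset nat}, rkhs [set: E] (ker_u k u).
Variable HK : rkhs FX K.

Lemma comb_kerK_restricted l x (s : seq (R * FX)) : (forall j, (l <= j)%N -> x j = a) ->
  comb K s x = \sum_(u <- subsets l) \sum_(p <- s)
    p.1 * (prod_weight g u * A l (val p.2) * ker_u k u x (val p.2)).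
Proof.
move=> xa; have Xx : FX x by apply: (frakX_perturb k_psd g_gt0 (l := l) _ X_anchor) => j /xa ->.
rewrite /comb exchange_big /=; apply: eq_bigr => p _.
rewrite ksecE// (K_restricted k_psd g_gt0 X_anchor xa (setvalP _)) mulr_sumr.
by apply: eq_bigr => u _; ring.
Qed.

Section component.
Variables (B : {fset nat} -> E -> R).

(** The share of the section of [K] at [y] in H_u. The scalar [B u y] comes from the anchored
    coordinates; it is later a tail product or a difference of two. *)
Definition component_sec u (y : FX) : E -> R :=
  fun x => prod_weight g u * B u (val y) * ker_u k u x (val y).

Lemma component_secC u y : rkhs_carrier (Hu u) (component_sec u y).
Proof.
apply: carrierZ; have := ksecC (Hu u) (x := val y) I; congr (rkhs_carrier _ _).
by apply/funext => x; rewrite ksecE.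
Qed.

Lemma sqn_component u (s : seq (R * FX)) :
  sqn (Hu u) (fun x => \sum_(p <- s) p.1 * component_sec u p.2 x) =
  prod_weight g u ^+ 2 *
    qform (fun x y : FX => B u (val x) * B u (val y) * ker_u k u (val x) (val y)) s.
Proof.
pose r := [seq (p.1 * (prod_weight g u * B u (val p.2)),
  Sub (val p.2) (mem_set I) : [set: E]) | p <- s].
have -> : (fun x => \sum_(p <- s) p.1 * component_sec u p.2 x) = comb (ker_u k u) r.
  apply/funext => x; rewrite /comb big_map; apply: eq_bigr => p _.
  by rewrite ksecE//= /component_sec mulrA.
rewrite sqn_comb /qform big_map mulr_sumr; apply: eq_bigr => p _.
rewrite big_map mulr_sumr; apply: eq_bigr => q _.
by rewrite /rker /=; ring.
Qed.

(** All summands being nonnegative, the joint bound controls each [u] separately, which yields the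
    limits [h u] by [comb_extend]. The joint bound, with one constant [c] for the whole of [r], then
    passes to the limit by continuity of the norms. *)
Lemma component_limit (r : seq {fset nat}) (c : R) (s : nat -> seq (R * FX)) f :
  (forall t : seq (R * FX), \sum_(u <- r) prod_weight g u * qform (fun x y : FX =>
      B u (val x) * B u (val y) * ker_u k u (val x) (val y)) t
    <= c * qform (rker K) t) ->
  rkhs_carrier HK f ->
  (fun n => sqn HK (comb K (s n) \- f)) @ \oo --> (0 : R) ->
  exists h : {fset nat} -> E -> R,
    (forall u, u \in r -> rkhs_carrier (Hu u) (h u) /\
       (fun n => sqn (Hu u) ((fun x => \sum_(p <- s n) p.1 * component_sec u p.2 x)
          \- h u)) @ \oo --> (0 : R)) /\
    \sum_(u <- r) sqn (Hu u) (h u) / prod_weight g u <= c * sqn HK f.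
Proof.
move=> bc Cf sf.
have q0 u t : 0 <= qform (fun x y : FX =>
    B u (val x) * B u (val y) * ker_u k u (val x) (val y)) t.
  rewrite (qform_weight (fun x : FX => B u (val x))); apply: qform_ge0.
  exact: (psd_comp (fun x : FX => val x) (ker_u_psd k_psd u)).
have T1 u : u \in r -> exists h, rkhs_carrier (Hu u) h /\
    (fun n => sqn (Hu u) ((fun x => \sum_(p <- s n) p.1 * component_sec u p.2 x)
      \- h)) @ \oo --> (0 : R).
  move=> ur; suff bT t : sqn (Hu u) (fun x => \sum_(p <- t) p.1 * component_sec u p.2 x)
      <= prod_weight g u * c * qform (rker K) t.
    have [h Ch hl] := comb_extend (component_secC u) bT Cf sf.
    by exists h; split.
  rewrite sqn_component expr2 -!mulrA ler_wpM2l ?prod_weight_ge0//.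
  apply: le_trans (bc t); rewrite (big_rem u)//= lerDl.
  by apply: sumr_ge0 => v _; rewrite mulr_ge0 ?prod_weight_ge0.
have {T1} T2 u : exists h, u \in r -> rkhs_carrier (Hu u) h /\
    (fun n => sqn (Hu u) ((fun x => \sum_(p <- s n) p.1 * component_sec u p.2 x)
      \- h)) @ \oo --> (0 : R).
  by have [/T1[h hh]|_] := boolP (u \in r); [exists h|exists (fun=> 0)].
have [h hh] := choice T2; exists h; split=> //.
have Tc u n : rkhs_carrier (Hu u) (fun x => \sum_(p <- s n) p.1 * component_sec u p.2 x).
  elim: (s n) => [|p t IH].
    rewrite (_ : (fun x => _) = fun=> 0); first exact: rkhs_zero.
    by apply/funext => x; exact: big_nil.
  rewrite (_ : (fun x => _) = (fun x => \sum_(p <- t) p.1 * component_sec u p.2 x)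
     \+ (fun x => p.1 * component_sec u p.2 x)).
    by apply: carrierZD => //; exact: component_secC.
  by apply/funext => x; rewrite big_cons addrC.
have lhs : (fun n => \sum_(u <- r) (sqn (Hu u)
      (fun x => \sum_(p <- s n) p.1 * component_sec u p.2 x)) / prod_weight g u)
    @ \oo --> \sum_(u <- r) sqn (Hu u) (h u) / prod_weight g u.
  (* Convergence is known for [u] in [r] only, so the membership test is moved into the summand. *)
  rewrite big_seq; under eq_fun do rewrite big_seq.
  rewrite (_ : (fun n => _) = fun n => \sum_(u <- r) if u \in r then
      (sqn (Hu u) (fun x => \sum_(p <- s n) p.1 * component_sec u p.2 x)) / prod_weight g u
      else 0); last by apply/funext => n; rewrite big_mkcond.
  rewrite big_mkcond /=; apply: (cvg_bigsum (u := fun u n => if u \in r then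
      (sqn (Hu u) (fun x => \sum_(p <- s n) p.1 * component_sec u p.2 x)) / prod_weight g u
      else 0)) => u.
  case: ifPn => [ur|_]; last exact: cvg_cst.
  have [Ch hl] := hh u ur; apply: cvgMl.
  exact: (cvg_sqn (Tc u) Ch hl).
have rhs : (fun n => c * sqn HK (comb K (s n))) @ \oo --> c * sqn HK f.
  by apply: cvgMr; exact: (cvg_sqn (fun n => combC HK (s n)) Cf sf).
rewrite -(cvg_lim _ lhs)// -(cvg_lim _ rhs)//; apply: ler_lim.
- by apply/cvg_ex; eexists; exact: lhs.
- by apply/cvg_ex; eexists; exact: rhs.
near=> n; rewrite sqn_comb; apply: le_trans (bc (s n)).
rewrite le_eqVlt; apply/orP; left; apply/eqP/eq_bigr => u _.
by rewrite sqn_component; field; rewrite gt_eqF ?prod_weight_gt0.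
Unshelve. all: by end_near. Qed.

End component.

Lemma tail_sec_anti l l' : (l <= l')%N -> A l' (anchor a) <= A l (anchor a).
Proof.
move=> ll'; have cv i := cvg_factor_tail k_psd g_gt0 X_anchor (l := i) X_anchor.
rewrite -(cvg_lim _ (cv l))// -(cvg_lim _ (cv l'))//; apply: ler_lim.
- by apply/cvg_ex; eexists; exact: cv.
- by apply/cvg_ex; eexists; exact: cv.
near=> n; have l'n : (l' <= n)%N by near: n; exact: nbhs_infty_ge.
rewrite [leRHS](@big_cat_nat _ _ _ l')//= ler_peMl//.
  by apply: prodr_ge0 => j _; rewrite addr_ge0 ?(factor_diag_ge0 k_psd g_gt0).
apply: (big_ind (fun z : R => 1 <= z)) => //; first exact: mulr_ege1.
by move=> j _; rewrite lerDl (factor_diag_ge0 k_psd g_gt0).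
Unshelve. all: by end_near. Qed.

Lemma tail_sec_ge1 l : 1 <= A l (anchor a).
Proof.
have cv := cvg_factor_tail k_psd g_gt0 X_anchor (l := l) X_anchor.
rewrite -(cvg_lim _ cv)//; apply: limr_ge; first by apply/cvg_ex; eexists; exact: cv.
near=> n; apply: (big_ind (fun z : R => 1 <= z)) => //; first exact: mulr_ege1.
by move=> j _; rewrite lerDl (factor_diag_ge0 k_psd g_gt0).
Unshelve. all: by end_near. Qed.

Section levels.
Variables (first : bool) (lo hi : nat).
Hypothesis lohi : (lo <= hi)%N.

(** The flag [first] cannot be replaced by [lo = 0]: [subsets 0] contains [fset0], which would
    subtract the value of [f] at the anchor, whereas Psi_0 f is 0. *)
Definition low_sets : seq {fset nat} := if first then [::] else subsets lo.

Definition level_sec u y := A hi y - (if u \in low_sets then A lo y else 0).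

(** Old sets carry the coefficient [A hi - A lo] and new ones [A hi], hence two norm bounds, from
    [qform_low] and [qform_high]. The last clause keeps the constant component as a limit along [s],
    in the form needed for the telescoping of the bias. *)
Lemma level_decomposition (s : nat -> seq (R * FX)) f :
  rkhs_carrier HK f ->
  (fun n => sqn HK (comb K (s n) \- f)) @ \oo --> (0 : R) ->
  exists h : {fset nat} -> E -> R,
  [/\ forall u, u \in subsets hi -> rkhs_carrier (Hu u) (h u),
      forall x : E, (forall j, (hi <= j)%N -> x j = a) ->
        f x - (if first then 0 else f (restrict a lo x)) = \sum_(u <- subsets hi) h u x,
      \sum_(u <- [seq u <- subsets hi | u \notin low_sets])
        sqn (Hu u) (h u) / prod_weight g u <= A hi (anchor a) * sqn HK f,
      \sum_(u <- [seq u <- subsets hi | u \in low_sets])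
        sqn (Hu u) (h u) / prod_weight g u
        <= (A lo (anchor a) - A hi (anchor a)) * sqn HK f &
      forall x, (fun n => \sum_(p <- s n) p.1 * level_sec fset0 (val p.2)) @ \oo --> h fset0 x].
Proof.
move=> Cf sf; pose Q u (t : seq (R * FX)) := prod_weight g u * qform (fun x y : FX =>
  level_sec u (val x) * level_sec u (val y) * ker_u k u (val x) (val y)) t.
have Q0 u t : 0 <= Q u t.
  rewrite mulr_ge0 ?prod_weight_ge0//.
  rewrite (qform_weight (fun x : FX => level_sec u (val x))); apply: qform_ge0.
  exact: (psd_comp (fun x : FX => val x) (ker_u_psd k_psd u)).
have [|h1 [h1C h1b]] := @component_limit level_sec
  [seq u <- subsets hi | u \notin low_sets] (A hi (anchor a)) s f _ Cf sf.
  move=> t; apply: le_trans (qform_high k_psd g_gt0 X_anchor hi t).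
  rewrite big_filter big_mkcond /=; apply: ler_sum => u _; case: ifPn => [ul|_].
    rewrite ler_wpM2l ?prod_weight_ge0// le_eqVlt; apply/orP; left; apply/eqP.
    by apply: eq_qform => x y; rewrite /level_sec (negbTE ul) !subr0.
  rewrite mulr_ge0 ?prod_weight_ge0//.
  rewrite (qform_weight (fun x : FX => A hi (val x))); apply: qform_ge0.
  exact: (psd_comp (fun x : FX => val x) (ker_u_psd k_psd u)).
have [|h2 [h2C h2b]] := @component_limit level_sec
  [seq u <- subsets hi | u \in low_sets] (A lo (anchor a) - A hi (anchor a)) s f _ Cf sf.
  move=> t; have qK : 0 <= qform (rker K) t by apply/qform_ge0/rker_psd.
  rewrite -/(\sum_(u <- _) Q u t) /low_sets; case fE: first => /=.
    by rewrite filter_pred0 big_nil mulr_ge0// subr_ge0 tail_sec_anti.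
  apply: (@le_trans _ _ (\sum_(u <- subsets lo) Q u t)).
    apply: subset_sum_le => //; first by rewrite filter_uniq// subsets_uniq.
    by move=> u; rewrite mem_filter => /andP[].
  apply: le_trans (qform_low k_psd g_gt0 X_anchor t lohi).
  rewrite big_seq [leRHS]big_seq; apply: ler_sum => u ul.
  rewrite ler_wpM2l ?prod_weight_ge0// le_eqVlt; apply/orP; left; apply/eqP.
  by apply: eq_qform => x y; rewrite /level_sec /low_sets fE ul; ring.
pose h u := if u \in low_sets then h2 u else h1 u; exists h.
have hC u : u \in subsets hi -> rkhs_carrier (Hu u) (h u) /\
       (fun n => sqn (Hu u) ((fun x => \sum_(p <- s n) p.1 * component_sec level_sec u p.2 x)
          \- h u)) @ \oo --> (0 : R).
  move=> uhi; rewrite /h; case: ifPn => ul.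
    by apply: h2C; rewrite mem_filter ul.
  by apply: h1C; rewrite mem_filter ul.
have Tc u n : rkhs_carrier (Hu u) (fun x => \sum_(p <- s n) p.1 * component_sec level_sec u p.2 x).
  elim: (s n) => [|p t IH].
    rewrite (_ : (fun x => _) = fun=> 0); first exact: rkhs_zero.
    by apply/funext => x; exact: big_nil.
  rewrite (_ : (fun x => _) = (fun x => \sum_(p <- t) p.1 * component_sec level_sec u p.2 x)
     \+ (fun x => p.1 * component_sec level_sec u p.2 x)).
    by apply: carrierZD => //; exact: component_secC.
  by apply/funext => x; rewrite big_cons addrC.
have hE u x : u \in subsets hi ->
    (fun n => \sum_(p <- s n) p.1 * component_sec level_sec u p.2 x) @ \oo --> h u x.
  by move=> /hC[Ch hl]; exact: (cvg_eval (x := x) (Tc u) Ch hl).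
split.
- by move=> u /hC[].
- move=> x xa; have fcv y := cvg_eval (x := y) (fun n => combC HK (s n)) Cf sf.
  have lhs : (fun n => comb K (s n) x - (if first then 0 else comb K (s n) (restrict a lo x)))
      @ \oo --> f x - (if first then 0 else f (restrict a lo x)).
    apply: cvgB; first exact: fcv.
    by case: first => //; exact: cvg_cst.
  have rhs : (fun n => \sum_(u <- subsets hi) if u \in subsets hi then
      \sum_(p <- s n) p.1 * component_sec level_sec u p.2 x else 0) @ \oo -->
      \sum_(u <- subsets hi) if u \in subsets hi then h u x else 0.
    apply: (cvg_bigsum (u := fun u n => if u \in subsets hi then
      \sum_(p <- s n) p.1 * component_sec level_sec u p.2 x else 0)) => u.
    by case: ifPn => [uh|_]; [exact: hE|exact: cvg_cst].
  rewrite [RHS]big_seq big_mkcond /=.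
  apply: (cvg_unique _ lhs); first exact: Rhausdorff.
  apply: (cvg_trans _ rhs); apply: near_eq_cvg; near=> n.
  rewrite /= -big_mkcond -big_seq (comb_kerK_restricted _ xa).
  transitivity (\sum_(u <- subsets hi) \sum_(p <- s n) p.1 *
      (prod_weight g u * A hi (val p.2) * ker_u k u x (val p.2)) -
     \sum_(u <- low_sets) \sum_(p <- s n) p.1 *
      (prod_weight g u * A lo (val p.2) * ker_u k u x (val p.2))).
    rewrite [X in _ - X](_ : _ = \sum_(u <- subsets hi | u \in low_sets) \sum_(p <- s n) p.1 *
      (prod_weight g u * A lo (val p.2) * ker_u k u x (val p.2))).
      rewrite [X in _ - X]big_mkcond -sumrB; apply: eq_bigr => u _; case: ifPn => ul.
        by rewrite -sumrB; apply: eq_bigr => p _; rewrite /component_sec /level_sec ul; ring.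
      by rewrite subr0; apply: eq_bigr => p _; rewrite /component_sec /level_sec (negbTE ul); ring.
    rewrite -[RHS]big_filter; apply: perm_big; apply: uniq_perm.
    + by rewrite /low_sets; case: first => //; exact: subsets_uniq.
    + by rewrite filter_uniq// subsets_uniq.
    + move=> u; rewrite mem_filter /low_sets; case: first => //.
      by apply/idP/andP => [ul|[]//]; split=> //; exact: subsets_subset ul.
  congr (_ - _); rewrite /low_sets; case: first => //; first by rewrite big_nil.
  have ra j : (lo <= j)%N -> restrict a lo x j = a by rewrite /restrict ltnNge => ->.
  rewrite (comb_kerK_restricted _ ra) big_seq [RHS]big_seq; apply: eq_bigr => u ul.
  by apply: eq_bigr => p _; rewrite ker_u_restrict.
- rewrite big_seq (eq_bigr (fun u => sqn (Hu u) (h1 u) / prod_weight g u)) -?big_seq// => u.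
  by rewrite mem_filter => /andP[ul _]; rewrite /h (negbTE ul).
- rewrite big_seq (eq_bigr (fun u => sqn (Hu u) (h2 u) / prod_weight g u)) -?big_seq// => u.
  by rewrite mem_filter => /andP[ul _]; rewrite /h ul.
- move=> x; have := hE fset0 x (fset0_subsets hi).
  apply: cvg_trans; apply: near_eq_cvg; near=> n; apply: eq_bigr => p _.
  by rewrite /component_sec prod_weight0 ker_u0 mul1r mulr1.
Unshelve. all: by end_near. Qed.

End levels.

Lemma bias_limit l (s : nat -> seq (R * FX)) f (b : R) :
  rkhs_carrier HK f ->
  (fun n => sqn HK (comb K (s n) \- f)) @ \oo --> (0 : R) ->
  (fun n => \sum_(p <- s n) p.1 * (A l (val p.2) - 1)) @ \oo --> b ->
  b ^+ 2 <= (A l (anchor a) - 1) * sqn HK f.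
Proof.
move=> Cf sf sb; have lhs : (fun n => (\sum_(p <- s n) p.1 * (A l (val p.2) - 1)) ^+ 2)
    @ \oo --> b ^+ 2.
  by under eq_fun do rewrite expr2; rewrite expr2; exact: cvgM.
have rhs : (fun n => (A l (anchor a) - 1) * sqn HK (comb K (s n))) @ \oo -->
    (A l (anchor a) - 1) * sqn HK f.
  by apply: cvgMr; exact: (cvg_sqn (fun n => combC HK (s n)) Cf sf).
rewrite -(cvg_lim _ lhs)// -(cvg_lim _ rhs)//; apply: ler_lim.
- by apply/cvg_ex; eexists; exact: lhs.
- by apply/cvg_ex; eexists; exact: rhs.
near=> n; rewrite sqn_comb.
exact: (qform_bias k_psd g_gt0 X_anchor).
Unshelve. all: by end_near. Qed.

End decomposition.

(** * Product measures and second moments *)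

Section product_space.
Variables (I : choiceType) (d : measure_display) (D : measurableType d).

Lemma measurable_coord (i : I) :
  measurable_fun [set: prodspace I D] (fun x : prodspace I D => x i).
Proof.
move=> _ B mB; rewrite setTI; apply: sub_sigma_algebra.
by exists i, B.
Qed.

Lemma measurable_to_prodspace dT (T : measurableType dT) (f : T -> prodspace I D) :
  (forall i, measurable_fun [set: T] (fun t => f t i)) -> measurable_fun [set: T] f.
Proof.
move=> mf; apply: (@measurability _ _ T (prodspace I D) setT f (@coord_cylinders I d D)) => //.
move=> _ [_ [i [B [mB ->]]] <-].
exact: (mf i measurableT B mB).
Qed.

Definition cylinders : set (set (prodspace I D)) :=
  [set C | exists (J : {fset I}) (B : I -> set D), (forall i, measurable (B i)) /\
     C = [set x | forall i, i \in J -> B i (x i)]].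

Lemma cylinders_generate : measurable = <<s cylinders >>.
Proof.
apply/seteqP; split.
  apply: smallest_sub; first exact: smallest_sigma_algebra.
  move=> _ [i [B [mB ->]]]; apply: sub_sigma_algebra.
  exists [fset i]%fset, (fun=> B); split=> //; apply/seteqP; split=> x /=.
    by move=> h j; rewrite inE => /eqP ->.
  by apply; rewrite inE.
apply: smallest_sub; first exact: sigma_algebra_measurable.
move=> _ [J [B [mB ->]]].
rewrite (_ : [set x | _] = \bigcap_(i in [set` J]) [set x : prodspace I D | B i (x i)]); last first.
  by apply/seteqP; split.

apply: fin_bigcap_measurable; first exact: finite_fset.
move=> i _; have := @measurable_coord i measurableT _ (mB i).
by rewrite setTI.
Qed.

Lemma cylinders_setI : setI_closed cylinders.
Proof.
move=> _ _ [J [B [mB ->]]] [J' [B' [mB' ->]]].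
exists (J `|` J')%fset, (fun i => (if i \in J then B i else setT) `&`
  (if i \in J' then B' i else setT)); split.
  by move=> i; apply: measurableI; case: ifP.
apply/seteqP; split=> x /=.
  move=> [h h'] i _; split; case: ifP => //; [exact: h|exact: h'].
move=> h; split=> i iJ.
  by have [] := h i; [rewrite inE iJ|rewrite iJ].
have iJJ : i \in (J `|` J')%fset by rewrite inE iJ orbT.
by have [_] := h i iJJ; rewrite iJ.
Qed.

Lemma cylindersT : cylinders setT.
Proof.
by exists fset0, (fun=> setT); split=> //; apply/seteqP; split=> x //= _ i; rewrite inE.
Qed.

End product_space.

Section law.
Variables (R : realType) (d d' : measure_display).
Variables (T : measurableType d) (T' : measurableType d').
Variables (P : probability T R) (P' : probability T' R) (phi : T -> T').

Definition has_law := measurable_fun [set: T] phi /\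
  forall A, measurable A -> P (phi @^-1` A) = P' A.

Hypothesis phi_law : has_law.

Let X : {RV P >-> T'} := mfun_Sub (mem_set phi_law.1).

Let law_measure (f : T' -> \bar R) :
  (\int[P']_y f y = \int[distribution P X]_y f y)%E.
Proof.
apply: eq_measure_integral => A mA _.
exact/esym/phi_law.2.
Qed.

Lemma ge0_integral_law (f : T' -> \bar R) : measurable_fun [set: T'] f ->
  (forall y, 0 <= f y)%E -> (\int[P']_y f y = \int[P]_t f (phi t))%E.
Proof.
by move=> mf f0; rewrite law_measure ge0_integral_distribution.
Qed.

Lemma integrable_law (f : T' -> \bar R) :
  P'.-integrable setT f -> P.-integrable setT (f \o phi).
Proof.
move=> /integrableP[mf foo]; apply/integrableP; split.
  by apply: measurableT_comp => //; exact: phi_law.1.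
rewrite -(ge0_integral_law (f := abse \o f)); first exact: foo.
  exact: measurableT_comp.
by move=> y; exact: abse_ge0.
Qed.

Lemma integral_law (f : T' -> \bar R) :
  P'.-integrable setT f -> (\int[P']_y f y = \int[P]_t f (phi t))%E.
Proof.
move=> fi; rewrite law_measure integral_distribution//; last exact: integrable_law.
exact: measurable_int fi.
Qed.

End law.

Section resampling.
Variables (R : realType) (I : choiceType) (d : measure_display).
Variables (Om : measurableType d) (P : probability Om R).
Variables (Pw : probability (prodspace I Om) R).
Hypothesis Pw_prod : is_product_measure P Pw.

Definition upd (j : I) (o : Om) (om : prodspace I Om) : prodspace I Om :=
  fun i => if i == j then o else om i.

Lemma measurable_upd j :
  measurable_fun [set: Om * prodspace I Om] (fun z : Om * prodspace I Om => upd j z.1 z.2).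
Proof.
apply: measurable_to_prodspace => i; rewrite /upd.
case: eqVneq => [_|_]; first exact: measurable_fst.
exact: (measurableT_comp (@measurable_coord I d Om i) measurable_snd).
Qed.

(** Overwriting one coordinate by an independent sample preserves the product measure. This serves
    as Fubini in a single coordinate without splitting the index type. *)
Lemma resample_law j :
  has_law (P \x Pw)%E Pw (fun z : Om * prodspace I Om => upd j z.1 z.2).
Proof.
split; first exact: measurable_upd.
pose X : {RV (P \x Pw)%E >-> prodspace I Om} := mfun_Sub (mem_set (measurable_upd j)).
suff E A : measurable A -> distribution (P \x Pw)%E X A = Pw A by move=> A /E.
apply: (measure_unique (@cylinders I d Om) (fun=> setT)).
- exact: cylinders_generate.
- exact: cylinders_setI.
- by move=> _; exact: cylindersT.
- by apply/seteqP; split=> // x _; exists 0%N.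
- move=> _ [J [B [mB ->]]]; rewrite /distribution /pushforward /=.
  (* The old value of coordinate [j] is overwritten, so its constraint moves to the fresh sample. *)
  pose B' i := if i == j then setT else B i.
  have mB' i : measurable (B' i) by rewrite /B'; case: ifP.
  rewrite (_ : _ @^-1` _ = (if j \in J then B j else setT) `*`
     [set x : prodspace I Om | forall i, i \in J -> B' i (x i)]); last first.
    apply/seteqP; split=> -[w om] /=; rewrite /upd.
      move=> h; split; first by case: ifP => // /h; rewrite eqxx.
      by move=> i /h; rewrite /B'; case: eqVneq.
    move=> [h1 h2] i iJ; have := h2 i iJ; rewrite /B'.
    by case: eqVneq => // ij _; move: h1; rewrite -ij iJ.
  rewrite product_measure1E; [|by case: ifP|]; last first.
    have : cylinders [set x : prodspace I Om | forall i, i \in J -> B' i (x i)].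
      by exists J, B'.
    by rewrite cylinders_generate; exact: sub_sigma_algebra.
  rewrite (Pw_prod J mB).
  transitivity (P (if j \in J then B j else setT) * \prod_(i <- J) P (B' i))%E.
    by congr (_ * _)%E; exact: (Pw_prod J mB').
  case: ifPn => jJ.
    rewrite (big_fsetD1 j)//= [in RHS](big_fsetD1 j)//= {1}/B' eqxx probability_setT mul1e.
    congr (_ * _)%E; rewrite big_seq [in RHS]big_seq; apply: eq_bigr => i.
    by rewrite !inE /B' => /andP[/negbTE -> _].
  rewrite probability_setT mul1e big_seq [RHS]big_seq; apply: eq_bigr => i iJ.
  by rewrite /B'; case: eqVneq => // ij; rewrite ij (negbTE jJ) in iJ.
- by move=> _; exact: (le_lt_trans (probability_le1 _ _) (ltry _)).
Qed.

Lemma resample_ge0 j (F : prodspace I Om -> \bar R) : measurable_fun setT F ->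
  (forall om, 0 <= F om)%E ->
  (\int[Pw]_om F om = \int[Pw]_om \int[P]_o F (upd j o om))%E.
Proof.
move=> mF F0; rewrite (ge0_integral_law (resample_law j))//.
rewrite (fubini_tonelli2 (fun z => F (upd j z.1 z.2)))//.
by apply: measurableT_comp => //; exact: measurable_upd.
Qed.

Lemma resample_eq0 j (F : prodspace I Om -> \bar R) : Pw.-integrable setT F ->
  (forall om, \int[P]_o F (upd j o om) = 0)%E -> (\int[Pw]_om F om = 0)%E.
Proof.
move=> iF F0; rewrite (integral_law (resample_law j))//.
rewrite -(integral21_prod_meas1 (integrable_law (resample_law j) iF)).
by apply: integral0_eq => om _; rewrite /fubini_G /= F0.
Qed.

Lemma integral_prod_coord (r : seq I) (phi : I -> Om -> R) (m : R) : uniq r ->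
  (forall j o, 0 <= phi j o) -> (forall j, measurable_fun setT (phi j)) ->
  (forall j, \int[P]_o (phi j o)%:E = m%:E)%E ->
  (\int[Pw]_om (\prod_(j <- r) phi j (om j))%:E = (m ^+ size r)%:E)%E.
Proof.
move=> + phi0 mphi phim; elim: r => [|j r IH] /=.
  move=> _; under eq_integral do rewrite big_nil.
  transitivity (1%:E * Pw setT)%E; first exact: integral_cst.
  by rewrite probability_setT mul1e expr0.
have mprod r' : measurable_fun setT (fun om : prodspace I Om => \prod_(i <- r') phi i (om i)).
  apply: measurable_prod => i _.
  exact: (measurableT_comp (mphi i) (@measurable_coord I d Om i)).
have prod0 r' (om : prodspace I Om) : 0 <= \prod_(i <- r') phi i (om i).
  exact: prodr_ge0.
have m0 : 0 <= m by rewrite -lee_fin -(phim j); apply: integral_ge0 => o _; rewrite lee_fin.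
move=> /andP[jr ur]; rewrite (resample_ge0 j); first last.
- by move=> om; rewrite lee_fin.
- exact/measurable_EFinP.
rewrite (eq_integral (fun om : prodspace I Om =>
    (m%:E * (\prod_(i <- r) phi i (om i))%:E)%E)).
  rewrite ge0_integralZl//; first by rewrite IH// -EFinM -exprS.
  - exact/measurable_EFinP.
  - by move=> om _; rewrite lee_fin.
move=> om _; rewrite (eq_integral (fun o =>
    ((\prod_(i <- r) phi i (om i))%:E * (phi j o)%:E)%E)).
  rewrite ge0_integralZl//; first by rewrite phim muleC.
  - exact/measurable_EFinP.
  - by move=> o _; rewrite lee_fin.
  - by rewrite lee_fin.
move=> o _; rewrite big_cons {1}/upd eqxx mulrC EFinM; congr (_%:E * _)%E.
rewrite big_seq [RHS]big_seq; apply: eq_bigr => i ir; rewrite /upd.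
by case: eqVneq => // ij; rewrite -ij ir in jr.
Qed.

End resampling.

Lemma measurable_funZ (R : realType) d (T : measurableType d) c (f : T -> R) :
  measurable_fun setT f -> measurable_fun setT (fun t => c * f t).
Proof. by move=> mf; apply: measurable_funM. Qed.

Lemma measurable_bigsum (R : realType) d (T : measurableType d) (I : Type)
    (r : seq I) (f : I -> T -> R) : (forall i, measurable_fun setT (f i)) ->
  measurable_fun setT (fun t => \sum_(i <- r) f i t).
Proof.
move=> mf; elim: r => [|i r IH].
  by under eq_fun do rewrite big_nil; exact: measurable_cst.
by under eq_fun do rewrite big_cons; exact: measurable_funD.
Qed.

Section square_integrable.
Variables (R : realType) (d : measure_display) (T : measurableType d).
Variable P : probability T R.
Implicit Types (f g : T -> R).

Definition intg f := P.-integrable setT (EFin \o f).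
Definition Ex f : R := (\int[P]_t f t)%R.
Definition L2 f := measurable_fun setT f /\ intg (fun t => f t ^+ 2).

Lemma eq_Ex f g : f =1 g -> Ex f = Ex g.
Proof. by move=> /funext ->. Qed.

Lemma intgE f : intg f -> (\int[P]_t (f t)%:E)%E = (Ex f)%:E.
Proof. by move=> fi; rewrite /Ex /Rintegral fineK// integrable_fin_num. Qed.

Lemma intg_le f g : measurable_fun setT f -> (forall t, `|f t| <= g t) -> intg g ->
  intg f.
Proof.
move=> mf fg; apply: le_integrable => //; first exact/measurable_EFinP.
by move=> t _; rewrite /= lee_fin (le_trans (fg t))// ler_norm.
Qed.

Lemma intgD f g : intg f -> intg g -> intg (fun t => f t + g t).
Proof. by move=> fi gi; exact: (integrableD measurableT fi gi). Qed.

Lemma intgZ c f : intg f -> intg (fun t => c * f t).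
Proof. by move=> fi; exact: (integrableZl measurableT c fi). Qed.

Lemma intg_cst c : intg (fun=> c).
Proof. exact: finite_measure_integrable_cst. Qed.

Lemma intg_sum (I : Type) (r : seq I) (F : I -> T -> R) :
  (forall i, intg (F i)) -> intg (fun t => \sum_(i <- r) F i t).
Proof.
move=> Fi; elim: r => [|i r IH].
  by under eq_fun do rewrite big_nil; exact: intg_cst.
by under eq_fun do rewrite big_cons; exact: intgD.
Qed.

Lemma ExD f g : intg f -> intg g -> Ex (fun t => f t + g t) = Ex f + Ex g.
Proof. by move=> fi gi; rewrite /Ex RintegralD. Qed.

Lemma ExZ c f : intg f -> Ex (fun t => c * f t) = c * Ex f.
Proof. by move=> fi; rewrite /Ex RintegralZl. Qed.

Lemma Ex_cst c : Ex (fun=> c) = c.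
Proof.
transitivity (c * fine (P setT)); first exact: Rintegral_cst.
by rewrite probability_setT mulr1.
Qed.

Lemma Ex_sum (I : Type) (r : seq I) (F : I -> T -> R) :
  (forall i, intg (F i)) -> Ex (fun t => \sum_(i <- r) F i t) = \sum_(i <- r) Ex (F i).
Proof.
move=> Fi; elim: r => [|i r IH].
  by under eq_fun do rewrite big_nil; rewrite Ex_cst big_nil.
under eq_fun do rewrite big_cons.
by rewrite ExD// ?IH ?big_cons//; exact: intg_sum.
Qed.

Lemma Ex_ge0 f : (forall t, 0 <= f t) -> 0 <= Ex f.
Proof. by move=> f0; apply: Rintegral_ge0. Qed.

Lemma Ex_le f g : intg f -> intg g -> (forall t, f t <= g t) -> Ex f <= Ex g.
Proof. by move=> fi gi fg; apply: le_Rintegral. Qed.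

Lemma L2M f g : L2 f -> L2 g -> intg (fun t => f t * g t).
Proof.
move=> [mf fi] [mg gi]; apply: intg_le (intgD fi gi); first exact: measurable_funM.
move=> t; apply: (@le_trans _ _ ((f t ^+ 2 + g t ^+ 2) / 2)).
  by apply: abs_le_mean; rewrite ?sqr_ge0// exprMn.
by rewrite ler_pdivrMr// ler_peMr ?addr_ge0 ?sqr_ge0// ler1n.
Qed.

Lemma L2_cst c : L2 (fun=> c).
Proof. by split; [exact: measurable_cst|exact: intg_cst]. Qed.

Lemma L2_intg f : L2 f -> intg f.
Proof.
move=> fL; have := L2M fL (L2_cst 1).
by under eq_fun do rewrite mulr1.
Qed.

Lemma L2D f g : L2 f -> L2 g -> L2 (fun t => f t + g t).
Proof.
move=> fL gL; split; first exact: measurable_funD fL.1 gL.1.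
rewrite (_ : (fun t => _) = (fun t => f t ^+ 2 + (2 * (f t * g t) + g t ^+ 2))).
  by apply: intgD fL.2 _; apply: intgD gL.2; apply/intgZ/L2M.
by apply/funext => t; ring.
Qed.

Lemma L2Z c f : L2 f -> L2 (fun t => c * f t).
Proof.
move=> [mf fi]; split; first exact: measurable_funZ.
by under eq_fun do rewrite exprMn; exact: intgZ.
Qed.

Lemma L2_sum (I : Type) (r : seq I) (F : I -> T -> R) :
  (forall i, L2 (F i)) -> L2 (fun t => \sum_(i <- r) F i t).
Proof.
move=> FL; elim: r => [|i r IH].
  by under eq_fun do rewrite big_nil; exact: L2_cst.
by under eq_fun do rewrite big_cons; exact: L2D.
Qed.

Lemma L2_dominated f g : measurable_fun setT f -> (forall t, f t ^+ 2 <= g t) ->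
  intg g -> L2 f.
Proof.
move=> mf fg gi; split=> //; apply: intg_le gi; first exact: measurable_funX.
by move=> t; rewrite ger0_norm ?sqr_ge0.
Qed.

Lemma sqr_Ex_le f : L2 f -> Ex f ^+ 2 <= Ex (fun t => f t ^+ 2).
Proof.
move=> fL; have fi := L2_intg fL; set e := Ex f.
have : 0 <= Ex (fun t => (f t + (- e)) ^+ 2) by apply: Ex_ge0 => t; exact: sqr_ge0.
rewrite (_ : (fun t => _) = (fun t => f t ^+ 2 + ((- 2 * e) * f t + e ^+ 2))); last first.
  by apply/funext => t; ring.
rewrite ExD; [|exact: fL.2|by apply: intgD (intg_cst _); exact: intgZ].
rewrite ExD; [|exact: intgZ|exact: intg_cst].
by rewrite ExZ// Ex_cst -/e; lra.
Qed.

Lemma pythagoras (I : eqType) (r : seq I) (F : I -> T -> R) : uniq r ->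
  (forall i, L2 (F i)) ->
  (forall i j, i \in r -> j \in r -> i != j -> Ex (fun t => F i t * F j t) = 0) ->
  Ex (fun t => (\sum_(i <- r) F i t) ^+ 2) = \sum_(i <- r) Ex (fun t => F i t ^+ 2).
Proof.
move=> ur FL; elim: r ur => [|i r IH] /=.
  by move=> _ _; under eq_fun do rewrite big_nil expr0n; rewrite big_nil Ex_cst.
move=> /andP[ir ur] orth; rewrite big_cons -IH//; last first.
  by move=> j l jr lr; apply: orth; rewrite inE ?jr ?lr orbT.
have SL : L2 (fun t => \sum_(j <- r) F j t) by exact: L2_sum.
rewrite (_ : (fun t => _) = (fun t => F i t ^+ 2 +
  (2 * (F i t * \sum_(j <- r) F j t) + (\sum_(j <- r) F j t) ^+ 2))); last first.
  by apply/funext => t; rewrite big_cons; ring.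
rewrite ExD; [|exact: (FL i).2|apply: intgD SL.2; exact/intgZ/L2M].
rewrite ExD; [|exact/intgZ/L2M|exact: SL.2].
rewrite ExZ; last exact: L2M.
rewrite (_ : Ex (fun t => F i t * _) = 0) ?mulr0 ?add0r//.
under eq_fun do rewrite mulr_sumr.
rewrite Ex_sum => [|j]; last exact: L2M.
rewrite big_seq big1// => j jr; apply: orth; rewrite ?inE ?eqxx ?jr ?orbT//.
by apply: contraNneq ir => ->.
Qed.

Lemma variance_centered f : L2 f -> Ex f = 0 -> 'V_P[f]%E = (Ex (fun t => f t ^+ 2))%:E.
Proof.
move=> fL f0; rewrite /variance covariance.unlock !expectation.unlock.
rewrite (intgE (L2_intg fL)) f0 -intgE; last exact: fL.2.
apply: eq_integral => t _; rewrite -[LHS]/(((f t - 0) * (f t - 0))%:E).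
by rewrite subr0 expr2.
Qed.

End square_integrable.

Section law_expectation.
Variables (R : realType) (d d' : measure_display).
Variables (T : measurableType d) (T' : measurableType d').
Variables (P : probability T R) (P' : probability T' R) (phi : T -> T').
Hypothesis phi_law : has_law P P' phi.

Lemma intg_law (f : T' -> R) : intg P' f -> intg P (f \o phi).
Proof. exact: (integrable_law phi_law). Qed.

Lemma Ex_law (f : T' -> R) : intg P' f -> Ex P (f \o phi) = Ex P' f.
Proof. by move=> fi; rewrite /Ex /Rintegral (integral_law phi_law fi). Qed.

Lemma L2_law (f : T' -> R) : L2 P' f -> L2 P (f \o phi).
Proof.
move=> [mf fi]; split; first exact: measurableT_comp mf phi_law.1.
exact: (intg_law fi).
Qed.

End law_expectation.

Section independent_pair.
Variables (R : realType) (d d1 d2 : measure_display).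
Variables (T : measurableType d) (T1 : measurableType d1) (T2 : measurableType d2).
Variables (P : probability T R) (P1 : probability T1 R) (P2 : probability T2 R).
Variables (phi : T -> T1) (psi : T -> T2).
Hypotheses (phi_law : has_law P P1 phi) (psi_law : has_law P P2 psi).
Hypothesis indep : forall A B, measurable A -> measurable B ->
  P (phi @^-1` A `&` psi @^-1` B) = (P1 A * P2 B)%E.

Lemma pair_law : has_law P (P1 \x P2)%E (fun t => (phi t, psi t)).
Proof.
have mpair : measurable_fun setT (fun t => (phi t, psi t)).
  by apply: measurable_fun_pair; [exact: phi_law.1|exact: psi_law.1].
split=> // A mA; pose X : {RV P >-> (T1 * T2)%type} := mfun_Sub (mem_set mpair).
apply/esym; exact: (@product_measure_unique _ _ _ _ _ P1 P2 (distribution P X)).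
Qed.

Lemma Ex_indep_centered (f : T1 -> R) (g : T2 -> R) :
  L2 P1 f -> L2 P2 g -> Ex P2 g = 0 -> Ex P (fun t => f (phi t) * g (psi t)) = 0.
Proof.
move=> fL gL g0; have fst_law : has_law (P1 \x P2)%E P1 fst.
  split; first exact: measurable_fst.
  move=> A mA; rewrite (_ : fst @^-1` A = A `*` setT); last first.
    by apply/seteqP; split=> -[x y] //= [].
  transitivity (P1 A * P2 setT)%E; first exact: product_measure1E.
  by rewrite probability_setT mule1.
have snd_law : has_law (P1 \x P2)%E P2 snd.
  split; first exact: measurable_snd.
  move=> A mA; rewrite (_ : snd @^-1` A = setT `*` A); last first.
    by apply/seteqP; split=> -[x y] //= [].
  transitivity (P1 setT * P2 A)%E; first exact: product_measure1E.
  by rewrite probability_setT mul1e.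
have fgi : intg (P1 \x P2)%E (fun z => f z.1 * g z.2).
  exact: L2M (L2_law fst_law fL) (L2_law snd_law gL).
rewrite -[LHS]/(Ex P ((fun z => f z.1 * g z.2) \o (fun t => (phi t, psi t)))).
rewrite (Ex_law pair_law fgi) /Ex /Rintegral -(integral12_prod_meas1 fgi).
rewrite integral0_eq// => x _; rewrite /fubini_F /=.
under eq_integral do rewrite EFinM.
by rewrite integralZl ?intgE ?g0 ?mule0//; exact: L2_intg.
Qed.

End independent_pair.

(** * Measurability and means of elements of a reproducing kernel Hilbert space *)

Section rkhs_mean.
Variables (R : realType) (E : Type) (A : set E) (L : E -> E -> R) (H : rkhs A L).
Variables (d : measure_display) (T : measurableType d) (P : probability T R).
Variables (phi : T -> E) (G : T -> R) (m : A -> R).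
Hypothesis msec : forall y : A, measurable_fun setT (fun t => ksec A L (val y) (phi t)).
Hypothesis Esec : forall y : A, Ex P (fun t => ksec A L (val y) (phi t)) = m y.
Hypothesis Gi : intg P G.
Hypothesis fG : forall f t, rkhs_carrier H f -> f (phi t) ^+ 2 <= sqn H f * G t.

Let cm (s : seq (R * A)) : measurable_fun setT (fun t => comb L s (phi t)).
Proof. by apply: measurable_bigsum => p; exact: measurable_funZ. Qed.

Variables (f : E -> R) (s : nat -> seq (R * A)).
Hypothesis Cf : rkhs_carrier H f.
Hypothesis sf : (fun n => sqn H (comb L (s n) \- f)) @ \oo --> (0 : R).

(** Norm convergence implies pointwise convergence, so [f] inherits measurability from the
    combinations of sections. *)
Lemma rkhs_measurable : measurable_fun setT (fun t => f (phi t)).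
Proof.
apply: (@measurable_fun_cvg _ _ _ _ (fun n t => comb L (s n) (phi t))) => //.
by move=> t _; exact: (cvg_eval (fun n => combC H (s n)) Cf sf).
Qed.

Let CL2 h : rkhs_carrier H h -> measurable_fun setT (fun t => h (phi t)) ->
  L2 P (fun t => h (phi t)).
Proof.
move=> Ch mh; apply: (@L2_dominated _ _ _ _ _ (fun t => sqn H h * G t)) => //.
  by move=> t; exact: fG.
exact: intgZ.
Qed.

Lemma rkhs_L2 : L2 P (fun t => f (phi t)).
Proof. by apply: CL2 => //; exact: rkhs_measurable. Qed.

(** [G] bounds the squared norms of the evaluations at [phi t], so the mean is a continuous
    functional with squared norm at most [Ex P G], determined by its values [m] on sections. It is
    applied with [m = 0] for averaging over one coordinate in [u] and with [m = 1] for integration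
    over the whole product. *)
Lemma rkhs_mean_cvg :
  (fun n => \sum_(p <- s n) p.1 * m p.2) @ \oo --> Ex P (fun t => f (phi t)).
Proof.
have seci (y : A) : intg P (fun t => ksec A L (val y) (phi t)).
  apply: L2_intg; apply: (@CL2 (ksec A L (val y))) => //.
  exact: (ksecC H (setvalP y)).
have EC r : Ex P (fun t => comb L r (phi t)) = \sum_(p <- r) p.1 * m p.2.
  rewrite Ex_sum => [|p]; last exact: intgZ.
  by apply: eq_bigr => p _; rewrite ExZ// Esec.
have Cd n : rkhs_carrier H (comb L (s n) \- f) by apply: carrierB => //; exact: combC.
have dL n : L2 P (fun t => (comb L (s n) \- f) (phi t)).
  by apply: CL2 => //; apply: measurable_funB => //; exact: rkhs_measurable.
have d0 : (fun n => Ex P (fun t => (comb L (s n) \- f) (phi t))) @ \oo --> (0 : R).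
  apply: (@cvg0_sqr_le _ _ _ (Ex P G) _ sf) => n.
  apply: le_trans (sqr_Ex_le (dL n)) _; rewrite mulrC -ExZ//.
  by apply: Ex_le; [exact: (dL n).2|exact: intgZ|move=> t; exact: fG].
have -> : (fun n => \sum_(p <- s n) p.1 * m p.2) = (fun n =>
    Ex P (fun t => (comb L (s n) \- f) (phi t)) + Ex P (fun t => f (phi t))).
  apply/funext => n; rewrite -EC -ExD; [|exact: L2_intg|exact/L2_intg/rkhs_L2].
  by congr Ex; apply/funext => t /=; rewrite subrK.
by rewrite -[X in _ --> X]add0r; apply: cvgD => //; exact: cvg_cst.
Qed.

End rkhs_mean.

Section kernel_measure.
Variables (R : realType) (d : measure_display) (D : measurableType d).
Variables (k : D -> D -> R) (rho : probability D R) (M : R).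
Hypothesis k_psd : psd k.
Hypothesis k_meas : measurable_fun setT (fun z : D * D => k z.1 z.2).
Hypothesis k_trace : (\int[rho]_x (k x x)%:E = M%:E)%E.
Hypothesis k_mean : forall y, (\int[rho]_x (k x y)%:E = 0)%E.

Local Notation E := (prodspace nat D).

Lemma measurable_k dT (T : measurableType dT) (f h : T -> D) :
  measurable_fun setT f -> measurable_fun setT h ->
  measurable_fun setT (fun t => k (f t) (h t)).
Proof.
move=> mf mh.
exact: (measurableT_comp k_meas (measurable_fun_pair mf mh)).
Qed.

Lemma intg_trace : intg rho (fun x => k x x).
Proof.
apply/integrableP; split; first exact/measurable_EFinP/measurable_k.
rewrite (eq_integral (fun x => (k x x)%:E)) ?k_trace ?ltry// => x _.
by rewrite /= ger0_norm// (psd_diag _ k_psd).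
Qed.

Lemma Ex_trace : Ex rho (fun x => k x x) = M.
Proof. by rewrite /Ex /Rintegral k_trace. Qed.

Lemma Ex_k_mean y : Ex rho (fun x => k x y) = 0.
Proof. by rewrite /Ex /Rintegral k_mean. Qed.

Lemma intg_k y : intg rho (fun x => k x y).
Proof.
apply: (intg_le (g := fun x => k x x + k y y)).
- by apply: measurable_k => //; exact: measurable_cst.
- move=> x; apply: (@le_trans _ _ ((k x x + k y y) / 2)).
    by apply: abs_le_mean; rewrite ?(psd_diag _ k_psd)//; exact: psd_CS2.
  by rewrite ler_pdivrMr// ler_peMr ?addr_ge0 ?(psd_diag _ k_psd)// ler1n.
- exact: intgD intg_trace (intg_cst _ _).
Qed.

Lemma measurable_ker_u dT (T : measurableType dT) (f h : T -> E) u :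
  measurable_fun setT f -> measurable_fun setT h ->
  measurable_fun setT (fun t => ker_u k u (f t) (h t)).
Proof.
move=> mf mh; apply: measurable_prod => j _.
by apply: measurable_k; exact: (measurableT_comp (@measurable_coord _ _ D j)).
Qed.

Lemma measurable_upd1 (I : choiceType) dO (Om : measurableType dO) (j : I)
    (om : prodspace I Om) : measurable_fun setT (fun o : Om => upd j o om).
Proof.
apply: measurable_to_prodspace => i; rewrite /upd.
by case: eqVneq => _; [exact: measurable_id|exact: measurable_cst].
Qed.

Lemma ker_u_upd (u : {fset nat}) j y (x z : E) : j \in u ->
  ker_u k u (upd j y x) z = k y (z j) * \prod_(i <- (u `\ j)%fset) k (x i) (z i).
Proof.
move=> ju; rewrite /ker_u (big_fsetD1 j)//= {1}/upd eqxx; congr (_ * _).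
rewrite big_seq [RHS]big_seq; apply: eq_bigr => i.
by rewrite !inE /upd => /andP[/negbTE ->].
Qed.

Variable Hu : forall u : {fset nat}, rkhs [set: E] (ker_u k u).
Variables (u : {fset nat}) (h : E -> R).
Hypothesis Ch : rkhs_carrier (Hu u) h.

Lemma Hu_measurable : measurable_fun setT h.
Proof.
have [s sh] := comb_dense Ch.
apply: (rkhs_measurable (phi := fun x : E => x) _ Ch sh) => y.
have -> : (fun x : E => ksec [set: E] (ker_u k u) (val y) x) = (fun x => ker_u k u x (val y)).
  by apply/funext => x; rewrite ksecE.
by apply: measurable_ker_u => //; exact: measurable_cst.
Qed.

(** The sections of [ker_u k u] at [x] and [x'] coincide, and [h] is evaluated by pairing with
    them. *)
Lemma Hu_eq x x' : (forall j, j \in u -> x j = x' j) -> h x = h x'.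
Proof.
move=> xx'; rewrite -(ip_ksec Ch (x := x) I) -(ip_ksec Ch (x := x') I).
congr (rkhs_inner _ _ _); apply/funext => y; rewrite !ksecE//.
rewrite [LHS](ker_u_psd k_psd u).1 [RHS](ker_u_psd k_psd u).1.
exact: eq_ker_u.
Qed.

Let upd_hyps j x (ju : j \in u) :
  [/\ forall y : [set: E], measurable_fun setT (fun t => ksec [set: E] (ker_u k u) (val y) (upd j t x)),
      forall y : [set: E], Ex rho (fun t => ksec [set: E] (ker_u k u) (val y) (upd j t x)) = 0,
      intg rho (fun t => ker_u k u (upd j t x) (upd j t x)) &
      forall f t, rkhs_carrier (Hu u) f ->
        f (upd j t x) ^+ 2 <= sqn (Hu u) f * ker_u k u (upd j t x) (upd j t x)].
Proof.
have mu := measurable_upd1 j x.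
split.
- move=> y; under eq_fun do rewrite ksecE//.
  by apply: measurable_ker_u => //; exact: measurable_cst.
- move=> y; under eq_fun do rewrite ksecE// ker_u_upd// mulrC.
  by rewrite ExZ ?Ex_k_mean ?mulr0//; exact: intg_k.
- under eq_fun do rewrite ker_u_upd// {1}/upd eqxx mulrC.
  rewrite (_ : (fun x0 => _) = fun t => \prod_(i <- (u `\ j)%fset) k (x i) (x i) * k t t).
    exact/intgZ/intg_trace.
  apply/funext => t; congr (_ * _); rewrite big_seq [RHS]big_seq; apply: eq_bigr => i.
  by rewrite !inE /upd => /andP[/negbTE ->].
- by move=> f t Cf; rewrite mulrC; exact: sqr_eval_le.
Qed.

Lemma Hu_L2_upd j x : j \in u -> L2 rho (fun y => h (upd j y x)).
Proof.
move=> ju; have [H1 H2 H3 H4] := upd_hyps x ju; have [s sh] := comb_dense Ch.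
exact: (rkhs_L2 (phi := fun t => upd j t x) H1 H3 H4 Ch sh).
Qed.

Lemma Hu_mean_upd j x : j \in u -> Ex rho (fun y => h (upd j y x)) = 0.
Proof.
move=> ju; have [H1 H2 H3 H4] := upd_hyps x ju; have [s sh] := comb_dense Ch.
have := rkhs_mean_cvg (phi := fun t => upd j t x) (m := fun=> 0) H1 H2 H3 H4 Ch sh.
rewrite (_ : (fun n => _) = fun=> 0); last first.
  by apply/funext => n; rewrite big1// => p _; rewrite mulr0.
move=> c0; apply: (cvg_unique _ c0); first exact: Rhausdorff.
exact: cvg_cst.
Qed.

End kernel_measure.

(** * Variance of the multilevel algorithm *)

Section nodes.
Variables (R : realType) (d : measure_display) (D : measurableType d).
Variables (k : D -> D -> R) (rho : probability D R) (M : R) (a : D).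
Hypothesis k_psd : psd k.
Hypothesis k_meas : measurable_fun setT (fun z : D * D => k z.1 z.2).
Hypothesis k_trace : (\int[rho]_x (k x x)%:E = M%:E)%E.
Hypothesis k_mean : forall y, (\int[rho]_x (k x y)%:E = 0)%E.
Variable Hu : forall u : {fset nat}, rkhs [set: prodspace nat D] (ker_u k u).

Variables (dO : measure_display) (Om : measurableType dO) (P : probability Om R).
Variables (v : {fset nat}) (Pw : probability (prodspace v Om) R).
Hypothesis Pw_prod : is_product_measure P Pw.

Lemma coord_law (j : v) : has_law Pw P (fun om : prodspace v Om => om j).
Proof.
split=> [|B mB]; first exact: measurable_coord.
have := Pw_prod [fset j]%fset (fun=> mB).
rewrite big_seq_fset1 => <-; congr (Pw _); apply/seteqP; split=> om /=.
  by move=> h i; rewrite inE => /eqP ->.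
by apply; rewrite inE.
Qed.

Definition good_node (t : prodspace v Om -> prodspace v D) :=
  measurable_fun setT t /\ forall j : v,
    (forall om om' : prodspace v Om, om j = om' j -> t om j = t om' j) /\
    (forall B : set D, measurable B -> Pw [set om | B (t om j)] = rho B).

Definition node_pt (t : prodspace v Om -> prodspace v D) (om : prodspace v Om) :
  prodspace nat D := splice_fin (t om) (anchor a).

Variable t : prodspace v Om -> prodspace v D.
Hypothesis t_good : good_node t.

Lemma node_ptE om (j : v) : node_pt t om (val j) = t om j.
Proof. by rewrite /node_pt /splice_fin insubT //= => ?; congr (t _ _); exact: val_inj. Qed.

Lemma node_pt_out om j : j \notin v -> node_pt t om j = a.
Proof. by move=> jv; rewrite /node_pt /splice_fin insubN. Qed.

Lemma measurable_node_pt : measurable_fun setT (node_pt t).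
Proof.
apply: measurable_to_prodspace => j; have [jv|jv] := boolP (j \in v).
  have -> : (fun om => node_pt t om j) = (fun om => t om [` jv]%fset).
    by apply/funext => om; rewrite -node_ptE.
  exact: (measurableT_comp (@measurable_coord _ _ D _) t_good.1).
have -> : (fun om => node_pt t om j) = fun=> a.
  by apply/funext => om; rewrite node_pt_out.
exact: measurable_cst.
Qed.

(** By the first half of [condition_star], resampling the randomness of index [j] alters the node in
    its coordinate [j] only. *)
Lemma node_pt_upd (j : v) o om i :
  node_pt t (upd j o om) i = upd (val j) (t (upd j o om) j) (node_pt t om) i.
Proof.
rewrite /upd; have [->|ij] := eqVneq i (val j); first by rewrite node_ptE.
have [iv|iv] := boolP (i \in v); last by rewrite !node_pt_out.
have {1 2}-> : i = val [` iv]%fset by [].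
rewrite !node_ptE; apply: (t_good.2 _).1; case: eqVneq => // e.
by rewrite -e eqxx in ij.
Qed.

(** The other entries of [om] may be frozen, since coordinate [j] of the node does not see them. *)
Lemma node_upd_law (j : v) om : has_law P rho (fun o => t (upd j o om) j).
Proof.
have mt : measurable_fun setT (fun o => t (upd j o om) j).
  exact: (measurableT_comp (@measurable_coord v d D j)
    (measurableT_comp t_good.1 (measurable_upd1 j om))).
split=> // B mB; rewrite -((t_good.2 j).2 _ mB).
have mB' : measurable ((fun o => t (upd j o om) j) @^-1` B).
  by rewrite -[X in measurable X]setTI; exact: mt.
rewrite -((coord_law j).2 _ mB'); congr (Pw _); apply/seteqP.
have e om' : t (upd j (om' j) om) j = t om' j.
  by apply: (t_good.2 j).1; rewrite /upd eqxx.
by split=> om' /=; rewrite e.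
Qed.

Variable u : {fset nat}.

(** The coordinates of a node are functions [tau j] of separate independent variables, each with law
    [rho], so the diagonal of the product kernel has a product expectation. The reference point
    [om0] only fills the arguments that [tau j] ignores. *)
Lemma node_trace : {subset u <= v} ->
  (\int[Pw]_om (ker_u k u (node_pt t om) (node_pt t om))%:E = (M ^+ #|` u|)%:E)%E.
Proof.
move=> uv; pose om0 : prodspace v Om := fun=> point.
pose tau (j : v) (o : Om) := t (upd j o om0) j.
have tauE om j : tau j (om j) = t om j.
  by apply: (t_good.2 j).1; rewrite /upd eqxx.
have law j : has_law P rho (tau j) by exact: node_upd_law.
pose r : seq v := pmap insub u.
have rE : map val r = u.
  rewrite pmap_filter; last by move=> j; exact: insubK.
  by apply/all_filterP/allP => j ju; rewrite insubT//; exact: uv.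
rewrite (eq_integral (fun om : prodspace v Om =>
    (\prod_(j <- r) k (tau j (om j)) (tau j (om j)))%:E)); last first.
  move=> om _; rewrite /ker_u -rE big_map; congr EFin; apply: eq_bigr => j _.
  by rewrite node_ptE tauE.
rewrite (integral_prod_coord Pw_prod (phi := fun j o => k (tau j o) (tau j o)) (m := M)).
- by rewrite -(size_map val) rE.
- by rewrite -(map_inj_uniq val_inj) rE fset_uniq.
- by move=> j o; exact: psd_diag.
- by move=> j; apply: measurable_k => //; exact: (law j).1.
move=> j; have it := intg_trace k_psd k_meas k_trace.
by rewrite (intgE (intg_law (law j) it)) (Ex_law (law j) it) (Ex_trace k_trace).
Qed.

Variable h : prodspace nat D -> R.
Hypothesis Ch : rkhs_carrier (Hu u) h.
Hypothesis uv : {subset u <= v}.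

Lemma node_L2 : L2 Pw (fun om => h (node_pt t om)).
Proof.
apply: (L2_dominated (g := fun om => sqn (Hu u) h * ker_u k u (node_pt t om) (node_pt t om))).
- exact: (measurableT_comp (Hu_measurable k_meas Ch) measurable_node_pt).
- by move=> om; rewrite mulrC; exact: sqr_eval_le.
apply: intgZ; apply/integrableP; split.
  by apply/measurable_EFinP; apply: measurable_ker_u => //; exact: measurable_node_pt.
rewrite (eq_integral (fun om => (ker_u k u (node_pt t om) (node_pt t om))%:E)).
  by rewrite node_trace// ltry.
by move=> om _; rewrite /= ger0_norm//; apply: psd_diag; exact: ker_u_psd.
Qed.

(* The coordinate j is averaged first: psi is constant in it and the
   corresponding section of h has mean zero. *)
Lemma node_orthogonal (j : nat) (psi : prodspace v Om -> R) (ju : j \in u) :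
  L2 Pw psi ->
  (forall o om, psi (upd [` uv ju]%fset o om) = psi om) ->
  Ex Pw (fun om => h (node_pt t om) * psi om) = 0.
Proof.
move=> psiL psiE; rewrite /Ex /Rintegral.
rewrite (resample_eq0 Pw_prod (j := [` uv ju]%fset))//; first exact: L2M node_L2 psiL.
move=> om; rewrite (eq_integral (fun o =>
  (psi om * h (upd j (t (upd [` uv ju]%fset o om) [` uv ju]%fset) (node_pt t om)))%:E)).
  have law := node_upd_law [` uv ju]%fset om.
  have hL : L2 rho (fun y => h (upd j y (node_pt t om))).
    exact: (Hu_L2_upd k_psd k_meas k_trace k_mean Ch _ ju).
  rewrite intgE; last first.
    by apply: intgZ; exact: (intg_law law (L2_intg hL)).
  rewrite ExZ; last exact: (intg_law law (L2_intg hL)).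
  rewrite (Ex_law law (L2_intg hL)).
  by rewrite (Hu_mean_upd k_psd k_meas k_trace k_mean Ch _ ju) mulr0.
move=> o _; rewrite /= psiE mulrC; congr (_ * _)%:E.
by apply: (Hu_eq k_psd Ch) => i _; rewrite node_pt_upd.
Qed.

End nodes.

(** * Integration of elements of H(K) against the product measure *)

Section integral_functional.
Variables (R : realType) (d : measure_display) (D : measurableType d).
Variables (k : D -> D -> R) (g : nat -> R) (a : D) (rho : probability D R) (M : R).
Hypothesis k_psd : psd k.
Hypothesis g_gt0 : forall j, 0 < g j.
Hypothesis k_meas : measurable_fun setT (fun z : D * D => k z.1 z.2).
Hypothesis k_trace : (\int[rho]_x (k x x)%:E = M%:E)%E.
Hypothesis k_mean : forall y, (\int[rho]_x (k x y)%:E = 0)%E.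
Hypothesis gM : (\esum_(u in [set: {fset nat}])
            (prod_weight g u * M ^+ #|` u|)%:E < +oo)%E.

Local Notation E := (prodspace nat D).
Local Notation FX := (frakX k (prod_weight g)).
Local Notation K := (ker_K k (prod_weight g)).

Variable mu : probability E R.
Hypothesis mu_prod : is_product_measure rho mu.

Let Kn n (x y : E) := \sum_(u <- subsets n) prod_weight g u * ker_u k u x y.

Let KnE n x y : Kn n x y = \prod_(0 <= j < n) (1 + factor k g j x y).
Proof. by rewrite prod1D_subsets; apply: eq_bigr => u _; rewrite factorE. Qed.

Let Kn_psd n : psd (Kn n).
Proof.
apply: eq_psd (psd_prod1D (index_iota 0 n) (factor_psd k_psd g_gt0)) => x y.
by rewrite KnE.
Qed.

Let Kn_meas n dT (T : measurableType dT) (f h : T -> E) :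
  measurable_fun setT f -> measurable_fun setT h ->
  measurable_fun setT (fun t => Kn n (f t) (h t)).
Proof.
move=> mf mh; apply: measurable_bigsum => u; apply: measurable_funZ.
exact: measurable_ker_u.
Qed.

Let Kn_homo x : {homo (fun n => Kn n x x) : m n / (m <= n)%N >-> m <= n}.
Proof.
move=> m n mn; rewrite !KnE [leRHS](@big_cat_nat _ _ _ m)//= ler_peMr//.
  by apply: prodr_ge0 => j _; rewrite addr_ge0 ?(factor_diag_ge0 k_psd g_gt0).
apply: (big_ind (fun z : R => 1 <= z)) => //; first exact: mulr_ege1.
by move=> j _; rewrite lerDl (factor_diag_ge0 k_psd g_gt0).
Qed.

Let Kn_cvg x y : FX x -> FX y -> (fun n => Kn n x y) @ \oo --> K x y.
Proof.
move=> Xx Xy; under eq_fun do rewrite KnE.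
exact: cvg_factor_K.
Qed.

Lemma ker_u_trace u : (\int[mu]_x (ker_u k u x x)%:E = (M ^+ #|` u|)%:E)%E.
Proof.
have mk : measurable_fun setT (fun x => k x x) by exact: measurable_k.
rewrite (integral_prod_coord mu_prod (phi := fun _ x => k x x) (m := M))//.
by move=> j x; exact: psd_diag.
Qed.

Let ker_u_diag_intg u : intg mu (fun x => ker_u k u x x).
Proof.
apply/integrableP; split; first exact/measurable_EFinP/measurable_ker_u.
rewrite (eq_integral (fun x => (ker_u k u x x)%:E)) ?ker_u_trace ?ltry// => x _.
by rewrite /= ger0_norm//; apply: psd_diag; exact: ker_u_psd.
Qed.

Let ker_u_intg u y : intg mu (fun x => ker_u k u x y).
Proof.
have ku := ker_u_psd k_psd u.
apply: (intg_le (g := fun x => ker_u k u x x + ker_u k u y y)).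
- by apply: measurable_ker_u => //; exact: measurable_cst.
- move=> x; apply: (@le_trans _ _ ((ker_u k u x x + ker_u k u y y) / 2)).
    by apply: abs_le_mean; rewrite ?(psd_diag _ ku)//; exact: psd_CS2.
  by rewrite ler_pdivrMr// ler_peMr ?addr_ge0 ?(psd_diag _ ku)// ler1n.
- by apply: intgD; [exact: ker_u_diag_intg|exact: intg_cst].
Qed.

Let ker_u_mean u y : u != fset0 -> Ex mu (fun x => ker_u k u x y) = 0.
Proof.
move=> /fset0Pn[j ju]; rewrite /Ex /Rintegral (resample_eq0 mu_prod (j := j))//.
  exact: ker_u_intg.
move=> x; rewrite (eq_integral (fun o =>
    (\prod_(i <- (u `\ j)%fset) k (x i) (y i) * k o (y j))%:E)).
  by rewrite intgE ?ExZ ?(Ex_k_mean k_mean) ?mulr0//; [|apply: intgZ]; exact: (intg_k k_psd k_meas k_trace).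
by move=> o _; rewrite /= ker_u_upd// mulrC.
Qed.

Let Kn_mean n y : Ex mu (fun x => Kn n x y) = 1.
Proof.
rewrite Ex_sum => [|u]; last exact: intgZ.
rewrite (big_rem fset0) ?fset0_subsets//= big_seq big1 ?addr0.
  rewrite ExZ// prod_weight0 mul1r.
  by under eq_fun do rewrite ker_u0; rewrite Ex_cst.
move=> u; rewrite mem_rem_uniq ?subsets_uniq// inE => /andP[u0 _].
by rewrite ExZ// ker_u_mean// mulr0.
Qed.

Let C := fine (\esum_(u in [set: {fset nat}]) (prod_weight g u * M ^+ #|` u|)%:E).

Let M_ge0 : 0 <= M.
Proof.
by rewrite -(Ex_trace k_trace); apply: Ex_ge0 => x; exact: psd_diag.
Qed.

Let Kn_trace n : (\int[mu]_x (Kn n x x)%:E <= C%:E)%E.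
Proof.
have w0 u : 0 <= prod_weight g u * M ^+ #|` u|.
  by rewrite mulr_ge0 ?exprn_ge0// prod_weight_ge0.
have -> : C%:E = \esum_(u in [set: {fset nat}]) (prod_weight g u * M ^+ #|` u|)%:E.
  by rewrite fineK// ge0_fin_numE// esum_ge0// => u _; rewrite lee_fin.
apply: le_trans (subsets_sum_le_esum n w0).
rewrite intgE; last by apply: intg_sum => u; exact: intgZ.
rewrite lee_fin Ex_sum => [|u]; last exact: intgZ.
apply: ler_sum => u _; rewrite ExZ// /Ex /Rintegral ker_u_trace.
exact: lexx.
Qed.

(** The diagonal of [K] as an increasing extended-real limit defined on the whole product. It is
    finite exactly on [frakX], and its integral is at most [C]; from this [frakX] is measurable and
    has full measure. *)
Let Ksup (x : E) := limn (fun n => (Kn n x x)%:E).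

Let Kn0 n x : (0 <= (Kn n x x)%:E)%E.
Proof. by rewrite lee_fin psd_diag. Qed.

Let Kn_ehomo x : {homo (fun n => (Kn n x x)%:E) : m n / (m <= n)%N >-> (m <= n)%E}.
Proof. by move=> m n mn; rewrite lee_fin; exact: Kn_homo. Qed.

Let Kn_emeas n : measurable_fun setT (fun x => (Kn n x x)%:E).
Proof. exact/measurable_EFinP/Kn_meas. Qed.

Let Ksup_meas : measurable_fun setT Ksup.
Proof.
apply: (@emeasurable_fun_cvg _ _ _ _ (fun n x => (Kn n x x)%:E)) => // x _.
by apply: ereal_nondecreasing_is_cvgn; exact: Kn_ehomo.
Qed.

Let Ksup0 x : (0 <= Ksup x)%E.
Proof.
apply: lime_ge; first by apply: ereal_nondecreasing_is_cvgn; exact: Kn_ehomo.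
exact: nearW.
Qed.

Let Ksup_int : (\int[mu]_x Ksup x <= C%:E)%E.
Proof.
rewrite monotone_convergence//.
apply: lime_le; last by apply: nearW => n; exact: Kn_trace.
apply: ereal_nondecreasing_is_cvgn => m n mn.
apply: ge0_le_integral => //.
by move=> x _; exact: Kn_ehomo.
Qed.

Let Kn_le_Ksup n x : ((Kn n x x)%:E <= Ksup x)%E.
Proof.
apply: lime_ge; first by apply: ereal_nondecreasing_is_cvgn; exact: Kn_ehomo.
by near=> m; apply: Kn_ehomo; near: m; exact: nbhs_infty_ge.
Unshelve. all: by end_near.
Qed.

Let frakX_Ksup x : FX x <-> (Ksup x < +oo)%E.
Proof.
split=> [Xx|Kx].
  rewrite /Ksup (_ : limn _ = (K x x)%:E) ?ltry//; apply: cvg_lim => //.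
  by apply: cvg_EFin; [exact: nearW|exact: Kn_cvg].
apply/(frakX_bounded k_psd g_gt0); exists (fine (Ksup x)) => n; rewrite -KnE.
rewrite -lee_fin fineK; first exact: Kn_le_Ksup.
by rewrite ge0_fin_numE.
Qed.

Lemma measurable_frakX : measurable FX.
Proof.
rewrite (_ : FX = Ksup @^-1` [set y | (y < +oo)%E]); last first.
  by apply/seteqP; split=> x /frakX_Ksup.
rewrite -[X in measurable X]setTI; apply: Ksup_meas => //.
rewrite (_ : [set y | _] = ~` [set +oo%E]); first exact/measurableC/emeasurable_set1.
by apply/seteqP; split=> y /=; rewrite ltey => /eqP.
Qed.

Lemma frakX_ae : {ae mu, forall x, FX x}.
Proof.
have Ki : mu.-integrable setT Ksup.
  apply/integrableP; split=> //.
  rewrite (eq_integral Ksup); first exact: le_lt_trans Ksup_int (ltry _).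
  by move=> x _; rewrite gee0_abs.
have := integrable_ae measurableT Ki; apply: filterS => x /(_ I) xfin.
by apply/frakX_Ksup; rewrite ltey_eq xfin.
Qed.

Let G (x : E) := patch (fun=> 0) FX (fun x => K x x) x.

Let G_Ksup x : FX x -> Ksup x = (G x)%:E.
Proof.
move=> Xx; rewrite /G patchE mem_set//; apply: cvg_lim => //.
by apply: cvg_EFin; [exact: nearW|exact: Kn_cvg].
Qed.

Let G_ge0 x : 0 <= G x.
Proof.
have [Xx|nXx] := pselect (FX x); last by rewrite /G patchE memNset.
by rewrite -lee_fin -G_Ksup.
Qed.

Let patch_meas (f : E -> R) (fn : nat -> E -> R) :
  (forall n, measurable_fun setT (fn n)) -> (forall x, FX x -> fn ^~ x @ \oo --> f x) ->
  measurable_fun setT (patch (fun=> 0) FX f).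
Proof.
move=> mfn ff; apply: (@measurable_fun_cvg _ _ _ _
  (fun n x => \1_FX x * fn n x)) => [n|x _].
  by apply: measurable_funM => //; exact: measurable_indic measurable_frakX.
rewrite patchE; have [Xx|nXx] := pselect (FX x).
  by rewrite mem_set// indicE mem_set//; under eq_fun do rewrite mul1r; exact: ff.
rewrite memNset// indicE memNset//; under eq_fun do rewrite mul0r; exact: cvg_cst.
Qed.

Let G_intg : intg mu G.
Proof.
apply/integrableP; split.
  apply/measurable_EFinP; apply: (@patch_meas _ (fun n x => Kn n x x)) => [n|x Xx].
    exact: Kn_meas.
  exact: Kn_cvg.
apply: le_lt_trans (ltry C); apply: le_trans Ksup_int.
have mG : measurable_fun setT (fun x => (G x)%:E).
  apply/measurable_EFinP; apply: (@patch_meas _ (fun n x => Kn n x x)) => [n|x Xx].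
    exact: Kn_meas.
  exact: Kn_cvg.
apply: ge0_le_integral => //.
  by apply: measurableT_comp mG.
move=> x _; rewrite /= ger0_norm//; have [Xx|nXx] := pselect (FX x).
  by rewrite -G_Ksup.
by rewrite /G patchE memNset.
Qed.

Let sec_meas (y : FX) : measurable_fun setT (fun x => ksec FX K (val y) x).
Proof.
apply: (@patch_meas _ (fun n x => Kn n x (val y))) => [n|x Xx].
  by apply: Kn_meas => //; exact: measurable_cst.
by apply: Kn_cvg => //; exact: setvalP.
Qed.

(** In each truncation only the empty set has a nonzero mean, so all truncations have mean 1. The
    limit is taken by dominated convergence with a majorant [h] that Cauchy-Schwarz provides from
    the diagonals at [x] and [y]. *)
Let sec_mean (y : FX) : Ex mu (fun x => ksec FX K (val y) x) = 1.
Proof.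
pose h x := G x + K (val y) (val y).
have hi : intg mu h by apply: intgD G_intg _; exact: intg_cst.
have Kny n : Kn n (val y) (val y) <= K (val y) (val y).
  have Xy := setvalP y; rewrite -lee_fin.
  have := Kn_le_Ksup n (val y); rewrite G_Ksup// /G patchE mem_set//.
have [||||seci _ lim] := @dominated_convergence _ _ _ mu setT measurableT
  (fun n x => (Kn n x (val y))%:E) (fun x => (ksec FX K (val y) x)%:E)
  (fun x => (h x)%:E) _ _ _ hi _.
- by move=> n; apply/measurable_EFinP/Kn_meas => //; exact: measurable_cst.
- by apply/measurable_EFinP; exact: sec_meas.
- apply: filterS frakX_ae => x Xx _; rewrite ksecE//.
  by apply: cvg_EFin; [exact: nearW|apply: Kn_cvg => //; exact: setvalP].
- apply: filterS frakX_ae => x Xx n _; rewrite /= lee_fin.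
  have Knx : Kn n x x <= G x by rewrite -lee_fin -G_Ksup.
  apply: (@le_trans _ _ ((Kn n x x + Kn n (val y) (val y)) / 2)).
    by apply: abs_le_mean; rewrite ?psd_diag//; exact: psd_CS2.
  have := Kny n; have : 0 <= Kn n (val y) (val y) by exact: psd_diag.
  by have : 0 <= Kn n x x by [exact: psd_diag]; rewrite /h; lra.
have {}seci : intg mu (fun x => ksec FX K (val y) x) by exact: seci.
apply: EFin_inj; rewrite -intgE//; apply: (cvg_unique _ lim); first exact: ereal_hausdorff.
rewrite (_ : [sequence _]_n = fun=> 1%:E); first exact: cvg_cst.
apply/funext => n; rewrite /= intgE ?Kn_mean//.
by apply: intg_sum => u; exact: intgZ.
Qed.

Variable HK : rkhs FX K.
Variables (f : E -> R) (s : nat -> seq (R * FX)).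
Hypothesis Cf : rkhs_carrier HK f.
Hypothesis sf : (fun n => sqn HK (comb K (s n) \- f)) @ \oo --> (0 : R).

(** Every section of [K] has integral 1, so a combination integrates to the sum of its
    coefficients. *)
Lemma integral_cvg :
  (fun n => \sum_(p <- s n) p.1) @ \oo --> (\int[mu]_(x in FX) f x)%R.
Proof.
have -> : (\int[mu]_(x in FX) f x)%R = Ex mu f.
  rewrite Rintegral_mkcond; congr Rintegral; apply/funext => x; rewrite patchE.
  by case: ifPn => //; rewrite notin_setE => /(rkhs_supp Cf).
have fG h x : rkhs_carrier HK h -> h x ^+ 2 <= sqn HK h * G x.
  move=> Ch; rewrite /G patchE; case: ifPn => [/set_mem Xx|].
    by rewrite mulrC; exact: sqr_eval_le.
  by rewrite notin_setE => /(rkhs_supp Ch) ->; rewrite expr0n mulr0.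
have := rkhs_mean_cvg (phi := fun x : E => x) sec_meas sec_mean G_intg fG Cf sf.
by under eq_fun do under eq_bigr do rewrite mulr1.
Qed.

End integral_functional.

(** * Variance of a single level *)

Section level_variance.
Variables (R : realType) (d : measure_display) (D : measurableType d).
Variables (k : D -> D -> R) (g : nat -> R) (a : D) (rho : probability D R) (M : R).
Hypothesis k_psd : psd k.
Hypothesis g_gt0 : forall j, 0 < g j.
Hypothesis k_meas : measurable_fun setT (fun z : D * D => k z.1 z.2).
Hypothesis k_trace : (\int[rho]_x (k x x)%:E = M%:E)%E.
Hypothesis k_mean : forall y, (\int[rho]_x (k x y)%:E = 0)%E.

Local Notation E := (prodspace nat D).
Local Notation FX := (frakX k (prod_weight g)).
Local Notation K := (ker_K k (prod_weight g)).
Local Notation A l y := (tail_sec k g a l y).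

Hypothesis X_anchor : FX (anchor a).
Variable Hu : forall u : {fset nat}, rkhs [set: E] (ker_u k u).
Variable HK : rkhs FX K.

Variables (dO : measure_display) (Om : measurableType dO) (P : probability Om R).
Variables (v : {fset nat}) (Pw : probability (prodspace v Om) R).
Hypothesis Pw_prod : is_product_measure P Pw.
Variables (n : nat) (q : rule R Om D v n).
Hypothesis q_good : forall i, good_node rho Pw (node q i).
Hypothesis q_weight : \sum_(i < n) weight q i = 1.

Variables (first : bool) (lo hi : nat).
Hypothesis lohi : (lo <= hi)%N.
Hypothesis v_hi : forall j, (j \in v) = (j < hi)%N.

Variables (C : {fset nat} -> R) (B1 B2 r : R).
Hypotheses (r0 : 0 <= r) (B10 : 0 <= B1) (B20 : 0 <= B2).
Hypothesis q_var : forall u h, u \in subsets hi -> u != fset0 ->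
  rkhs_carrier (Hu u) h ->
  ('V_Pw[rule_eval q (anchor a) h] <= (C u * r * sqn (Hu u) h)%:E)%E.
Hypothesis C_high : forall u, u \in subsets hi -> u \notin low_sets first lo ->
  u != fset0 -> C u * prod_weight g u <= B1.
Hypothesis C_low : forall u, u \in subsets hi -> u \in low_sets first lo ->
  u != fset0 -> C u * prod_weight g u <= B2.

Lemma subsets_sub u : u \in subsets hi -> {subset u <= v}.
Proof. by move=> /mem_subsetsP h j /h; rewrite v_hi. Qed.

Section components.
Variable h : {fset nat} -> E -> R.
Hypothesis Ch : forall u, u \in subsets hi -> rkhs_carrier (Hu u) (h u).

Let X u := if u \in subsets hi then rule_eval q (anchor a) (h u) else fun=> 0.

Let hL u i : u \in subsets hi -> L2 Pw (fun om => h u (node_pt a (node q i) om)).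
Proof.
move=> uh; exact: (node_L2 a k_psd k_meas k_trace Pw_prod (q_good i) (Ch uh) (subsets_sub uh)).
Qed.

Let XL u : L2 Pw (X u).
Proof.
rewrite /X; case: ifPn => uh; last exact: L2_cst.
rewrite /rule_eval; apply: (L2_sum _ (F := fun i om =>
  weight q i * h u (splice_fin (node q i om) (anchor a)))) => i.
by apply: L2Z; exact: hL.
Qed.

(** Averaging over a coordinate [j] in [u] on which [psi] does not depend. With [psi = 1] it gives
    mean zero, with [psi] another component it gives orthogonality. *)
Let Xorth u j psi : u \in subsets hi -> forall ju : j \in u, L2 Pw psi ->
  (forall jv : j \in v, forall o om, psi (upd [` jv]%fset o om) = psi om) ->
  Ex Pw (fun om => X u om * psi om) = 0.
Proof.
move=> uh ju psiL psiE; rewrite /X uh /rule_eval.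
have hpsi i : intg Pw (fun om => h u (node_pt a (node q i) om) * psi om).
  by apply: L2M => //; exact: hL.
rewrite (@eq_Ex _ _ _ Pw _ (fun om => \sum_(i < n) weight q i *
    (h u (node_pt a (node q i) om) * psi om))); last first.
  by move=> om; rewrite mulr_suml; apply: eq_bigr => i _; rewrite mulrA.
rewrite Ex_sum => [|i]; last exact: intgZ.
rewrite big1// => i _; rewrite ExZ//.
rewrite (node_orthogonal a k_psd k_meas k_trace k_mean Pw_prod (q_good i) (Ch uh)
  (uv := subsets_sub uh) (ju := ju))// ?mulr0//.
Qed.

Let X_upd u j (jv : j \in v) o om : j \notin u -> X u (upd [` jv]%fset o om) = X u om.
Proof.
move=> ju; rewrite /X; case: ifPn => // uh; apply: eq_bigr => i _; congr (_ * _).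
apply: (Hu_eq k_psd (Ch uh)) => j' j'u.
rewrite -/(node_pt a (node q i) _) (node_pt_upd a (q_good i)) /upd /=.
by case: eqVneq => // e; rewrite -e j'u in ju.
Qed.

Let Xmean u : u \in subsets hi -> u != fset0 -> Ex Pw (X u) = 0.
Proof.
move=> uh /fset0Pn[j ju]; have := @Xorth u j (fun=> 1) uh ju (L2_cst _ _) (fun _ _ _ => erefl).
by rewrite (@eq_Ex _ _ _ Pw _ (X u))// => om; rewrite mulr1.
Qed.

(** One of two distinct sets has an element outside the other; that coordinate is averaged. *)
Let X_orthogonal u u' : u \in subsets hi -> u' \in subsets hi -> u != u' ->
  Ex Pw (fun om => X u om * X u' om) = 0.
Proof.
move=> uh u'h uu'.
have [/fsubsetP uu|] := boolP (u `<=` u')%fset; last first.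
  move=> /fsubsetPn[j ju ju']; apply: (Xorth uh ju (XL u')) => jv o om.
  exact: X_upd.
have [/fsubsetP u'u|] := boolP (u' `<=` u)%fset.
  by case/eqP: uu'; apply/fsetP => j; apply/idP/idP => [/uu|/u'u].
move=> /fsubsetPn[j ju' ju]; rewrite (@eq_Ex _ _ _ Pw _ (fun om => X u' om * X u om)) => [|om]; last exact: mulrC.
by apply: (Xorth u'h ju' (XL u)) => jv o om; exact: X_upd.
Qed.

Let r1 := [seq u <- subsets hi | u != fset0].

Lemma components_L2 : L2 Pw (fun om => \sum_(u <- r1) X u om).
Proof. by apply: L2_sum => u; exact: XL. Qed.

Lemma components_mean : Ex Pw (fun om => \sum_(u <- r1) X u om) = 0.
Proof.
rewrite Ex_sum => [|u]; last exact/L2_intg/XL.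
rewrite big_seq big1// => u; rewrite mem_filter => /andP[u0 uh].
exact: Xmean.
Qed.

Lemma components_variance :
  Ex Pw (fun om => (\sum_(u <- r1) X u om) ^+ 2) <= \sum_(u <- r1) C u * r * sqn (Hu u) (h u).
Proof.
rewrite pythagoras; [|by rewrite filter_uniq// subsets_uniq|exact: XL|]; last first.
  move=> u u'; rewrite !mem_filter => /andP[_ uh] /andP[_ u'h].
  exact: X_orthogonal.
rewrite big_seq [leRHS]big_seq; apply: ler_sum => u; rewrite mem_filter => /andP[u0 uh].
rewrite -lee_fin -variance_centered//; last exact: Xmean.
rewrite (_ : X u = rule_eval q (anchor a) (h u)); last by rewrite /X uh.
by apply: q_var => //; exact: Ch.
Qed.

(** The weights sum to 1, so the constant component passes through the rule unchanged and
    contributes to the mean only. *)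
Lemma rule_eval_components om :
  \sum_(u <- subsets hi) rule_eval q (anchor a) (h u) om =
  h fset0 (anchor a) + \sum_(u <- r1) X u om.
Proof.
rewrite (big_rem fset0) ?fset0_subsets//=; congr (_ + _).
  rewrite /rule_eval -[RHS]mul1r -q_weight mulr_suml; apply: eq_bigr => i _; congr (_ * _).
  by apply: (Hu_eq k_psd (Ch (fset0_subsets hi))) => j; rewrite inE.
rewrite rem_filter ?subsets_uniq// /r1 big_seq [RHS]big_seq.
by apply: eq_bigr => u; rewrite mem_filter /X => /andP[_ ->].
Qed.

End components.

(** [c] is the constant component. Each variance term is written as [(C u * gamma_u)] times
    [sqn h_u / gamma_u]: the first factor is bounded by the assumptions on the rule, the sum of the
    second ones by [level_decomposition], for new and old sets separately. *)
Lemma level_bound (s : nat -> seq (R * FX)) f F :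
  rkhs_carrier HK f ->
  (fun n => sqn HK (comb K (s n) \- f)) @ \oo --> (0 : R) ->
  (forall x : E, F x = f x - (if first then 0 else f (restrict a lo x))) ->
  exists c : R,
  [/\ (fun n => \sum_(p <- s n) p.1 *
         level_sec k g a first lo hi fset0 (val p.2)) @ \oo --> c,
      L2 Pw (fun om => rule_eval q (anchor a) F om - c),
      Ex Pw (fun om => rule_eval q (anchor a) F om - c) = 0 &
      Ex Pw (fun om => (rule_eval q (anchor a) F om - c) ^+ 2) <=
        r * (B1 * A hi (anchor a) + B2 * (A lo (anchor a) - A hi (anchor a))) * sqn HK f].
Proof.
move=> Cf sf FE.
have [h [Ch hE hhigh hlow hcvg]] :=
  level_decomposition k_psd g_gt0 X_anchor Hu first lohi Cf sf.
exists (h fset0 (anchor a)).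
pose r1 := [seq u <- subsets hi | u != fset0].
pose X u := if u \in subsets hi then rule_eval q (anchor a) (h u) else fun=> 0.
have YE : (fun om => rule_eval q (anchor a) F om - h fset0 (anchor a)) =
    (fun om => \sum_(u <- r1) X u om).
  apply/funext => om; apply/eqP; rewrite subr_eq addrC -rule_eval_components//; apply/eqP.
  rewrite /rule_eval exchange_big /=; apply: eq_bigr => i _; rewrite -mulr_sumr; congr (_ * _).
  rewrite FE hE// => j hij; apply: (node_pt_out a (node q i) om).
  by rewrite v_hi -leqNgt.
split.
- exact: hcvg.
- by rewrite YE; exact: components_L2.
- by rewrite YE; exact: components_mean.
rewrite [X in Ex _ X](_ : _ = fun om => (\sum_(u <- r1) X u om) ^+ 2); last first.
  by apply/funext => om; congr (_ ^+ 2); have := congr1 (fun z => z om) YE.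
apply: le_trans (components_variance Ch) _.
pose w u := sqn (Hu u) (h u) / prod_weight g u.
have w0 u : u \in subsets hi -> 0 <= w u.
  by move=> uh; rewrite divr_ge0 ?prod_weight_ge0// sqn_ge0//; exact: Ch.
rewrite -/r1 (bigID (fun u => u \in low_sets first lo)) /=.
rewrite -mulrA mulrDl mulrDr addrC; apply: lerD.
- rewrite -[B1 * _ * _]mulrA; apply: (@le_trans _ _ (r * (B1 *
    \sum_(u <- [seq u <- subsets hi | u \notin low_sets first lo]) w u))); last first.
    by rewrite ler_wpM2l// ler_wpM2l.
  rewrite !mulr_sumr /r1 !big_filter_cond [leLHS]big_mkcond [leRHS]big_mkcond.
  rewrite [leLHS]big_seq [leRHS]big_seq; apply: ler_sum => u uh.
  case: (boolP (u \in low_sets first lo)) => ul /=; first by rewrite andbF.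
  rewrite andbT; case: (eqVneq u fset0) => [_|u0] /=.
    by rewrite mulr_ge0// mulr_ge0// w0.
  rewrite (_ : _ * sqn _ _ = r * ((C u * prod_weight g u) * w u)); last first.
    by rewrite /w; field; rewrite gt_eqF ?prod_weight_gt0.
  by rewrite ler_wpM2l// ler_wpM2r ?w0// C_high.
- rewrite -[B2 * _ * _]mulrA; apply: (@le_trans _ _ (r * (B2 *
    \sum_(u <- [seq u <- subsets hi | u \in low_sets first lo]) w u))); last first.
    by rewrite ler_wpM2l// ler_wpM2l.
  rewrite !mulr_sumr /r1 !big_filter_cond [leLHS]big_mkcond [leRHS]big_mkcond.
  rewrite [leLHS]big_seq [leRHS]big_seq; apply: ler_sum => u uh.
  case: (boolP (u \in low_sets first lo)) => ul /=; last by rewrite andbF.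
  rewrite andbT; case: (eqVneq u fset0) => [_|u0] /=.
    by rewrite mulr_ge0// mulr_ge0// w0.
  rewrite (_ : _ * sqn _ _ = r * ((C u * prod_weight g u) * w u)); last first.
    by rewrite /w; field; rewrite gt_eqF ?prod_weight_gt0.
  by rewrite ler_wpM2l// ler_wpM2r ?w0// C_low.
Qed.

End level_variance.

(** * Independent levels and the error of the multilevel algorithm *)

Section independent_sum.
Variables (R : realType) (dT : measure_display) (T : measurableType dT).
Variables (PT : probability T R) (d' : nat -> measure_display).
Variables (S : forall l, measurableType (d' l)) (PS : forall l, probability (S l) R).
Variable xi : forall l, T -> S l.
Hypothesis xi_law : forall l, has_law PT (PS l) (xi l).
Hypothesis xi_indep : independent_elements PT xi.

Lemma independent_pair l l' (A : set (S l)) (B : set (S l')) : l != l' ->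
  measurable A -> measurable B ->
  PT (xi l @^-1` A `&` xi l' @^-1` B) = (PS l A * PS l' B)%E.
Proof.
move=> ll' mA mB; pose C0 : forall k, set (S k) := fun=> setT.
pose C := eqtype.dfwith (eqtype.dfwith C0 A) B.
have Cl' : C l' = B by rewrite /C eqtype.dfwith_in.
have Cl : C l = A by rewrite /C eqtype.dfwith_out 1?eq_sym// eqtype.dfwith_in.
have mC k : measurable (C k).
  have [->|kl'] := eqVneq k l'; first by rewrite Cl'.
  have [->|kl] := eqVneq k l; first by rewrite Cl.
  rewrite /C eqtype.dfwith_out; last by rewrite eq_sym.
  rewrite eqtype.dfwith_out; last by rewrite eq_sym.
  exact: measurableT.
have := xi_indep [fset l; l']%fset mC.
rewrite big_fsetU1 ?inE//= big_seq_fset1 Cl Cl' (xi_law l).2// (xi_law l').2// => <-.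
congr (PT _); apply/seteqP; split=> t /=.
  by move=> [h1 h2] k; rewrite !inE => /orP[]/eqP ->; rewrite ?Cl ?Cl'.
move=> h; split; first by rewrite -Cl; apply: h; rewrite !inE eqxx.
by rewrite -Cl'; apply: h; rewrite !inE eqxx orbT.
Qed.

Lemma Ex_independent_sum (r : seq nat) (Y : forall l, S l -> R) (b : R) : uniq r ->
  (forall l, L2 (PS l) (@Y l)) -> (forall l, Ex (PS l) (@Y l) = 0) ->
  intg PT (fun t => (b + \sum_(l <- r) Y l (xi l t)) ^+ 2) /\
  Ex PT (fun t => (b + \sum_(l <- r) Y l (xi l t)) ^+ 2) =
    b ^+ 2 + \sum_(l <- r) Ex (PS l) (fun x => Y l x ^+ 2).
Proof.
move=> ur YL Y0; have ZL l : L2 PT (fun t => Y l (xi l t)) := L2_law (xi_law l) (YL l).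
have SL : L2 PT (fun t => \sum_(l <- r) Y l (xi l t)).
  exact: (L2_sum _ (F := fun l t => Y l (xi l t))).
split; first exact: (L2D (L2_cst PT b) SL).2.
rewrite (@eq_Ex _ _ _ PT _ (fun t => b ^+ 2 + (2 * b * (\sum_(l <- r) Y l (xi l t)) +
  (\sum_(l <- r) Y l (xi l t)) ^+ 2))); last by move=> t; ring.
have Si := L2_intg SL.
rewrite ExD; [|exact: intg_cst|by apply: intgD SL.2; exact: intgZ].
rewrite ExD; [|exact: intgZ|exact: SL.2].
rewrite Ex_cst ExZ// Ex_sum => [|l]; last exact/L2_intg/ZL.
rewrite big1 => [|l _]; last first.
  by rewrite (Ex_law (xi_law l) (L2_intg (YL l))).
rewrite mulr0 add0r (pythagoras ur (F := fun l t => Y l (xi l t)))//; last first.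
  move=> l l' _ _ ll'; apply: (Ex_indep_centered (xi_law l) (xi_law l')) => //.
  by move=> A B mA mB; exact: independent_pair.
by congr (_ + _); apply: eq_bigr => l _; rewrite -(Ex_law (xi_law l) (YL l).2).
Qed.

End independent_sum.

Section multilevel.
Variables (R : realType) (d : measure_display) (D : measurableType d).
Variables (k : D -> D -> R) (g : nat -> R) (a : D) (rho : probability D R) (M : R).
Hypothesis k_psd : psd k.
Hypothesis g_gt0 : forall j, 0 < g j.
Hypothesis k_meas : measurable_fun setT (fun z : D * D => k z.1 z.2).
Hypothesis k_trace : (\int[rho]_x (k x x)%:E = M%:E)%E.
Hypothesis k_mean : forall y, (\int[rho]_x (k x y)%:E = 0)%E.
Hypothesis gM : (\esum_(u in [set: {fset nat}])
            (prod_weight g u * M ^+ #|` u|)%:E < +oo)%E.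

Local Notation E := (prodspace nat D).
Local Notation FX := (frakX k (prod_weight g)).
Local Notation K := (ker_K k (prod_weight g)).
Local Notation A l y := (tail_sec k g a l y).

Hypothesis X_anchor : FX (anchor a).
Variable Hu : forall u : {fset nat}, rkhs [set: E] (ker_u k u).
Variable HK : rkhs FX K.
Variable mu : probability E R.
Hypothesis mu_prod : is_product_measure rho mu.

Variable L : nat -> nat.
Hypothesis L_incr : forall l, (1 <= l)%N -> (L l < L l.+1)%N.

Variables (dO : measure_display) (Om : measurableType dO) (P : probability Om R).
Variable Pw : forall w : {fset nat}, probability (prodspace w Om) R.
Hypothesis Pw_prod : forall w, is_product_measure P (Pw w).
Variable Q : forall l n, rule R Om D (level_set L l) n.
Variables (dT : measure_display) (T : measurableType dT) (PT : probability T R).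
Variable xi : forall l, T -> prodspace (level_set L l) Om.
Arguments xi : clear implicits.
Hypothesis xi_law : forall l, has_law PT (Pw (level_set L l)) (xi l).
Hypothesis xi_indep : independent_elements PT xi.

Variables (m : nat) (n : nat -> nat).
Hypothesis m_gt0 : (1 <= m)%N.
Hypothesis Q_good : forall l i, (1 <= l <= m)%N ->
  good_node rho (Pw (level_set L l)) (node (Q l (n l)) i).
Hypothesis Q_weight : forall l, (1 <= l <= m)%N ->
  \sum_(i < n l) weight (Q l (n l)) i = 1.

Variables (C : {fset nat} -> nat -> R) (B1 B2 r : nat -> R).
Hypothesis r0 : forall l, 0 <= r l.
Hypothesis B10 : forall l, 0 <= B1 l.
Hypothesis B20 : forall l, 0 <= B2 l.
Hypothesis Q_var : forall l u h, (1 <= l <= m)%N -> u \in subsets (L l) -> u != fset0 ->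
  rkhs_carrier (Hu u) h ->
  ('V_(Pw (level_set L l))[rule_eval (Q l (n l)) (anchor a) h]
    <= (C u l * r l * sqn (Hu u) h)%:E)%E.

Let low l := low_sets (l == 1%N) (L l.-1).

Hypothesis C_high : forall l u, (1 <= l <= m)%N -> u \in subsets (L l) -> u \notin low l ->
  u != fset0 -> C u l * prod_weight g u <= B1 l.
Hypothesis C_low : forall l u, (1 <= l <= m)%N -> u \in subsets (L l) -> u \in low l ->
  u != fset0 -> C u l * prod_weight g u <= B2 l.

Lemma level_setE l j : (1 <= l)%N -> (j \in level_set L l) = (j < L l)%N.
Proof. by case: l => // l _; rewrite /level_set !inE mem_iota add0n. Qed.

Let low_le_hi l : (1 <= l)%N -> ((if l == 1%N then 0%N else L l.-1) <= L l)%N.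
Proof.
case: l => // -[|l] _ //=; exact/ltnW/L_incr.
Qed.

(** [L 0] is unconstrained, so on level 1 the lower index is set to 0, which guarantees
    [Lo l <= L l]; the flag [l == 1] makes [low_sets] empty there in any case. *)
Let Lo l := if l == 1%N then 0%N else L l.-1.

Definition level_error l : R :=
  r l * (B1 l * A (L l) (anchor a) +
         B2 l * (A (Lo l) (anchor a) - A (L l) (anchor a))).

Lemma multilevel_error f : rkhs_carrier HK f -> sqn HK f <= 1 ->
  (\int[PT]_t (((\int[mu]_(x in FX) f x)%R -
     ml_eval (v := level_set L) (anchor a) Q xi m n f t) ^+ 2)%:E
   <= ((A (L m) (anchor a) - 1) + \sum_(1 <= l < m.+1) level_error l)%:E)%E.
Proof.
move=> Cf f1; have [s sf] := comb_dense Cf.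
have lowE l : (1 <= l)%N -> low_sets (l == 1%N) (Lo l) = low l.
  by rewrite /low /Lo /low_sets; case: (l == 1%N).
have level l : exists c : R, (1 <= l <= m)%N ->
  [/\ (fun n => \sum_(p <- s n) p.1 *
         level_sec k g a (l == 1%N) (Lo l) (L l) fset0 (val p.2)) @ \oo --> c,
      L2 (Pw (level_set L l)) (fun om =>
        rule_eval (Q l (n l)) (anchor a) (f \- Psi (level_set L) (anchor a) l.-1 f) om - c),
      Ex (Pw (level_set L l)) (fun om =>
        rule_eval (Q l (n l)) (anchor a) (f \- Psi (level_set L) (anchor a) l.-1 f) om - c) = 0 &
      Ex (Pw (level_set L l)) (fun om =>
        (rule_eval (Q l (n l)) (anchor a) (f \- Psi (level_set L) (anchor a) l.-1 f) om - c) ^+ 2)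
        <= level_error l].
  have [lm|] := boolP (1 <= l <= m)%N; last by exists 0.
  have /andP[l1 _] := lm.
  have [||||c [h1 h2 h3 h4]] := level_bound k_psd g_gt0 k_meas k_trace k_mean
    X_anchor (Hu := Hu) (@Pw_prod (level_set L l)) (fun i => Q_good i lm)
    (Q_weight lm) (first := l == 1%N) (low_le_hi l1) _ (C := C^~ l)
    (r0 l) (B10 l) (B20 l) (fun u h => Q_var lm) _ _
    (F := f \- Psi (level_set L) (anchor a) l.-1 f) Cf sf.
  - by move=> j; exact: level_setE.
  - by move=> u uh; rewrite lowE//; exact: C_high.
  - by move=> u uh; rewrite lowE//; exact: C_low.
  - move=> x; rewrite /=; congr (_ - _); case: l l1 {lm} => // -[|l] _ //=.
    by congr f; apply/funext => j; rewrite /restrict -(@level_setE l.+1 j isT).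
  exists c => _; split => //; apply: le_trans h4 _; rewrite -[leRHS]mulr1.
  apply: ler_wpM2l => //; rewrite mulr_ge0// addr_ge0// mulr_ge0//.
    exact: le_trans (tail_sec_ge1 k_psd g_gt0 X_anchor _).
  by rewrite subr_ge0; apply: tail_sec_anti => //; exact: low_le_hi.
have [c hc] := choice level.
pose Y l : prodspace (level_set L l) Om -> R := if (1 <= l <= m)%N then fun om =>
  rule_eval (Q l (n l)) (anchor a) (f \- Psi (level_set L) (anchor a) l.-1 f) om - c l
  else fun=> 0.
have YL l : L2 (Pw (level_set L l)) (Y l).
  by rewrite /Y; case: ifPn => [/hc[]//|_]; exact: L2_cst.
have Y0 l : Ex (Pw (level_set L l)) (Y l) = 0.
  by rewrite /Y; case: ifPn => [/hc[]//|_]; exact: Ex_cst.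
pose I := (\int[mu]_(x in FX) f x)%R.
pose b := \sum_(1 <= l < m.+1) c l - I.
have errE t : I - ml_eval (v := level_set L) (anchor a) Q xi m n f t =
    - (b + \sum_(l <- index_iota 1 m.+1) Y l (xi l t)).
  have -> : ml_eval (v := level_set L) (anchor a) Q xi m n f t =
      \sum_(1 <= l < m.+1) (Y l (xi l t) + c l).
    rewrite /ml_eval big_nat [RHS]big_nat; apply: eq_bigr => l lm.
    by rewrite /Y -ltnS lm subrK.
  by rewrite big_split /= /b; ring.
rewrite (eq_integral (fun t => ((b + \sum_(l <- index_iota 1 m.+1) Y l (xi l t)) ^+ 2)%:E));
  last by move=> t _; rewrite errE sqrrN.
have [Zi ZE] := Ex_independent_sum (PS := fun l => Pw (level_set L l)) xi_law xi_indep
  b (iota_uniq 1 (m.+1 - 1)) YL Y0.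
rewrite (intgE Zi) lee_fin ZE; apply: lerD; last first.
  rewrite big_nat [leRHS]big_nat; apply: ler_sum => l lm; rewrite /Y -ltnS lm.
  by have [] := hc l lm.
have A1 := tail_sec_ge1 k_psd g_gt0 X_anchor (L m).
rewrite -[leRHS]mulr1; apply: (@le_trans _ _ ((A (L m) (anchor a) - 1) * sqn HK f)); last first.
  by rewrite ler_wpM2l// subr_ge0.
apply: (bias_limit k_psd g_gt0 X_anchor Cf sf).
(* From level 2 on the empty set is an old set, with coefficient [A (L l) - A (L l.-1)]; on level 1
   its coefficient is [A (L 1)]. *)
have telescope m' y : (1 <= m')%N -> \sum_(1 <= l < m'.+1)
    level_sec k g a (l == 1%N) (Lo l) (L l) fset0 y = A (L m') y.
  elim: m' => // -[|m'] IH _.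
    by rewrite big_nat1 /level_sec /= subr0.
  rewrite big_nat_recr//= IH// /level_sec /low_sets /= fset0_subsets /Lo /=.
  by rewrite addrC subrK.
have -> : (fun i => \sum_(p <- s i) p.1 * (A (L m) (val p.2) - 1)) = (fun i =>
    \sum_(l <- index_iota 1 m.+1) (if (1 <= l <= m)%N then \sum_(p <- s i) p.1 *
      level_sec k g a (l == 1%N) (Lo l) (L l) fset0 (val p.2) else 0) - \sum_(p <- s i) p.1).
  apply/funext => i; transitivity (\sum_(1 <= l < m.+1) \sum_(p <- s i) p.1 *
      level_sec k g a (l == 1%N) (Lo l) (L l) fset0 (val p.2) - \sum_(p <- s i) p.1).
    rewrite exchange_big -sumrB /=; apply: eq_bigr => p _.
    by rewrite -mulr_sumr telescope// mulrBr mulr1.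
  by congr (_ - _); rewrite big_nat [RHS]big_nat; apply: eq_bigr => l; rewrite ltnS => ->.
apply: cvgB; last first.
  exact: (integral_cvg k_psd g_gt0 k_meas k_trace k_mean gM mu_prod Cf sf).
rewrite (_ : \sum_(1 <= l < m.+1) c l = \sum_(l <- index_iota 1 m.+1)
  if (1 <= l <= m)%N then c l else 0); last first.
  by rewrite big_nat [RHS]big_nat; apply: eq_bigr => l; rewrite ltnS => ->.
apply: (cvg_bigsum (u := fun l i => if (1 <= l <= m)%N then \sum_(p <- s i) p.1 *
  level_sec k g a (l == 1%N) (Lo l) (L l) fset0 (val p.2) else 0)) => l.
by case: ifPn => [/hc[]//|_]; exact: cvg_cst.
Qed.

End multilevel.

(** * Cost of the multilevel algorithm *)

Section integral_bound.
Import HBNNSimple.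

(** The cost of a point tests exact equality with the anchor on infinitely many coordinates. The
    bound therefore runs through the simple functions below [F], which are measurable by
    construction. *)
Lemma integral_le_cst (R : realType) d (T : measurableType d) (P : probability T R)
    (F : T -> \bar R) (c : R) :
  (forall t, 0 <= F t)%E -> (forall t, F t <= c%:E)%E -> (\int[P]_t F t <= c%:E)%E.
Proof.
move=> F0 Fc; rewrite ge0_integralTE//; apply: ge_ereal_sup => _ [h hF <-].
rewrite -integralT_nnsfun; apply: (@le_trans _ _ (\int[P]_t (cst c%:E t))%E).
  apply: ge0_le_integral => //.
  - by move=> t _; rewrite lee_fin.
  - exact/measurable_EFinP.
  - by move=> t _; exact: le_trans (hF t) (Fc t).
rewrite (_ : (\int[P]_t cst c%:E t)%E = c%:E)// -[RHS]mule1 -(probability_setT P).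
exact: integral_cst.
Qed.

End integral_bound.

Section cost.
Variables (R : realType) (d : measure_display) (D : measurableType d) (a : D).
Variables (dollar : nat -> R) (L : nat -> nat).
Hypothesis dollar_ge0 : forall n, 0 <= dollar n.
Hypothesis L1 : (1 <= L 1)%N.
Hypothesis L_incr : forall l, (1 <= l)%N -> (L l < L l.+1)%N.
Variables (dO : measure_display) (Om : measurableType dO).
Variable Q : forall l n, rule R Om D (level_set L l) n.
Variables (dT : measure_display) (T : measurableType dT) (PT : probability T R).
Variable xi : forall l, T -> prodspace (level_set L l) Om.
Arguments xi : clear implicits.

Lemma card_level_set l : (1 <= l)%N -> #|` level_set L l| = L l.
Proof.
move=> l1; rewrite -[RHS](size_iota 0); apply: perm_size.
apply: uniq_perm; [exact: fset_uniq|exact: iota_uniq|move=> j].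
by rewrite (level_setE L j l1) mem_iota add0n.
Qed.

(** Shifted by one because the cost model asks for non-empty sets and [level_set L 0] is empty. *)
Let v i := level_set L i.+1.

Let point_cost_ge0 x : (0 <= point_cost dollar v (anchor a) x)%E.
Proof.
by apply: le_ereal_inf_tmp => _ [i _ <-]; rewrite lee_fin.
Qed.

Let point_cost_le l x : (1 <= l)%N -> (forall j, j \notin level_set L l -> x j = a) ->
  (point_cost dollar v (anchor a) x <= (dollar (L l))%:E)%E.
Proof.
case: l => // l _ xa; apply: ereal_inf_lbound; exists l; first exact: xa.
by rewrite card_level_set.
Qed.

Let sum_cost_le n (x : 'I_n -> prodspace nat D) c :
  (forall i, (point_cost dollar v (anchor a) (x i) <= c%:E)%E) ->
  (\sum_(i <- enum 'I_n) point_cost dollar v (anchor a) (x i) <= (n%:R * c)%:E)%E.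
Proof.
move=> h; apply: (@le_trans _ _ (\sum_(i <- enum 'I_n) c%:E)%E).
  by apply: lee_sum => i _; exact: h.
rewrite sumEFin lee_fin big_const_seq count_predT size_enum_ord iter_addr_0.
by rewrite mulr_natl.
Qed.

(** The factor 2 accounts for the spliced point of each node. It also equals the anchor off
    [level_set L l], so it is charged at the same price [dollar (L l)]. *)
Lemma multilevel_cost (X : set (prodspace nat D)) BK m n : X (anchor a) ->
  (vss_cost dollar X BK PT (ml_points (v := level_set L) (anchor a) Q xi m n)
   <= (\sum_(1 <= l < m.+1) 2 * (n l)%:R * dollar (L l))%:E)%E.
Proof.
move=> Xa; apply: (@le_trans _ _ (ereal_sup [set (\int[PT]_t
   \sum_(x <- ml_points (v := level_set L) (anchor a) Q xi m n f t)
     point_cost dollar v (anchor a) x)%E | f in BK])).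
  apply: ereal_inf_lbound; exists v, (anchor a); split => //.
  - move=> i; rewrite -cardfs_gt0 card_level_set//.
    by elim: i => // i /leq_trans; apply; exact/ltnW/L_incr.
  - move=> i; rewrite fproperEcard !card_level_set// L_incr// andbT.
    by apply/fsubsetP => j; rewrite !level_setE// => /leq_trans; apply; exact/ltnW/L_incr.
apply: ge_ereal_sup => _ [f _ <-]; apply: integral_le_cst => t.
  by apply: sume_ge0 => x _; exact: point_cost_ge0.
rewrite /ml_points big_flatten big_map /= -sumEFin.
rewrite /index_iota subSS subn0 big_seq [leRHS]big_seq; apply: lee_sum => l.
rewrite mem_iota => /andP[l1 _]; rewrite big_cat /= big_map.
have pts i : (point_cost dollar v (anchor a)
    (splice_fin (node (Q l (n l)) i (xi l t)) (anchor a)) <= (dollar (L l))%:E)%E.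
  by apply: point_cost_le => // j jl; rewrite /splice_fin insubN.
have h1 := sum_cost_le pts.
rewrite -mulrA mulr_natl mulr2n EFinD; apply: leeD; first exact: h1.
case: eqVneq => [_|l2]; first by rewrite big_nil lee_fin mulr_ge0.
rewrite 2!big_map.
apply: (sum_cost_le (x := fun i => splice (level_set L l.-1)
  (splice_fin (node (Q l (n l)) i (xi l t)) (anchor a)) (anchor a))) => i; apply: point_cost_le => // j jl.
by rewrite /splice /splice_fin insubN//; case: ifP.
Qed.

End cost.

(** * Rates *)

Section real_powers.
Variable R : realType.
Implicit Types x y p r : R.

Lemma powR_anti r x y : 0 <= r -> 0 < x -> x <= y -> y `^ (- r) <= x `^ (- r).
Proof.
move=> r0 x0 xy; rewrite !powRN lef_pV2 ?posrE ?powR_gt0 ?(lt_le_trans x0)//.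
by rewrite ge0_ler_powR// nnegrE ltW// (lt_le_trans x0).
Qed.

(** Integral comparison on [[j, j + 1]] in telescoping form. After division by [y]^ (1 -
    p)[it reads](y / x) [^ (p - 1) >= 1 + (p - 1) / y], which follows from [expR z >= 1 + z] and
    [ln (y / x) >= 1 / y]. *)
Lemma powR_step p (j : nat) : 1 < p -> (1 <= j)%N ->
  (p - 1) * j.+1%:R `^ (- p) <= j%:R `^ (1 - p) - j.+1%:R `^ (1 - p).
Proof.
move=> p1 j1; have j0 : 0 < j%:R :> R by rewrite ltr0n.
have j10 : 0 < j.+1%:R :> R by rewrite ltr0n.
set x : R := j%:R; set y : R := j.+1%:R; have yx : y = x + 1 by rewrite /x /y natr1.
have -> : y `^ (- p) = y `^ (1 - p) / y.
  rewrite -(powR_inv1 (ltW j10)) -powRD ?(gt_eqF j10) ?implybT//.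
  by congr (_ `^ _); ring.
have -> : x `^ (1 - p) = y `^ (1 - p) * (y / x) `^ (p - 1).
  rewrite powRM ?invr_ge0 ?ltW// mulrA -powRD ?(gt_eqF j10) ?implybT//.
  rewrite (_ : 1 - p + (p - 1) = 0) ?powRr0 ?mul1r; last by ring.
  by rewrite -powR_inv1 ?ltW// -powRrM; congr (_ `^ _); ring.
set Y := y `^ (1 - p); set Z := (y / x) `^ _.
rewrite (_ : _ * (Y / y) = Y * ((p - 1) / y)); last by ring.
rewrite (_ : Y * Z - Y = Y * (Z - 1)); last by ring.
rewrite ler_wpM2l ?powR_ge0// lerBrDr /Z /powR gt_eqF ?divr_gt0//.
apply: le_trans (expR_ge1Dx _); rewrite addrC lerD2l ler_wpM2l ?subr_ge0 ?(ltW p1)//.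
have : ln (1 + - y^-1) <= - y^-1.
  by apply: le_ln1Dx; rewrite ltrN2 invf_lt1// /y ltr1n ltnS.
rewrite (_ : 1 + - y^-1 = (y / x)^-1); last first.
  by rewrite yx; field; rewrite -yx !gt_eqF.
by rewrite lnV ?posrE ?divr_gt0// lerN2.
Qed.

Lemma sum_powR_tail p (l n : nat) : 1 < p -> (1 <= l)%N ->
  \sum_(l <= j < n) j.+1%:R `^ (- p) <= l%:R `^ (1 - p) / (p - 1).
Proof.
move=> p1 l1; have p0 : 0 < p - 1 by rewrite subr_gt0.
have [nl|ln] := leqP n l; first by rewrite big_geq// divr_ge0 ?powR_ge0 ?ltW.
rewrite ler_pdivlMr// mulr_suml.
apply: (@le_trans _ _ (l%:R `^ (1 - p) - n%:R `^ (1 - p))); last first.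
  by rewrite gerBl powR_ge0.
elim: n ln => // n IH; rewrite ltnS leq_eqVlt => /predU1P[<-|ln].
  by rewrite big_nat1 mulrC; exact: powR_step.
rewrite big_nat_recr/=; last exact: ltnW.
have := IH ln; have := powR_step p1 (leq_trans l1 (ltnW ln)).
by rewrite [_ * (p - 1)]mulrC => h1 h2; lra.
Qed.

Lemma prod1D_le_expR (I : Type) (r : seq I) (t : I -> R) : (forall i, 0 <= t i) ->
  \prod_(i <- r) (1 + t i) <= expR (\sum_(i <- r) t i).
Proof.
move=> t0; elim: r => [|i r IH]; first by rewrite !big_nil expR0.
rewrite !big_cons expRD; apply: ler_pM => //.
- by rewrite addr_ge0.
- by apply: prodr_ge0 => j _; rewrite addr_ge0.
- exact: expR_ge1Dx.
Qed.

Lemma expR_sub1_le x : expR x - 1 <= x * expR x.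
Proof.
have := expR_ge1Dx (- x); rewrite expRN => h.
have e0 : 0 < expR x by exact: expR_gt0.
have := ler_wpM2r (ltW e0) h; rewrite mulVf ?gt_eqF// mulrDl mul1r; lra.
Qed.

End real_powers.

Section decay.
Variables (R : realType) (d : measure_display) (D : measurableType d).
Variables (k : D -> D -> R) (g : nat -> R) (a : D).
Hypothesis k_gt0 : 0 < k a a.
Hypothesis g_ge0 : forall j, 0 <= g j.
Hypothesis g_noninc : forall i j, (i <= j)%N -> g j <= g i.
Variable us : nat -> {fset nat}.
Hypothesis us_enum : decreasing_enum (prod_weight g) (gamma_hat k a (prod_weight g)) us.

(* Infinitely many subsets with positive weight force all g j to be positive. *)
Lemma weights_gt0 j : 0 < g j.
Proof.
have [us_inj us_pos _] := us_enum.
rewrite lt_def g_ge0 andbT; apply/negP => /eqP gj.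
have us_sub i : us i \in subsets j.
  have [_ ui0] := (us_pos (us i)).1 (ex_intro _ i erefl).
  apply/mem_subsetsP => l lu; rewrite ltnNge; apply/negP => jl.
  have gl : g l = 0 by apply/eqP; rewrite eq_le g_ge0 -gj g_noninc.
  by move: ui0; rewrite /prod_weight (big_fsetD1 l)//= gl mul0r ltxx.
have : (size (map us (iota 0 (size (subsets j)).+1)) <= size (subsets j))%N.
  apply: uniq_leq_size; first by rewrite map_inj_uniq// iota_uniq.
  by move=> _ /mapP[i _ ->].
by rewrite size_map size_iota ltnn.
Qed.

Let gh j := g j * k a a.

Let gamma_hat1 j : gamma_hat k a (prod_weight g) [fset j]%fset = gh j.
Proof. by rewrite /gamma_hat /prod_weight big_seq_fset1 cardfs1 expr1. Qed.

(* Among the singletons {0}, ..., {j} one occupies a position at least j. *)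
Lemma singleton_le_enum j : gh j <= gamma_hat k a (prod_weight g) (us j).
Proof.
have [us_inj us_pos us_dec] := us_enum.
have pos i : exists n, us n = [fset i]%fset.
  apply: (us_pos _).2; split; last by rewrite /prod_weight big_seq_fset1 weights_gt0.
  by apply/fset0Pn; exists i; rewrite inE.
have [n hn] := choice pos.
have [i ij jn] : exists2 i, (i <= j)%N & (j <= n i)%N.
  apply: contrapT => h.
  have : (size (map n (iota 0 j.+1)) <= size (iota 0 j))%N.
    apply: uniq_leq_size.
      rewrite map_inj_in_uniq ?iota_uniq// => x y _ _ exy.
      have := congr1 us exy; rewrite !hn => /fsetP/(_ x).
      by rewrite !inE eqxx => /esym/eqP.
    move=> x /mapP[i]; rewrite !mem_iota !add0n /= ltnS => ij ->.
    by rewrite ltnNge; apply/negP => jn; apply: h; exists i.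
  by rewrite size_map !size_iota ltnn.
apply: le_trans (us_dec _ _ jn); rewrite hn gamma_hat1.
by rewrite /gh ler_wpM2r ?(ltW k_gt0)// g_noninc.
Qed.

Variable dec : R.
Hypothesis us_decay : decay (gamma_hat k a (prod_weight g)) us = dec%:E.

(** The decay is a supremum, so some admissible exponent [q] exceeds [p]; the null sequence
    belonging to [q] is bounded, and [singleton_le_enum] transfers the bound to single weights. *)
Lemma singleton_decay p : p < dec -> exists2 c, 0 <= c &
  forall j, gh j <= c * j.+1%:R `^ (- p).
Proof.
move=> pd; pose u q j := gamma_hat k a (prod_weight g) (us j) * j.+1%:R `^ q.
have : (p%:E < ereal_sup [set q%:E | q in [set q : R | u q @ \oo --> (0%R : R)]])%E.
  by rewrite -/(decay _ us) us_decay lte_fin.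
move=> /ereal_sup_gt[_ [q uq <-]]; rewrite lte_fin => pq.
have [c [_ hc]] := cvg_seq_bounded (cvgP _ uq).
have {}hc j : `|u q j| <= `|c| + 1.
  by apply: hc => //; rewrite (le_lt_trans (ler_norm c))// ltrDl.
exists (`|c| + 1) => [|j]; first by rewrite addr_ge0.
have j0 : 0 < j.+1%:R :> R by rewrite ltr0n.
apply: le_trans (singleton_le_enum j) _.
have -> : gamma_hat k a (prod_weight g) (us j) = u q j * j.+1%:R `^ (- q).
  by rewrite /u -mulrA -powRD ?subrr ?powRr0 ?mulr1// (gt_eqF j0) implybT.
apply: ler_pM; rewrite ?powR_ge0//.
- rewrite mulr_ge0 ?powR_ge0// mulr_ge0 ?exprn_ge0 ?(ltW k_gt0)//.
  exact: prodr_ge0.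
- exact: le_trans (ler_norm _) (hc j).
- by apply: ler_powR; rewrite ?ler1n// lerN2 ltW.
Qed.

Hypothesis k_psd : psd k.
Hypothesis X_anchor : frakX k (prod_weight g) (anchor a).

(** With [s] the tail sum of the [gh j], the product minus 1 is at most [expR s - 1 <= s * expR s].
    The first factor has the claimed decay, and the second is at most [expR S0], where [S0] bounds
    all tail sums with [l >= 1]. *)
Lemma tail_sec_decay p : 1 < p -> p < dec -> exists2 c, 0 <= c &
  forall l, (1 <= l)%N -> tail_sec k g a l (anchor a) - 1 <= c * l%:R `^ (1 - p).
Proof.
move=> p1 pd; have [c c0 hc] := singleton_decay pd.
have p0 : 0 < p - 1 by rewrite subr_gt0.
have gh0 j : 0 <= gh j by rewrite mulr_ge0 ?(ltW k_gt0).
pose S0 := c / (p - 1); have S00 : 0 <= S0 by rewrite divr_ge0// ltW.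
exists (S0 * expR S0) => [|l l1]; first by rewrite mulr_ge0 ?expR_ge0.
have cv := cvg_factor_tail k_psd weights_gt0 X_anchor (l := l) X_anchor.
rewrite lerBlDr -(cvg_lim _ cv)//; apply: limr_le; first by apply/cvg_ex; eexists; exact: cv.
apply: nearW => n; pose s := \sum_(l <= j < n) gh j.
have s0 : 0 <= s by apply: sumr_ge0.
have sle : s <= S0 * l%:R `^ (1 - p).
  apply: (@le_trans _ _ (c * \sum_(l <= j < n) j.+1%:R `^ (- p))).
    by rewrite mulr_sumr; apply: ler_sum => j _; exact: hc.
  by rewrite /S0 mulrAC -mulrA ler_wpM2l// sum_powR_tail.
have sS0 : s <= S0.
  apply: le_trans sle _; rewrite ler_piMr// -opprB powRN invf_le1 ?powR_gt0 ?ltr0n//.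
  have : 1 `^ (p - 1) <= l%:R `^ (p - 1) :> R.
    by rewrite ge0_ler_powR ?nnegrE ?ler1n ?(ltW p0).
  by rewrite powR1.
rewrite -lerBlDr; apply: (@le_trans _ _ (expR s - 1)).
  by rewrite lerB// prod1D_le_expR.
apply: le_trans (expR_sub1_le s) _; rewrite mulrAC; by apply: ler_pM => //; rewrite ler_expR.
Qed.

End decay.

(** * Distribution of the nodes over the levels *)

Section allocation.
Variable R : realType.
Implicit Types x q B G H tau : R.

Lemma geometric_sumE q m :
  (q - 1) * \sum_(1 <= l < m.+1) q ^+ l = q ^+ m.+1 - q.
Proof.
elim: m => [|m IH]; first by rewrite big_geq// mulr0 expr1 subrr.
by rewrite big_nat_recr//= mulrDr IH !exprS; ring.
Qed.

Lemma geometric_sum_lt1 q m : 0 <= q -> q < 1 ->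
  \sum_(1 <= l < m.+1) q ^+ l <= (1 - q)^-1.
Proof.
move=> q0 q1; have d0 : 0 < 1 - q by rewrite subr_gt0.
rewrite -(ler_pM2l d0) mulfV ?gt_eqF//.
have := geometric_sumE q m; have := exprn_ge0 m.+1 q0.
by set S := \sum_(_ <= _ < _) _; lra.
Qed.

Lemma geometric_sum_gt1 q m : 1 < q ->
  \sum_(1 <= l < m.+1) q ^+ l <= q ^+ m * (q / (q - 1)).
Proof.
move=> q1; have d0 : 0 < q - 1 by rewrite subr_gt0.
rewrite mulrA -exprSr -(ler_pM2l d0) geometric_sumE mulrCA mulfV ?gt_eqF// mulr1.
by rewrite gerBl ltW// (lt_trans ltr01).
Qed.

Lemma powR_exprn x (l : nat) (y : R) : 0 <= x -> (x ^+ l) `^ y = (x `^ y) ^+ l.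
Proof.
by move=> x0; rewrite -powR_mulrn// powRAC powR_mulrn// powR_ge0.
Qed.

Lemma exists_scale B x : 1 < B -> B <= x ->
  exists m, [/\ (1 <= m)%N, B ^+ m <= x & x < B ^+ m.+1].
Proof.
move=> B1 Bx; have B0 : 0 < B by rewrite (lt_trans ltr01).
have x0 : 0 < x by exact: lt_le_trans Bx.
have : exists n, x < B ^+ n.
  have /cvgrPdist_lt/(_ x^-1) : (fun n => B^-1 ^+ n) @ \oo --> (0 : R).
    by apply: cvg_expr; rewrite gtr0_norm ?invr_gt0// invf_lt1.
  rewrite invr_gt0 => /(_ x0)[n _ /(_ n (leqnn n))] /=.
  rewrite sub0r normrN gtr0_norm ?exprn_gt0 ?invr_gt0// exprVn ltf_pV2 ?posrE ?exprn_gt0//.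
  by exists n.
move=> ex; case: (ex_minnP ex) => -[|[|m]] xm minm.
- by rewrite expr0 in xm; move: (lt_trans (lt_le_trans B1 Bx) xm); rewrite ltxx.
- by rewrite expr1 ltNge Bx in xm.
exists m.+1; split=> //; rewrite leNgt; apply/negP => /minm.
by rewrite ltnn.
Qed.

Section counts.
Variables (H x : R).
Hypotheses (H0 : 0 < H) (H1 : H < 1) (x0 : 0 < x).

(** The offset 2 rounds up and leaves at least two nodes, as the bound in [n - 1] requires. The
    surplus costs twice the sum of the [B ^+ l], which is of order [B ^+ m] and hence within the
    budget. *)
Definition node_count l : nat := (Num.truncn (x * H ^+ l)).+2.

Lemma node_count_ge l : x * H ^+ l <= (node_count l)%:R.
Proof.
rewrite ltW// (lt_trans (truncnS_gt _))// ltr_nat.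
exact: ltnSn.
Qed.

Lemma node_count_le l : (node_count l)%:R <= x * H ^+ l + 2.
Proof.
rewrite /node_count -addn2 natrD lerD2r truncn_le.
by rewrite mulr_ge0 ?exprn_ge0 ?ltW.
Qed.

Lemma node_count_noninc l : (node_count l.+1 <= node_count l)%N.
Proof.
rewrite !ltnS; apply: le_truncn; rewrite ler_wpM2l ?(ltW x0)//.
by rewrite exprS ler_piMl ?exprn_ge0 ?(ltW H0) ?(ltW H1).
Qed.

Lemma node_count_cost B m : 0 <= B ->
  \sum_(1 <= l < m.+1) (node_count l)%:R * B ^+ l <=
  x * \sum_(1 <= l < m.+1) (H * B) ^+ l + 2 * \sum_(1 <= l < m.+1) B ^+ l.
Proof.
move=> B0; rewrite !mulr_sumr -big_split; apply: ler_sum => l _ /=.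
by rewrite exprMn mulrA -mulrDl ler_wpM2r ?exprn_ge0// node_count_le.
Qed.

Lemma node_count_error G tau m : 0 <= G -> 0 <= tau ->
  \sum_(1 <= l < m.+1) (node_count l)%:R `^ (- tau) * G ^+ l <=
  x `^ (- tau) * \sum_(1 <= l < m.+1) (H `^ (- tau) * G) ^+ l.
Proof.
move=> G0 t0; rewrite mulr_sumr; apply: ler_sum => l _.
rewrite exprMn mulrA ler_wpM2r ?exprn_ge0// -powR_exprn ?(ltW H0)//.
rewrite -powRM ?(ltW x0) ?exprn_ge0 ?(ltW H0)//.
by apply: powR_anti => //; [rewrite mulr_gt0 ?exprn_gt0|exact: node_count_ge].
Qed.

End counts.

Variables (b s tau p : R).
Hypotheses (b1 : 1 < b) (s0 : 0 < s) (tau0 : 0 < tau) (p1 : 1 < p).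

Let B := b `^ s.
Let G := b `^ (1 - p).

Let b0 : 0 < b. Proof. exact: lt_trans b1. Qed.

Let powb_gt1 y : 0 < y -> 1 < b `^ y.
Proof.
by move=> y0; rewrite -(@powRr0 _ b) /powR gt_eqF// ltr_expR ltr_pM2r// ln_gt0.
Qed.

Let powb_lt1 y : y < 0 -> b `^ y < 1.
Proof.
move=> y0; rewrite -[y]opprK powRN invf_lt1 ?powR_gt0//.
by apply: powb_gt1; rewrite oppr_gt0.
Qed.

Let powbM y z : b `^ (y + z) = b `^ y * b `^ z.
Proof. by rewrite powRD ?(gt_eqF b0) ?implybT. Qed.

Let B1 : 1 < B. Proof. exact: powb_gt1. Qed.
Let B0 : 0 < B. Proof. exact: powR_gt0. Qed.
Let G0 : 0 < G. Proof. exact: powR_gt0. Qed.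
Let Cb : R := B / (B - 1).
Let Cb0 : 0 <= Cb. Proof. by rewrite divr_ge0 ?subr_ge0 ?(ltW B0) ?(ltW B1). Qed.

(** The number of levels is the largest affordable one, so the budget is below [B ^+ m.+1]; the one
    missing level costs the factor [G^-1]. *)
Let bias_scale r m x : 0 <= r -> r * s <= p - 1 -> 0 < x -> x < B ^+ m.+1 ->
  G ^+ m <= G^-1 * x `^ (- r).
Proof.
move=> r0 rs x0 xB; rewrite -(ler_pM2l G0) mulrA mulfV ?gt_eqF// mul1r -exprS.
apply: (@le_trans _ _ ((B `^ (- r)) ^+ m.+1)).
  rewrite lerXn2r ?nnegrE ?powR_ge0// /G /B -powRrM.
  by apply: ler_powR; [exact: ltW|lra].
rewrite -powR_exprn ?(ltW B0)//.
by apply: powR_anti => //; exact: ltW.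
Qed.

(** [x] is the budget, [B ^+ l] the order of the price of a node on level [l], and [G ^+ m] the
    order of the squared bias. *)
Definition allocation r := exists c x0 : R, [/\ 0 <= c, 0 < x0 & forall x, x0 <= x ->
  exists (m : nat) (n : nat -> nat),
  [/\ (1 <= m)%N, forall l, (2 <= n l)%N, forall l, (n l.+1 <= n l)%N,
      \sum_(1 <= l < m.+1) (n l)%:R * B ^+ l <= c * x &
      G ^+ m + \sum_(1 <= l < m.+1) (n l)%:R `^ (- tau) * G ^+ l <= c * x `^ (- r)]].

Lemma allocation_smooth : tau * s < p - 1 -> allocation tau.
Proof.
move=> ts; have [eta /andP[se et]] : exists eta, s < eta < (p - 1) / tau.
  exists ((s + (p - 1) / tau) / 2); have : s < (p - 1) / tau.
    by rewrite ltr_pdivlMr// mulrC.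
  by move=> h; apply/andP; split; lra.
have et' : tau * eta < p - 1 by rewrite mulrC -ltr_pdivlMr.
have e0 : 0 < eta by exact: lt_trans se.
pose H := b `^ (- eta); have H0 : 0 < H by exact: powR_gt0.
have H1 : H < 1 by apply: powb_lt1; rewrite oppr_lt0.
have HB : H * B < 1 by rewrite -powbM; apply: powb_lt1; lra.
have HG : H `^ (- tau) * G < 1.
  by rewrite /H -powRrM -powbM; apply: powb_lt1; lra.
have HB0 : 0 <= H * B by rewrite mulr_ge0 ?ltW.
have HG0 : 0 <= H `^ (- tau) * G by rewrite mulr_ge0 ?powR_ge0 ?ltW.
have i1 : 0 <= (1 - H * B)^-1 by rewrite invr_ge0 subr_ge0 ltW.
have i2 : 0 <= (1 - H `^ (- tau) * G)^-1 by rewrite invr_ge0 subr_ge0 ltW.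
have i3 : 0 <= G^-1 by rewrite invr_ge0 ltW.
exists ((1 - H * B)^-1 + 2 * Cb + (G^-1 + (1 - H `^ (- tau) * G)^-1)), B; split=> //.
  have c2 : 0 <= 2 * Cb by exact: mulr_ge0.
  by apply: addr_ge0; exact: addr_ge0.
move=> x Bx; have x0 : 0 < x by exact: lt_le_trans Bx.
have [m [m1 Bm xB]] := exists_scale B1 Bx.
exists m, (node_count H x); split=> //.
- by move=> l; exact: node_count_noninc.
- apply: le_trans (node_count_cost H0 x0 m (ltW B0)) _.
  have h1 := geometric_sum_lt1 m HB0 HB; have h2 := geometric_sum_gt1 m B1.
  have h3 := ler_wpM2l (ltW x0) h1; have h4 := ler_wpM2r Cb0 Bm.
  have h5 : 0 <= (G^-1 + (1 - H `^ (- tau) * G)^-1) * x.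
    by rewrite mulr_ge0 ?(ltW x0)// addr_ge0.
  by rewrite -/Cb in h2; lra.
- have h1 := node_count_error H0 x0 m (ltW G0) (ltW tau0).
  have h2 := ler_wpM2l (powR_ge0 x (- tau)) (geometric_sum_lt1 m HG0 HG).
  have h3 := bias_scale (ltW tau0) (ltW ts) x0 xB.
  have h4 : 0 <= ((1 - H * B)^-1 + 2 * Cb) * x `^ (- tau).
    by rewrite mulr_ge0 ?powR_ge0// addr_ge0// mulr_ge0.
  by lra.
Qed.

(** Here [(p - 1) / tau < eta < s], both ratios exceed 1 and the top level dominates. The variance
    is then of the order of the bias [G ^+ m], and the exponent is the one at which the number of
    affordable levels limits the bias. *)
Lemma allocation_rough : p - 1 < tau * s -> allocation ((p - 1) / s).
Proof.
move=> ts; have [eta /andP[et se]] : exists eta, (p - 1) / tau < eta < s.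
  exists ((s + (p - 1) / tau) / 2); have : (p - 1) / tau < s.
    by rewrite ltr_pdivrMr// mulrC.
  by move=> h; apply/andP; split; lra.
have et' : p - 1 < tau * eta by rewrite mulrC -ltr_pdivrMr.
have e0 : 0 < eta by apply: lt_trans et; rewrite divr_gt0// subr_gt0.
pose H := b `^ (- eta); have H0 : 0 < H by exact: powR_gt0.
have H1 : H < 1 by apply: powb_lt1; rewrite oppr_lt0.
have HB : 1 < H * B by rewrite -powbM; apply: powb_gt1; lra.
pose W := H `^ (- tau) * G.
have HG : 1 < W.
  by rewrite /W /H -powRrM -powbM; apply: powb_gt1; lra.
pose C1 := H * B / (H * B - 1); pose C2 := W / (W - 1).
have C10 : 0 <= C1 by rewrite divr_ge0 ?subr_ge0 ?ltW// (lt_trans ltr01).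
have C20 : 0 <= C2 by rewrite divr_ge0 ?subr_ge0 ?ltW// (lt_trans ltr01).
have i3 : 0 <= G^-1 by rewrite invr_ge0 ltW.
exists (C1 + 2 * Cb + (G^-1 + C2 * G^-1)), B; split=> //.
  have c2 : 0 <= 2 * Cb by exact: mulr_ge0.
  have c3 : 0 <= C2 * G^-1 by exact: mulr_ge0.
  by apply: addr_ge0; exact: addr_ge0.
move=> x Bx; have x0 : 0 < x by exact: lt_le_trans Bx.
have [m [m1 Bm xB]] := exists_scale B1 Bx.
(* Chosen with [y * H ^+ m = 1]: the top level receives a bounded number of nodes, and the lower
   levels grow from there. *)
pose y := (H ^+ m)^-1; have Hm : 0 < H ^+ m by exact: exprn_gt0.
have y0 : 0 < y by rewrite invr_gt0.
have p10 : 0 <= (p - 1) / s by rewrite divr_ge0 ?subr_ge0 ?(ltW p1) ?(ltW s0).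
have ps : (p - 1) / s * s <= p - 1 by rewrite divfK ?gt_eqF.
have hG := bias_scale p10 ps x0 xB.
exists m, (node_count H y); split=> //.
- by move=> l; exact: node_count_noninc.
- apply: le_trans (node_count_cost H0 y0 m (ltW B0)) _.
  have h1 := ler_wpM2l (ltW y0) (geometric_sum_gt1 m HB).
  have h2 := geometric_sum_gt1 m B1.
  have h3 : y * ((H * B) ^+ m * C1) = B ^+ m * C1.
    by rewrite exprMn !mulrA mulVf ?gt_eqF// mul1r.
  rewrite -/C1 h3 in h1; rewrite -/Cb in h2.
  have h4 := ler_wpM2r Cb0 Bm; have h5 := ler_wpM2r C10 Bm.
  have h6 : 0 <= (G^-1 + C2 * G^-1) * x.
    by rewrite mulr_ge0 ?(ltW x0)// addr_ge0// mulr_ge0.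
  by lra.
- have h1 := node_count_error H0 y0 m (ltW G0) (ltW tau0).
  have h2 := ler_wpM2l (powR_ge0 y (- tau)) (geometric_sum_gt1 m HG).
  have h3 : y `^ (- tau) * (W ^+ m * C2) = G ^+ m * C2.
    have e : y `^ (- tau) * (H `^ (- tau)) ^+ m = 1.
      rewrite -powR_exprn ?(ltW H0)// -powRM ?(ltW y0) ?(ltW Hm)//.
      by rewrite /y mulVf ?gt_eqF// powR1.
    move: (C2) => c2; rewrite /W exprMn.
    transitivity (y `^ (- tau) * (H `^ (- tau)) ^+ m * (G ^+ m * c2)); first by ring.
    by rewrite e mul1r.
  rewrite -/C2 h3 in h2.
  have h4 := ler_wpM2r C20 hG.
  have h5 : 0 <= (C1 + 2 * Cb) * x `^ (- ((p - 1) / s)).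
    by rewrite mulr_ge0 ?powR_ge0// addr_ge0// mulr_ge0.
  rewrite -/W in h1.
  move: (x `^ _) hG h4 h5 => z hG h4 h5.
  by lra.
Qed.

End allocation.

Lemma rand_error_sqr_le (R : realType) d (D : measurableType d)
    (mu : probability (prodspace nat D) R) (X : set (prodspace nat D)) BK
    dT (T : measurableType dT) (P : probability T R) (q : (prodspace nat D -> R) -> T -> R)
    (c : R) : BK !=set0 ->
  (forall f, BK f ->
     (\int[P]_t (((\int[mu]_(x in X) f x)%R - q f t) ^+ 2)%:E <= c%:E)%E) ->
  (rand_error mu X BK P q ^+ 2 <= c%:E)%E.
Proof.
move=> [f0 Bf0] h; rewrite /rand_error; set S := [set _ | f in BK].
(* The element [f0] keeps the supremum from being that of the empty set, which is [-oo]. *)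
have S0 : (0 <= ereal_sup S)%E.
  apply: (@le_trans _ _ (\int[P]_t (((\int[mu]_(x in X) f0 x)%R - q f0 t) ^+ 2)%:E)%E).
    by apply: integral_ge0 => t _; rewrite lee_fin sqr_ge0.
  by apply: ereal_sup_ubound; exists f0.
have Sc : (ereal_sup S <= c%:E)%E by apply: ge_ereal_sup => _ [f Bf <-]; exact: h.
have Sfin : ereal_sup S \is a fin_num.
  by rewrite ge0_fin_numE// (le_lt_trans Sc)// ltry.
rewrite -(fineK Sfin) poweR_EFin -EFin_expe powR12_sqrt ?fine_ge0// sqr_sqrtr ?fine_ge0//.
by rewrite fineK.
Qed.

(** * Assembly of the rates *)

Section assembly.
Variables (R : realType) (d : measure_display) (D : measurableType d).
Variables (k : D -> D -> R) (g : nat -> R) (a : D) (rho : probability D R) (M : R).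
Hypothesis k_psd : psd k.
Hypothesis k_diag : 0 < k a a.
Hypothesis g_ge0 : forall j, 0 <= g j.
Hypothesis g_noninc : forall i j, (i <= j)%N -> g j <= g i.
Hypothesis k_meas : measurable_fun setT (fun z : D * D => k z.1 z.2).
Hypothesis k_trace : (\int[rho]_x (k x x)%:E = M%:E)%E.
Hypothesis k_mean : forall y, (\int[rho]_x (k x y)%:E = 0)%E.
Hypothesis gM : (\esum_(u in [set: {fset nat}])
            (prod_weight g u * M ^+ #|` u|)%:E < +oo)%E.

Local Notation E := (prodspace nat D).
Local Notation FX := (frakX k (prod_weight g)).
Local Notation K := (ker_K k (prod_weight g)).
Local Notation A l y := (tail_sec k g a l y).

Hypothesis X_anchor : FX (anchor a).
Variable Hu : forall u : {fset nat}, rkhs [set: E] (ker_u k u).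
Variable HK : rkhs FX K.
Variable mu : probability E R.
Hypothesis mu_prod : is_product_measure rho mu.

Variable us : nat -> {fset nat}.
Hypothesis us_enum : decreasing_enum (prod_weight g) (gamma_hat k a (prod_weight g)) us.
Variable dec : R.
Hypothesis us_decay : decay (gamma_hat k a (prod_weight g)) us = dec%:E.

Variable L : nat -> nat.
Hypothesis L1 : (1 <= L 1)%N.
Hypothesis L_incr : forall l, (1 <= l)%N -> (L l < L l.+1)%N.
Variables (b c1 c2 : R).
Hypotheses (b1 : 1 < b) (c10 : 0 < c1).
Hypothesis L_Theta : forall l, (1 <= l)%N -> c1 * b ^+ l <= (L l)%:R <= c2 * b ^+ l.

Variables (dollar : nat -> R) (s cd : R).
Hypothesis dollar_ge0 : forall n, 0 <= dollar n.
Hypothesis s0 : 0 < s.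
Hypothesis dollar_le : forall n, (1 <= n)%N -> dollar n <= cd * n%:R `^ s.

Variables (dO : measure_display) (Om : measurableType dO) (P : probability Om R).
Variable Pw : forall w : {fset nat}, probability (prodspace w Om) R.
Hypothesis Pw_prod : forall w, is_product_measure P (Pw w).
Variable Q : forall l n, rule R Om D (level_set L l) n.
Hypothesis Q_weight : forall l n, (1 <= l)%N -> (1 <= n)%N ->
  \sum_(i < n) weight (Q l n) i = 1.
Hypothesis Q_star : forall l n, (1 <= l)%N -> (1 <= n)%N ->
  condition_star rho (Pw (level_set L l))
    [set u | (u `<=` level_set L l)%fset] (node (Q l n)).

Variables (dT : measure_display) (T : measurableType dT) (PT : probability T R).
Variable xi : forall l, T -> prodspace (level_set L l) Om.
Arguments xi : clear implicits.
Hypothesis xi_law : forall l, has_law PT (Pw (level_set L l)) (xi l).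
Hypothesis xi_indep : independent_elements PT xi.

Let g_gt0 j : 0 < g j.
Proof. exact: (weights_gt0 g_ge0 g_noninc us_enum). Qed.

Definition sqr_error m n : \bar R := (rand_error mu FX (rkhs_ball HK) PT
  (ml_eval (v := level_set L) (anchor a) Q xi m n) ^+ 2)%E.

Definition cost m n : \bar R := vss_cost dollar FX (rkhs_ball HK) PT
  (ml_points (v := level_set L) (anchor a) Q xi m n).

Let A1 l : 1 <= A l (anchor a).
Proof. exact: tail_sec_ge1. Qed.

Let L_gt0 l : (1 <= l)%N -> (1 <= L l)%N.
Proof.
by case: l => // l _; elim: l => // l /leq_trans; apply; exact/ltnW/L_incr.
Qed.

Let Q_good l n i : (1 <= l)%N -> (1 <= n)%N ->
  good_node rho (Pw (level_set L l)) (node (Q l n) i).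
Proof.
move=> l1 n1; split; first exact: node_measurable.
by move=> j; exact: (Q_star l1 n1 (fsubset_refl _) (valP j) i).
Qed.

Section bounds.
Variables (C : {fset nat} -> nat -> R) (tau' tau p : R).
Hypothesis tau_le : tau <= tau'.
Hypothesis Q_bounds : level_bounds Pw Hu (prod_weight g) us (anchor a) Q C tau' p.

(** The assumed constants may be negative. Truncation at 0 preserves the bounds and allows the
    exponent [tau'] to be relaxed to [tau] and single terms to be bounded by sums. *)
Let Cp u l := Num.max (C u l) 0.

Let Cp_weight u l c : C u l * prod_weight g u <= c -> 0 <= c -> Cp u l * prod_weight g u <= c.
Proof.
move=> h c0; rewrite /Cp /Num.max; case: ifP => // _.
by rewrite mul0r.
Qed.

(* Level 1 involves only finitely many u, whence a finite constant. *)
Let B0 := \sum_(u <- subsets (L 1)) Cp u 1 * prod_weight g u.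

Definition bound_high (h : R) l : R :=
  if l == 1%N then B0 else h * (L l.-1)%:R `^ (1 - p).

Definition bound_rate (n : nat -> nat) l : R := (n l).-1%:R `^ (- tau).

Let B0_ge0 : 0 <= B0.
Proof.
by apply: sumr_ge0 => u _; rewrite mulr_ge0 ?prod_weight_ge0// /Cp le_max lexx orbT.
Qed.

Lemma sqr_error_le : exists h c : R, [/\ 0 <= h, 0 <= c & forall m n, (1 <= m)%N ->
  (forall l, (2 <= n l)%N) ->
  (sqr_error m n <= ((A (L m) (anchor a) - 1) + \sum_(1 <= l < m.+1)
     level_error k g a L (bound_high h) (fun=> c) (bound_rate n) l)%:E)%E].
Proof.
have [Qvar [h hhigh] [c hlow]] := Q_bounds.
exists (`|h|), (`|c|); split=> // m n m1 n2; apply: rand_error_sqr_le.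
  by exists (fun=> 0); split; [exact: rkhs_zero|rewrite /rkhs_norm ip0l ?sqrtr0//; exact: rkhs_zero].
move=> f [Cf fn]; have f1 : sqn HK f <= 1.
  move: fn; rewrite /rkhs_norm -/(sqn HK f) -[X in _ <= X -> _]sqrtr1 ler_sqrt//.
have sub l u : (1 <= l)%N -> u \in subsets (L l) -> (u `<=` level_set L l)%fset.
  by move=> l1 /mem_subsetsP ul; apply/fsubsetP => j /ul; rewrite level_setE.
have cp0 u l : 0 <= Cp u l by rewrite /Cp le_max lexx orbT.
apply: (multilevel_error k_psd g_gt0 k_meas k_trace k_mean gM X_anchor (Hu := Hu)
  (HK := HK) mu_prod L_incr Pw_prod xi_law xi_indep m1 _ _ (C := Cp)) => //.
- by move=> l i /andP[l1 _]; apply: Q_good => //; exact: ltnW.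
- by move=> l /andP[l1 _]; apply: Q_weight => //; exact: ltnW.
- by move=> l; exact: powR_ge0.
- move=> l; rewrite /bound_high; case: ifP => _; first exact: B0_ge0.
  by rewrite mulr_ge0 ?powR_ge0.
- move=> l u f' /andP[l1 _] ul u0 Cf'.
  apply: le_trans (Qvar l (n l) u f' l1 (n2 l) (sub l u l1 ul) Cf') _.
  rewrite lee_fin /rkhs_norm sqr_sqrtr; last exact: rkhs_inner_ge0.
  rewrite ler_wpM2r ?sqn_ge0//.
  apply: (@le_trans _ _ (Cp u l * (n l).-1%:R `^ (- tau'))).
    by rewrite ler_wpM2r ?powR_ge0// /Cp le_max lexx.
  rewrite ler_wpM2l// /bound_rate ler_powR ?lerN2// ler1n.
  by move: (n2 l); case: (n l).
- move=> l u /andP[l1 _] ul unl u0; rewrite /bound_high; move: unl; rewrite /low_sets.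
  case: eqVneq => [l1'|l2] unl.
    rewrite /B0 -l1' (bigD1_seq u)//=; last exact: subsets_uniq.
    rewrite lerDl; apply: sumr_ge0 => w _.
    by rewrite mulr_ge0 ?prod_weight_ge0.
  have l2' : (2 <= l)%N by rewrite ltn_neqAle eq_sym l2.
  have l1' : (1 <= l.-1)%N by rewrite -ltnS prednK.
  have [j uj] : exists j, us j = u.
    have [_ us_pos _] := us_enum; apply: (us_pos u).2; split=> //.
    exact: prod_weight_gt0.
  apply: Cp_weight; last by rewrite mulr_ge0 ?powR_ge0.
  rewrite -uj; apply: (le_trans (hhigh l j l2' _)); last first.
    by rewrite ler_wpM2r ?powR_ge0// ler_norm.
  split=> /=; rewrite uj; first exact: sub.
  apply/negP; apply: contra unl => /fsubsetP h'; apply/mem_subsetsP => i iu.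
  by rewrite -level_setE//; exact: h'.
- move=> l u /andP[l1 _] ul; rewrite /low_sets; case: eqVneq => [//|l2] ulo u0.
  have l2' : (2 <= l)%N by rewrite ltn_neqAle eq_sym l2.
  have l1' : (1 <= l.-1)%N by rewrite -ltnS prednK.
  apply: Cp_weight => //; apply: le_trans (hlow l u l1 u0 _) (ler_norm _).
  exact: sub.
Qed.

Hypotheses (p1 : 1 < p) (p_dec : p < dec) (tau0 : 0 <= tau).

Let G := b `^ (1 - p).

Let G0 : 0 < G. Proof. by rewrite powR_gt0// (lt_trans ltr01). Qed.

Let L_decay l : (1 <= l)%N -> (L l)%:R `^ (1 - p) <= c1 `^ (1 - p) * G ^+ l.
Proof.
move=> l1; have b0 : 0 < b by rewrite (lt_trans ltr01).
rewrite /G -powR_exprn ?(ltW b0)//; have -> : 1 - p = - (p - 1) by rewrite opprB.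
rewrite -powRM ?exprn_ge0 ?(ltW b0) ?(ltW c10)//.
apply: powR_anti; first by rewrite subr_ge0 ltW.
  by rewrite mulr_gt0 ?exprn_gt0.
by have /andP[] := L_Theta l1.
Qed.

(** New sets contribute through the decay of their constants, old sets through the decay of the tail
    differences; both are of order [G ^+ l], so one constant covers all levels. *)
Lemma sqr_error_rate : exists2 c : R, 0 <= c & forall m n, (1 <= m)%N ->
  (forall l, (2 <= n l)%N) ->
  (sqr_error m n <= (c * (G ^+ m +
     \sum_(1 <= l < m.+1) (n l)%:R `^ (- tau) * G ^+ l))%:E)%E.
Proof.
have [h [c [h0 c0 err]]] := sqr_error_le.
have [t t0 tail] := tail_sec_decay k_diag g_ge0 g_noninc us_enum us_decay k_psd X_anchor p1 p_dec.
pose K1 := c1 `^ (1 - p); have K10 : 0 <= K1 by exact: powR_ge0.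
pose A0 := A 0 (anchor a); have A00 : 0 <= A0 by exact: le_trans (A1 0).
have A_anti l l' : (l <= l')%N -> A l' (anchor a) <= A l (anchor a).
  by move=> ll'; exact: tail_sec_anti.
have G_step l : (2 <= l)%N -> (L l.-1)%:R `^ (1 - p) <= K1 / G * G ^+ l.
  case: l => // -[//|l] _; rewrite exprS mulrA divfK ?gt_eqF//.
  exact: L_decay.
(* Dividing by [G] absorbs the shift from [L l.-1] to level [l], and it also fits the separate
   constant of level 1 to [G ^+ 1]. *)
have high l : (1 <= l)%N -> bound_high h l <= (B0 / G + h * (K1 / G)) * G ^+ l.
  move=> l1; rewrite /bound_high; case: eqVneq => [->|l2].
    rewrite expr1 mulrDl divfK ?gt_eqF// lerDl !mulr_ge0// ?invr_ge0 ltW//.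
  have l2' : (2 <= l)%N by rewrite ltn_neqAle eq_sym l2.
  apply: (@le_trans _ _ (h * (K1 / G * G ^+ l))); first by rewrite ler_wpM2l// G_step.
  rewrite mulrDl mulrA lerDr mulr_ge0 ?exprn_ge0 ?divr_ge0 ?(ltW G0)//.
have low l : (1 <= l)%N ->
    A (if l == 1%N then 0%N else L l.-1) (anchor a) - A (L l) (anchor a) <=
    (A0 / G + t * (K1 / G)) * G ^+ l.
  move=> l1; case: eqVneq => [->|l2].
    rewrite expr1 mulrDl divfK ?gt_eqF//.
    apply: (@le_trans _ _ A0).
      by rewrite gerBl; exact: le_trans (A1 _).
    by rewrite lerDl !mulr_ge0// ?invr_ge0 ltW.
  have l2' : (2 <= l)%N by rewrite ltn_neqAle eq_sym l2.
  have l1' : (1 <= l.-1)%N by rewrite -ltnS prednK.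
  apply: (@le_trans _ _ (A (L l.-1) (anchor a) - 1)); first by rewrite lerB.
  apply: le_trans (tail _ (L_gt0 l1')) _.
  apply: (@le_trans _ _ (t * (K1 / G * G ^+ l))); first by rewrite ler_wpM2l// G_step.
  by rewrite mulrDl mulrA lerDr mulr_ge0 ?exprn_ge0 ?divr_ge0 ?(ltW G0).
pose kap1 := B0 / G + h * (K1 / G); pose kap2 := A0 / G + t * (K1 / G).
have kap10 : 0 <= kap1 by rewrite addr_ge0 ?mulr_ge0 ?invr_ge0 ?(ltW G0)//; exact: B0_ge0.
have kap20 : 0 <= kap2 by rewrite addr_ge0 ?mulr_ge0 ?invr_ge0 ?(ltW G0).
(* For at least two nodes [n - 1 >= n / 2], which costs this factor. *)
pose e := 2^-1 `^ (- tau); have e0 : 0 <= e by exact: powR_ge0.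
pose kap := kap1 * A0 + c * kap2.
have kap0 : 0 <= kap by rewrite addr_ge0 ?mulr_ge0.
exists (t * K1 + e * kap); first by rewrite addr_ge0 ?mulr_ge0.
move=> m n m1 n2; apply: le_trans (err m n m1 n2) _; rewrite lee_fin.
have S0 : 0 <= \sum_(1 <= l < m.+1) (n l)%:R `^ (- tau) * G ^+ l.
  by apply: sumr_ge0 => l _; rewrite mulr_ge0 ?powR_ge0 ?exprn_ge0 ?(ltW G0).
have Gm : 0 <= G ^+ m by rewrite exprn_ge0 ?(ltW G0).
have h1 : A (L m) (anchor a) - 1 <= t * K1 * G ^+ m.
  apply: le_trans (tail _ (L_gt0 m1)) _; rewrite -mulrA ler_wpM2l//.
  exact: L_decay.
have h2 : \sum_(1 <= l < m.+1) level_error k g a L (bound_high h) (fun=> c) (bound_rate n) l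
    <= e * kap * \sum_(1 <= l < m.+1) (n l)%:R `^ (- tau) * G ^+ l.
  rewrite mulr_sumr big_nat [leRHS]big_nat; apply: ler_sum => l /andP[l1 _].
  have r1 : bound_rate n l <= e * (n l)%:R `^ (- tau).
    rewrite /bound_rate /e -powRM//; apply: powR_anti => //.
      by rewrite mulr_gt0// ltr0n; exact: ltnW.
    rewrite ler_pdivrMl// -natrM ler_nat mul2n -addnn.
    by move: (n2 l); case: (n l) => // -[|i] _ //=; rewrite addnS ltnS leq_addr.
  rewrite /level_error (_ : e * kap * _ = (e * (n l)%:R `^ (- tau)) * (kap * G ^+ l)); last by ring.
  have X0 : 0 <= bound_high h l.
    rewrite /bound_high; case: ifP => _; first exact: B0_ge0.
    by rewrite mulr_ge0 ?powR_ge0.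
  have Y0 : 0 <= A (if l == 1%N then 0%N else L l.-1) (anchor a) - A (L l) (anchor a).
    rewrite subr_ge0; apply: A_anti; move: l1; case: (l) => // -[|i] _ //=.
    exact/ltnW/L_incr.
  apply: ler_pM => //; first exact: powR_ge0.
    by rewrite addr_ge0 ?mulr_ge0// (le_trans _ (A1 _)).
  rewrite /kap mulrDl; apply: lerD; last by rewrite -mulrA ler_wpM2l// low.
  rewrite mulrAC; apply: ler_pM => //; [exact: le_trans (A1 _)|exact: high|exact: A_anti].
apply: le_trans (lerD h1 h2) _; rewrite mulrDl; apply: lerD.
  by rewrite ler_wpM2l ?mulr_ge0// lerDl.
by rewrite ler_wpM2l ?mulr_ge0// lerDr.
Qed.

End bounds.

Lemma cost_rate : exists2 c : R, 0 <= c & forall m n,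
  (cost m n <= (c * \sum_(1 <= l < m.+1) (n l)%:R * (b `^ s) ^+ l)%:E)%E.
Proof.
have b0 : 0 < b by rewrite (lt_trans ltr01).
exists (2 * (`|cd| * `|c2| `^ s)) => [|m n]; first by rewrite !mulr_ge0 ?powR_ge0.
apply: le_trans (multilevel_cost dollar_ge0 L1 L_incr Q PT xi _ m n X_anchor) _.
rewrite lee_fin mulr_sumr big_nat [leRHS]big_nat; apply: ler_sum => l /andP[l1 _].
rewrite [leRHS](_ : _ = 2 * (n l)%:R * (`|cd| * `|c2| `^ s * (b `^ s) ^+ l)); last by ring.
rewrite ler_wpM2l//; apply: le_trans (dollar_le (L_gt0 l1)) _.
apply: (@le_trans _ _ (`|cd| * (L l)%:R `^ s)); first by rewrite ler_wpM2r ?powR_ge0// ler_norm.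
rewrite -mulrA ler_wpM2l// -powR_exprn ?(ltW b0)// -powRM ?exprn_ge0 ?(ltW b0)//.
have /andP[_ Ll] := L_Theta l1.
rewrite ge0_ler_powR ?nnegrE ?mulr_ge0 ?exprn_ge0 ?(ltW b0) ?(ltW s0)//.
by apply: le_trans Ll _; rewrite ler_wpM2r ?exprn_ge0 ?(ltW b0)// ler_norm.
Qed.

Definition achievable r := exists (C : R) (N0 : nat), forall N : nat, (N0 <= N)%N ->
  exists (m : nat) (n : nat -> nat),
    [/\ [/\ (1 <= m)%N, forall l, (1 <= n l)%N & forall l, (n l.+1 <= n l)%N],
        (cost m n <= N%:R%:E)%E & (sqr_error m n <= (C * N%:R `^ r)%:E)%E].

Lemma cost_one_level : exists N0 : nat, forall N : nat, (N0 <= N)%N ->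
  (cost 1 (fun=> 2%N) <= N%:R%:E)%E.
Proof.
have [c c0 hc] := cost_rate; set S := \sum_(1 <= l < 2) 2%:R * (b `^ s) ^+ l : R.
exists (Num.truncn (c * S)).+1 => N hN; apply: le_trans (hc _ _) _; rewrite lee_fin -/S ltW//.
by apply: lt_le_trans (truncnS_gt _) _; rewrite ler_nat.
Qed.

(** For a nonnegative exponent a bounded error is enough, so one level with two nodes serves every
    large [N]; [N0.+1] ensures [N >= 1]. *)
Lemma achievable_ge0 C tau p r :
  level_bounds Pw Hu (prod_weight g) us (anchor a) Q C tau p -> 0 <= r -> achievable r.
Proof.
move=> QC r0; have [h [c [h0 c0 err]]] := sqr_error_le (lexx tau) QC.
have [N0 cN] := cost_one_level.
have := err 1%N (fun=> 2%N) isT (fun=> isT); set e := (_ + _)%R => he.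
exists `|e|, N0.+1 => N hN; exists 1%N, (fun=> 2%N); split => //; first exact/cN/ltnW.
apply: le_trans he _; rewrite lee_fin (le_trans (ler_norm e))// ler_peMr//.
by rewrite -[leLHS](powRr0 (N%:R : R)) ler_powR// ler1n (leq_ltn_trans _ hN).
Qed.

Lemma achievable_allocation C tau' tau p r :
  level_bounds Pw Hu (prod_weight g) us (anchor a) Q C tau' p ->
  tau <= tau' -> 1 < p -> p < dec -> 0 <= tau ->
  allocation b s tau p r -> achievable (- r).
Proof.
move=> QC tt p1 pd t0 [ca [x0 [ca0 x00 alloc]]].
have [ce ce0 err] := sqr_error_rate tt QC p1 pd t0; have [cc cc0 costP] := cost_rate.
(* The budget is [x = N / K1], so that the cost [cc * ca * x] stays below [N]; the summand 1 makes
   the division legitimate. *)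
pose K1 := cc * ca + 1; have K10 : 0 < K1 by rewrite ltr_wpDl// mulr_ge0.
exists (ce * (ca * K1^-1 `^ (- r))), (Num.truncn (K1 * x0)).+1 => N hN.
have N0 : x0 <= N%:R / K1.
  rewrite ler_pdivlMr// mulrC ltW// (lt_le_trans (truncnS_gt _))// ler_nat//.
have [m [n [m1 n2 nn hcost herr]]] := alloc _ N0.
exists m, n; split; first by split => // l; exact: ltnW.
  apply: le_trans (costP m n) _; rewrite lee_fin; apply: le_trans (ler_wpM2l cc0 hcost) _.
  rewrite !mulrA ler_pdivrMr// mulrC ler_wpM2l// /K1 lerDl//.
apply: le_trans (err m n m1 n2) _; rewrite lee_fin -mulrA ler_wpM2l//.
apply: le_trans herr _; rewrite -mulrA ler_wpM2l// [N%:R / K1]mulrC powRM ?invr_ge0//.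
exact: ltW.
Qed.

(** The target [tau] may lie below the exponent [tau'] of the assumed bounds; this slack is used at
    the critical values of the decay. *)
Lemma smooth_rate C tau' tau p :
  level_bounds Pw Hu (prod_weight g) us (anchor a) Q C tau' p ->
  tau <= tau' -> p < dec -> tau * s < p - 1 -> achievable (- tau).
Proof.
move=> QC tt pd ts; have [t0|t0] := leP tau 0.
  by apply: achievable_ge0 QC _; rewrite oppr_ge0.
have p1 : 1 < p by rewrite -subr_gt0; apply: le_lt_trans ts; rewrite mulr_ge0 ?ltW.
exact: achievable_allocation QC tt p1 pd (ltW t0) (allocation_smooth b1 s0 t0 ts).
Qed.

Lemma rough_rate C tau p :
  level_bounds Pw Hu (prod_weight g) us (anchor a) Q C tau p ->
  p < dec -> p - 1 < tau * s -> achievable (- ((p - 1) / s)).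
Proof.
move=> QC pd ts; have [p1|p1] := leP p 1.
  by apply: achievable_ge0 QC _; rewrite oppr_ge0 pmulr_lle0 ?invr_gt0// subr_le0.
have t0 : 0 < tau by rewrite -(pmulr_lgt0 _ s0); apply: lt_trans ts; rewrite subr_gt0.
exact: achievable_allocation QC (lexx tau) p1 pd (ltW t0) (allocation_rough b1 s0 t0 p1 ts).
Qed.

Section rates.
Variables alpha delta : R.
Hypotheses (alpha1 : 1 <= alpha) (delta0 : 0 < delta).
Hypothesis Q_bounds : exists C, level_bounds Pw Hu (prod_weight g) us (anchor a) Q C
  (Num.min alpha dec - delta) (dec - delta * s).
Hypothesis Q_critical :
  (alpha - 1) / alpha <= s /\ dec = 1 + alpha * s \/
  s < (alpha - 1) / alpha /\ dec = 1 / (1 - s) ->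
  exists delta' : R, 0 < delta' < delta /\
  exists C, level_bounds Pw Hu (prod_weight g) us (anchor a) Q C
    (Num.min alpha dec - delta') (dec - delta' * s).

Let alpha0 : 0 < alpha. Proof. exact: lt_le_trans alpha1. Qed.

Let p_lt_dec d' : 0 < d' -> dec - d' * s < dec.
Proof. by move=> d0; rewrite gtrBl mulr_gt0. Qed.

(** For [tau = min(alpha, dec) - delta] and [p = dec - delta * s] the terms in [delta] cancel, and
    [tau * s < p - 1] becomes [min(alpha, dec) * s < dec - 1]. The thresholds [1 + alpha * s] and
    [1 / (1 - s)] are its boundary cases. *)
Lemma rate_cheap : 1 < dec -> (alpha - 1) / alpha <= s ->
  (1 + alpha * s <= dec -> achievable (- alpha + delta)) /\
  (dec < 1 + alpha * s -> achievable (- ((dec - 1) / s) + delta)).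
Proof.
move=> dec1 sa; have as1 : alpha - 1 <= alpha * s by rewrite mulrC -ler_pdivrMr.
split=> [|das].
  rewrite (_ : - alpha + delta = - (alpha - delta)); last by ring.
  rewrite le_eqVlt => /predU1P[das|das].
    (* At this value [tau * s = p - 1]. Keeping the target [alpha - delta] while [p] is taken with
       [d' < delta] makes the inequality strict. *)
    have [|d' [/andP[d'0 d'd] [C QC]]] := Q_critical; first by left.
    have m : Num.min alpha dec = alpha by apply/min_idPl; lra.
    rewrite m in QC; apply: (smooth_rate QC); [lra|exact: p_lt_dec|].
    by have : d' * s < delta * s; [rewrite ltr_pM2r|lra].
  have [C QC] := Q_bounds; have m : Num.min alpha dec = alpha by apply/min_idPl; lra.
  by rewrite m in QC; apply: (smooth_rate QC); [lra|exact: p_lt_dec|lra].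
have [C QC] := Q_bounds.
rewrite (_ : - _ + delta = - ((dec - delta * s - 1) / s)); last by field; rewrite gt_eqF.
apply: (rough_rate QC); first exact: p_lt_dec.
rewrite mulrBl; suff : dec - 1 < Num.min alpha dec * s by lra.
(* If [dec <= alpha], the claim is [dec * (1 - s) < 1], while [alpha * (1 - s) <= 1] is known.
   Equality would force [dec = alpha = 1 + alpha * s], against [das]. *)
rewrite /Num.min; case: ifP => [_|/negbT]; first lra.
rewrite -leNgt => da; rewrite -(ltr_pM2l alpha0).
nra.
Qed.

Lemma rate_costly : 1 < dec -> s < (alpha - 1) / alpha ->
  [/\ alpha <= dec -> achievable (- alpha + delta),
      1 / (1 - s) < dec -> dec < alpha -> achievable (- dec + delta) &
      dec <= 1 / (1 - s) -> achievable (- ((dec - 1) / s) + delta)].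
Proof.
move=> dec1 sa; have as1 : alpha * s < alpha - 1 by rewrite mulrC -ltr_pdivlMr.
have s1 : 0 < 1 - s by rewrite -(pmulr_rgt0 _ alpha0); lra.
have [C QC] := Q_bounds; split.
- move=> ad; rewrite (_ : - alpha + delta = - (alpha - delta)); last by ring.
  have m : Num.min alpha dec = alpha by exact/min_idPl.
  by rewrite m in QC; apply: (smooth_rate QC); [lra|exact: p_lt_dec|lra].
- move=> sd da; rewrite (_ : - dec + delta = - (dec - delta)); last by ring.
  have m : Num.min alpha dec = dec by apply/min_idPr/ltW.
  rewrite m in QC; apply: (smooth_rate QC); [lra|exact: p_lt_dec|].
  by move: sd; rewrite ltr_pdivrMr//; lra.
move=> ds; have da : dec < alpha.
  by apply: le_lt_trans ds _; rewrite ltr_pdivrMr//; lra.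
have m : Num.min alpha dec = dec by apply/min_idPr/ltW.
move: ds; rewrite le_eqVlt => /predU1P[ds|].
  (* Here [dec * (1 - s) = 1], so [(dec - 1) / s = dec]: the rough and the smooth exponents agree,
     and the smooth rate applies with the slack between [d'] and [delta]. *)
  have [|d' [/andP[d'0 d'd] [C' QC']]] := Q_critical; first by right.
  have ds1 : dec * (1 - s) = 1 by rewrite ds divfK ?gt_eqF.
  have -> : - ((dec - 1) / s) + delta = - (dec - delta).
    rewrite (_ : dec - 1 = dec * s); last by lra.
    by rewrite mulfK ?gt_eqF//; ring.
  rewrite m in QC'; apply: (smooth_rate QC'); [lra|exact: p_lt_dec|].
  by have : d' * s < delta * s; [rewrite ltr_pM2r|lra].
rewrite ltr_pdivlMr// => ds; rewrite m in QC.
rewrite (_ : - _ + delta = - ((dec - delta * s - 1) / s)); last by field; rewrite gt_eqF.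
by apply: (rough_rate QC); [exact: p_lt_dec|lra].
Qed.

End rates.
End assembly.

Theorem theorem4p5 (R : realType)
  (* the domain D, a point a of D, and the product measure *)
  (D : set R) (a : D)
  (rho : probability (trace_space a) R)
  (mu : probability (prodspace nat (trace_space a)) R)
  (Hmu : is_product_measure rho mu)
  (* the kernel *)
  (k : trace_space a -> trace_space a -> R)
  (Hk_kernel : reproducing_kernel k)
  (Hk_meas : measurable_fun setT
     (fun z : trace_space a * trace_space a => k z.1 z.2))
  (Hk_neq0 : exists x y, k x y != 0)
  (Hk1 : rkhs setT k)
  (H1 : rkhs setT (fun _ _ : trace_space a => 1 : R))
  (Hk1_cap : rkhs_carrier Hk1 `&` rkhs_carrier H1 = [set fun=> 0])
  (M : R) (HM : (\int[rho]_x (k x x)%:E = M%:E)%E)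
  (Hk_int0 : forall y, (\int[rho]_x (k x y)%:E = 0)%E)
  (Hk_diag : forall x, 0 < k x x)
  (* the product weights *)
  (g : nat -> R)
  (Hg_ge0 : forall j, 0 <= g j)
  (Hg_noninc : forall i j, (i <= j)%N -> g j <= g i)
  (HgM : (\esum_(u in [set: {fset nat}])
            (prod_weight g u * M ^+ #|` u|)%:E < +oo)%E)
  (* the function spaces *)
  (Hu : forall u : {fset nat}, rkhs setT (ker_u k u))
  (HK : rkhs (frakX k (prod_weight g)) (ker_K k (prod_weight g)))
  (* the anchor *)
  (Ha : (\esum_(u in [set: {fset nat}])
           (gamma_hat k (base a) (prod_weight g) u)%:E < +oo)%E)
  (* the ordering of the sets u, and the decay *)
  (us : nat -> {fset nat})
  (Hus : decreasing_enum (prod_weight g)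
           (gamma_hat k (base a) (prod_weight g)) us)
  (dec : R)
  (Hdec : decay (gamma_hat k (base a) (prod_weight g)) us = dec%:E)
  (* the levels *)
  (L : nat -> nat)
  (HL_pos : (1 <= L 1)%N)
  (HL_incr : forall l, (1 <= l)%N -> (L l < L l.+1)%N)
  (b : R) (Hb : 1 < b)
  (HL_Theta : exists c1 c2 : R, 0 < c1 /\ forall l, (1 <= l)%N ->
     c1 * b ^+ l <= (L l)%:R <= c2 * b ^+ l)
  (* the cost function *)
  (dollar : nat -> R)
  (Hd_ge0 : forall n, 0 <= dollar n)
  (Hd_incr : forall n n', (n <= n')%N -> dollar n <= dollar n')
  (s : R) (Hs : 0 < s)
  (Hd_O : exists c : R, forall n, (1 <= n)%N -> dollar n <= c * n%:R `^ s)
  (alpha delta : R) (Halpha : 1 <= alpha) (Hdelta : 0 < delta)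
  (* the building blocks *)
  (dO : measure_display) (Omega : measurableType dO) (P : probability Omega R)
  (Pw : forall w : {fset nat}, probability (prodspace w Omega) R)
  (HPw : forall w, is_product_measure P (Pw w))
  (Q : forall l n, rule R Omega (trace_space a) (level_set L l) n)
  (HQ_weights : forall l n, (1 <= l)%N -> (1 <= n)%N ->
     \sum_(i < n) weight (Q l n) i = 1)
  (HQ_star : forall l n, (1 <= l)%N -> (1 <= n)%N ->
     condition_star rho (Pw (level_set L l))
       [set u | (u `<=` level_set L l)%fset] (node (Q l n)))
  (HQ_bounds : exists C, level_bounds Pw Hu (prod_weight g) us (fun=> base a) Q C
     (Num.min alpha dec - delta) (dec - delta * s))
  (* at the two critical values of the decay, the same with some smaller delta *)
  (HQ_critical :
     (alpha - 1) / alpha <= s /\ dec = 1 + alpha * s \/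
     s < (alpha - 1) / alpha /\ dec = 1 / (1 - s) ->
     exists delta' : R, 0 < delta' < delta /\
     exists C, level_bounds Pw Hu (prod_weight g) us (fun=> base a) Q C
       (Num.min alpha dec - delta') (dec - delta' * s))
  (* independent randomness for the levels *)
  (dT : measure_display) (T : measurableType dT) (PT : probability T R)
  (xi : forall l, T -> prodspace (level_set L l) Omega)
  (Hxi_meas : forall l, measurable_fun setT (xi l))
  (Hxi_law : forall l (B : set (prodspace (level_set L l) Omega)),
     measurable B -> PT (xi l @^-1` B) = Pw (level_set L l) B)
  (Hxi_indep : independent_elements PT xi) :
  exists (C : R) (N0 : nat), forall N : nat, (N0 <= N)%N ->
  exists (m : nat) (n : nat -> nat),
    let X := frakX k (prod_weight g) in
    let B := rkhs_ball HK in
    let cost := vss_cost dollar X B PT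
                  (ml_points (v := level_set L) (fun=> base a) Q xi m n) in
    let e := rand_error mu X B PT
               (ml_eval (v := level_set L) (fun=> base a) Q xi m n) in
    let e2_le := fun r : R => (e ^+ 2 <= (C * N%:R `^ r)%:E)%E in
    [/\ [/\ (1 <= m)%N, forall l, (1 <= l <= m)%N -> (1 <= n l)%N &
          forall l, (1 <= l < m)%N -> (n l.+1 <= n l)%N],
        (cost <= N%:R%:E)%E,
        (alpha - 1) / alpha <= s ->
          (1 + alpha * s <= dec -> e2_le (- alpha + delta)) /\
          (1 < dec < 1 + alpha * s -> e2_le (- ((dec - 1) / s) + delta)) &
        s < (alpha - 1) / alpha ->
          [/\ alpha <= dec -> e2_le (- alpha + delta),
              1 / (1 - s) < dec < alpha -> e2_le (- dec + delta) &
              1 < dec <= 1 / (1 - s) -> e2_le (- ((dec - 1) / s) + delta)]].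
Proof.
have [c1 [c2 [c10 HLT]]] := HL_Theta; have [cd Hd] := Hd_O.
have X_anchor : frakX k (prod_weight g) (anchor (base a)).
  rewrite /frakX /=; move: Ha; congr (_ < _)%E; apply: eq_esum => u _.
  rewrite /gamma_hat /ker_u; congr (_ * _)%:E.
  by rewrite (eq_bigr (fun=> k (base a) (base a)))// big_const_seq count_predT iter_mulr_1.
have xi_law l : has_law PT (Pw (level_set L l)) (xi l) by split => // B; exact: Hxi_law.
have k_psd := kernel_psd Hk_kernel.
have as0 : 0 < alpha by exact: lt_le_trans Halpha.
(* For [dec <= 1] every error clause has a contradictory premise, and only the cost remains to be
   met, by a single level. *)
have [dec1|dec1] := leP dec 1.
  have [N0 cN] := cost_one_level X_anchor HK HL_pos HL_incr Hb HLT Hd_ge0 Hs Hd Q PT xi.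
  exists 0, N0 => N /cN hN; exists 1%N, (fun=> 2%N); split => //.
    move=> _; split=> // /le_trans/(_ dec1).
    by rewrite gerDl leNgt mulr_gt0.
  move=> sa; have s1 : 0 < alpha * (1 - s).
    by move: sa; rewrite ltr_pdivlMr//; lra.
  have s1' : 1 < 1 / (1 - s).
    by rewrite ltr_pdivlMr ?mul1r; [lra|rewrite -(pmulr_rgt0 _ as0)].
  have a1 : 1 < alpha.
    by move: sa; rewrite ltr_pdivlMr//; have := mulr_gt0 Hs as0; lra.
  split=> // [ad|/andP[h _]]; first by move: (le_trans ad dec1); rewrite leNgt a1.
  by move: (lt_le_trans (lt_trans s1' h) dec1); rewrite ltxx.
have rates r : achievable (base a) HK mu dollar Q PT xi r ->
  exists (C : R) (N0 : nat), forall N : nat, (N0 <= N)%N ->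
  exists (m : nat) (n : nat -> nat),
    [/\ [/\ (1 <= m)%N, forall l, (1 <= l <= m)%N -> (1 <= n l)%N &
          forall l, (1 <= l < m)%N -> (n l.+1 <= n l)%N],
       (cost (base a) HK dollar Q PT xi m n <= N%:R%:E)%E &
       (sqr_error (base a) HK mu Q PT xi m n <= (C * N%:R `^ r)%:E)%E].
  move=> [C [N0 h]]; exists C, N0 => N /h[m [n [[m1 n1 nn] hc he]]]; exists m, n.
  by split=> //; split.
have cheap := rate_cheap k_psd (Hk_diag (base a)) Hg_ge0 Hg_noninc Hk_meas HM Hk_int0
  HgM X_anchor HK Hmu Hus Hdec HL_pos HL_incr Hb c10 HLT Hd_ge0 Hs Hd HPw HQ_weights
  HQ_star xi_law Hxi_indep Halpha Hdelta HQ_bounds HQ_critical dec1.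
have costly := rate_costly k_psd (Hk_diag (base a)) Hg_ge0 Hg_noninc Hk_meas HM Hk_int0
  HgM X_anchor HK Hmu Hus Hdec HL_pos HL_incr Hb c10 HLT Hd_ge0 Hs Hd HPw HQ_weights
  HQ_star xi_law Hxi_indep Halpha Hdelta HQ_bounds HQ_critical dec1.
(* [C], [N0], [m] and [n] must serve all clauses at once. For given [s] and [dec] exactly one clause
   has satisfiable premises, so its parameters are taken. *)
have [sa|sa] := leP ((alpha - 1) / alpha) s.
  have [smooth rough] := cheap sa; have [ds|ds] := leP (1 + alpha * s) dec.
    have [C [N0 h]] := rates _ (smooth ds); exists C, N0 => N /h[m [n [mn hc he]]].
    by exists m, n; split=> // _; split=> //; rewrite andbF.
  have [C [N0 h]] := rates _ (rough ds); exists C, N0 => N /h[m [n [mn hc he]]].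
  by exists m, n; split=> // _; split.
have [top mid low] := costly sa.
(* Separates the first and the last regime of the costly case, which would otherwise overlap. *)
have d1 : 1 / (1 - s) < alpha.
  have e : 1 < alpha * (1 - s) by move: sa; rewrite ltr_pdivlMr//; lra.
  by rewrite ltr_pdivrMr// -(pmulr_rgt0 _ as0); lra.
have [ad|ad] := leP alpha dec.
  have [C [N0 h]] := rates _ (top ad); exists C, N0 => N /h[m [n [mn hc he]]].
  exists m, n; split=> // _; split=> //; first by rewrite andbF.
  by move=> /andP[_ ds]; move: (le_lt_trans (le_trans ad ds) d1); rewrite ltxx.
have [ds|ds] := leP dec (1 / (1 - s)).
  have [C [N0 h]] := rates _ (low ds); exists C, N0 => N /h[m [n [mn hc he]]].
  by exists m, n; split=> // _; split.
have [C [N0 h]] := rates _ (mid ds ad); exists C, N0 => N /h[m [n [mn hc he]]].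
by exists m, n; split=> // _; split=> //; rewrite andbF.
Qed.
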